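(* $\Psi\in\mathrm{MAVal}_k(\mathbb{R}^n)$ is $\mathrm{GL}(n,\mathbb{R})$-equivariant with weight $q\in \mathbb{R}$ if and only if \begin{itemize} \item $k=0$, $q=-1$ and $\Psi$ is a multiple of the Lebesgue measure, or \item $k=n$, $q=1$ and $\Psi$ is a multiple of the real Monge-Amp\`ere operator. \end{itemize}
   Context: $\mathrm{MAVal}_k(\mathbb{R}^n)$ is the space of continuous valuations $\Psi:\mathrm{Conv}(\mathbb{R}^n,\mathbb{R})\to\mathcal{M}(\mathbb{R}^n)$ (finite-valued convex functions with locally uniform convergence, complex Radon measures with weak*-topology) that are dually epi-translation invariant, locally determined, translation equivariant and $k$-homogeneous. $\mathrm{GL}(n,\mathbb{R})$ acts by $[g\cdot\Psi](f)[B]=\Psi(f\circ g)[g^{-1}B]$, and $\Psi$ is $\mathrm{GL}(n,\mathbb{R})$-equivariant with weight $q$ if $g\cdot\Psi=|\det(g)|^q\Psi$ for all $g\in\mathrm{GL}(n,\mathbb{R})$.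
   Formalization: The formal statement assumes that Ψ is not identically zero and that n ≥ 1, since the zero valuation is equivariant with every weight q for every k, and for n = 0 the group GL(0,ℝ) is trivial, so every weight q occurs. *)

(* Defs.v *)
From HB Require Import structures.
From mathcomp Require Import all_boot all_order all_algebra.
From mathcomp Require Import complex.
From mathcomp Require Import all_classical all_reals all_analysis.
Set Implicit Arguments. Unset Strict Implicit. Unset Printing Implicit Defensive.
Import Order.TTheory GRing.Theory Num.Theory.
Import numFieldNormedType.Exports.
Local Open Scope classical_set_scope.
Local Open Scope ring_scope.
Local Open Scope complex_scope.

Section MAVal.
Variable R : realType.

Notation V n := 'rV[R]_n.

Definition vdot n (x y : V n) : R := \sum_i x ord0 i * y ord0 i.

Definition convex_fun n (f : V n -> R) : Prop :=
  forall (x y : V n) (t : R), 0 <= t <= 1 ->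
    f ((1 - t) *: x + t *: y) <= (1 - t) * f x + t * f y.

Definition Cc n (phi : V n -> R) : Prop :=
  continuous phi /\ exists K : set (V n), compact K /\ forall x, ~ K x -> phi x = 0.

(* A complex Radon measure on R^n, viewed (Riesz) as a linear functional on
   C_c(R^n) (real test functions, complex values) that is continuous for the
   inductive-limit topology: on functions supported in a fixed compact K it is
   bounded by a constant times the sup norm. Values outside C_c are irrelevant. *)
Definition radon n (mu : (V n -> R) -> R[i]) : Prop :=
  (forall (phi psi : V n -> R) (a b : R), Cc phi -> Cc psi ->
     mu (fun x => a * phi x + b * psi x) = a%:C * mu phi + b%:C * mu psi) /\
  (forall K : set (V n), compact K -> exists C : R,
     forall (phi : V n -> R) (M : R), Cc phi -> (forall x, ~ K x -> phi x = 0) ->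
       (forall x, `|phi x| <= M) ->
       `|(complex.Re (mu phi) : R)| + `|(complex.Im (mu phi) : R)| <= C * M).

Definition weak_star_cvg n (mu : nat -> (V n -> R) -> R[i]) (nu : (V n -> R) -> R[i]) :=
  forall phi : V n -> R, Cc phi ->
    (fun j => complex.Re (mu j phi)) @ \oo --> complex.Re (nu phi) /\
    (fun j => complex.Im (mu j phi)) @ \oo --> complex.Im (nu phi).

Definition loc_unif_cvg n (f : nat -> V n -> R) (g : V n -> R) : Prop :=
  forall K : set (V n), compact K -> forall e : R, 0 < e ->
    exists N : nat, forall j : nat, (N <= j)%N -> forall x, K x -> `|f j x - g x| < e.

(* A map Psi : Conv(R^n,R) -> M(R^n). Its values on non-convex functions are
   irrelevant: every condition below only concerns convex arguments. *)
Definition mval n := (V n -> R) -> (V n -> R) -> R[i].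

Definition MAVal n (k : nat) (Psi : mval n) : Prop :=
  (forall f, convex_fun f -> radon (Psi f)) /\
  (forall f h, convex_fun f -> convex_fun h ->
     convex_fun (fun x => Num.min (f x) (h x)) ->
     forall phi, Cc phi ->
       Psi (fun x => Num.max (f x) (h x)) phi + Psi (fun x => Num.min (f x) (h x)) phi
       = Psi f phi + Psi h phi) /\
  (* continuity (Conv(R^n,R) is metrizable, so sequential continuity) *)
  (forall (fs : nat -> V n -> R) (f : V n -> R),
     (forall j, convex_fun (fs j)) -> convex_fun f -> loc_unif_cvg fs f ->
     weak_star_cvg (fun j => Psi (fs j)) (Psi f)) /\
  (forall f, convex_fun f -> forall (y : V n) (c : R) phi, Cc phi ->
     Psi (fun x => f x + vdot x y + c) phi = Psi f phi) /\
  (forall f h, convex_fun f -> convex_fun h -> forall U : set (V n), open U ->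
     (forall x, U x -> f x = h x) ->
     forall phi, Cc phi ->
       (exists K : set (V n), compact K /\ K `<=` U /\ forall x, ~ K x -> phi x = 0) ->
       Psi f phi = Psi h phi) /\
  (* translation equivariant: Psi(f(.-a))[B] = Psi(f)[B-a] *)
  (forall f, convex_fun f -> forall (a : V n) phi, Cc phi ->
     Psi (fun x => f (x - a)) phi = Psi f (fun x => phi (x + a))) /\
  (forall f, convex_fun f -> forall t : R, 0 < t -> forall phi, Cc phi ->
     Psi (fun x => t * f x) phi = (t ^+ k)%:C * Psi f phi).

(* GL(n,R)-equivariance with weight q:
   [g.Psi](f)[B] = Psi(f o g)[g^-1 B] = |det g|^q Psi(f)[B].
   The measure B |-> mu(g^-1 B) is the push-forward of mu by g, which acts on
   test functions by phi |-> phi o g.  g acts on row vectors by x |-> x *m g. *)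
Definition GL_equivariant n (q : R) (Psi : mval n) : Prop :=
  forall g : 'M[R]_n, g \in unitmx ->
  forall f, convex_fun f -> forall phi, Cc phi ->
    Psi (fun x => f (x *m g)) (fun x => phi (x *m g))
    = (`|\det g| `^ q)%:C * Psi f phi.

Definition obox n (a b : V n) : set (V n) :=
  [set x | forall i, a ord0 i < x ord0 i < b ord0 i].
Definition box_vol n (a b : V n) : R := \prod_i (b ord0 i - a ord0 i).

Definition leb_outer n (A : set (V n)) : \bar R :=
  ereal_inf [set s | exists a b : nat -> V n,
     (forall k i, a k ord0 i <= b k ord0 i) /\
     A `<=` \bigcup_k obox (a k) (b k) /\
     s = (\sum_(0 <= k <oo) (box_vol (a k) (b k))%:E)%E].

(* Integral of a real (continuous, compactly supported) function against a
   nonnegative measure nu, via the layer-cake formula. *)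
Definition layer_integral n (nu : set (V n) -> \bar R) (phi : V n -> R) : R :=
  fine (\int[lebesgue_measure]_(t in [set t : R | (0 <= t)%R]) nu [set x | (t < phi x)%R])%E
  - fine (\int[lebesgue_measure]_(t in [set t : R | (0 <= t)%R]) nu [set x | (phi x < - t)%R])%E.

Definition lebesgue_n n : (V n -> R) -> R[i] :=
  fun phi => (layer_integral (@leb_outer n) phi)%:C.

Definition subdiff n (f : V n -> R) (x : V n) : set (V n) :=
  [set y | forall z, f x + vdot y (z - x) <= f z].
Definition subdiff_image n (f : V n -> R) (B : set (V n)) : set (V n) :=
  \bigcup_(x in B) subdiff f x.
Definition monge_ampere n (f : V n -> R) : (V n -> R) -> R[i] :=
  fun phi => (layer_integral (fun B => leb_outer (subdiff_image f B)) phi)%:C.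

End MAVal.

(* Main.v *)
Require Import Defs.
From HB Require Import structures.
From mathcomp Require Import all_boot all_order all_algebra.
From mathcomp Require Import fingroup perm complex.
From mathcomp Require Import all_classical all_reals all_analysis.
From mathcomp Require Import measurable_realfun ring lra zify.
Set Implicit Arguments. Unset Strict Implicit. Unset Printing Implicit Defensive.
Import Order.TTheory GRing.Theory Num.Theory.
Import numFieldNormedType.Exports.
Local Open Scope classical_set_scope.
Local Open Scope ring_scope.

(* The real and imaginary parts of [Psi] are treated separately.

   Degree 0: [Psi f = lim Psi (f / j) = Psi 0] is a translation invariant functional,
   hence a multiple of Lebesgue measure by uniqueness of Haar measure; the dilation by
   2 determines the weight.

   Degree [k > 0]: piecewise linear functions are dense and [Psi] is local, so only
   the germs [x |-> max_i <x, y_i>] matter. If the differences [y_i - y_0] span a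
   space of dimension [r], [Psi] of such a germ lives on the orthogonal complement.
   Dilations transversal to it give [k = r q], so [q > 0], and then dilations along it
   force the mass to be infinite or zero when [r < n]. For [r = n] the mass is
   concentrated at the origin. For a generic piecewise linear function every germ of
   full rank is a linear image of [max (0, x_1, ..., x_n)], so [Psi] is determined by
   one number [v]; halving the corresponding simplex gives [v = 2 * 2 ^ (- q) * v],
   that is [q = 1] (and [k = n]) unless [v = 0]. The Monge-Ampere operator has the
   same values on generic piecewise linear functions up to a constant factor, and it
   is continuous. *)

(** * Maximum norm and dot product on row vectors *)

Section Euclid.
Variables (R : realType) (n : nat).
Implicit Types (x y z : 'rV[R]_n) (r e : R).

(** Both reference operators are given by [leb_outer], an infimum over coverings by boxes, and by
    layer-cake integrals of set functions that are only known to be monotone. Additivity and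
    linearity do not come with these definitions; they are obtained by discretization. [layer_cvg]
    turns two-sided estimates between compact and open sets into convergence of finite weighted sums
    of point values. It serves for grid points, giving Riemann sums for Lebesgue measure, and for
    vertices of piecewise linear functions, weighted by the volumes of their subdifferentials. The
    delicate input is that the gradients shared by two disjoint compact sets form a null set; this
    is a packing argument with translates.

    General position matters because, in dimension [d], a vertex with more than [d + 1] active
    pieces is not a linear image of one model germ. The final constant is [v] divided by the volume
    of the standard simplex, since this volume is the Monge-Ampere mass of the model germ. *)

Lemma coord_le_norm x i : `|x ord0 i| <= `|x|.
Proof.
rewrite [leRHS]/Num.Def.normr /= mx_normrE.
by apply: (@le_bigmax _ _ _ (0 : R) (fun ij => `|x ij.1 ij.2|) (ord0, i)).
Qed.

Lemma norm_le_coord x r : 0 <= r -> (forall i, `|x ord0 i| <= r) -> `|x| <= r.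
Proof.
move=> r0 xr; rewrite [leLHS]/Num.Def.normr /= mx_normrE; apply/bigmax_leP; split => //.
by case=> i j _ /=; rewrite ord1.
Qed.

Lemma norm_lt_coord x r : 0 < r -> (forall i, `|x ord0 i| < r) -> `|x| < r.
Proof.
move=> r0 xr; rewrite [ltLHS]/Num.Def.normr /= mx_normrE; apply/bigmax_ltP; split => //.
by case=> i j _ /=; rewrite ord1.
Qed.

Lemma vdotC x y : vdot x y = vdot y x.
Proof. by apply: eq_bigr => i _; rewrite mulrC. Qed.

Lemma vdotDl x y z : vdot (x + y) z = vdot x z + vdot y z.
Proof. by rewrite -big_split; apply: eq_bigr => i _; rewrite mxE mulrDl. Qed.

Lemma vdotZl r x y : vdot (r *: x) y = r * vdot x y.
Proof. by rewrite mulr_sumr; apply: eq_bigr => i _; rewrite mxE mulrA. Qed.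

Lemma vdotNl x y : vdot (- x) y = - vdot x y.
Proof. by rewrite -scaleN1r vdotZl mulN1r. Qed.

Lemma vdotBl x y z : vdot (x - y) z = vdot x z - vdot y z.
Proof. by rewrite vdotDl vdotNl. Qed.

Lemma vdotDr x y z : vdot x (y + z) = vdot x y + vdot x z.
Proof. by rewrite ![vdot x _]vdotC vdotDl. Qed.

Lemma vdotZr r x y : vdot x (r *: y) = r * vdot x y.
Proof. by rewrite ![vdot x _]vdotC vdotZl. Qed.

Lemma vdotNr x y : vdot x (- y) = - vdot x y.
Proof. by rewrite ![vdot x _]vdotC vdotNl. Qed.

Lemma vdotBr x y z : vdot x (y - z) = vdot x y - vdot x z.
Proof. by rewrite vdotDr vdotNr. Qed.

Lemma vdot0l x : vdot 0 x = 0.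
Proof. by rewrite -(scale0r 0) vdotZl mul0r. Qed.

Lemma vdot0r x : vdot x 0 = 0.
Proof. by rewrite vdotC vdot0l. Qed.

Lemma vdotE x y : vdot x y = (x *m y^T) ord0 ord0.
Proof. by rewrite mxE; apply: eq_bigr => i _; rewrite mxE. Qed.

Lemma vdot_mulmx x y (g : 'M[R]_n) : vdot (x *m g) y = vdot x (y *m g^T).
Proof. by rewrite !vdotE trmx_mul trmxK mulmxA. Qed.

Lemma vdot_delta x i : vdot x (delta_mx ord0 i) = x ord0 i.
Proof.
rewrite /vdot (bigD1 i)//= big1 ?addr0 ?mxE ?eqxx ?mulr1// => j ji.
by rewrite mxE eqxx /= (negbTE ji) mulr0.
Qed.

Lemma norm_vdot x y : `|vdot x y| <= n%:R * `|x| * `|y|.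
Proof.
apply: (le_trans (ler_norm_sum _ _ _)).
apply: (@le_trans _ _ (\sum_(i < n) `|x| * `|y|)).
  by apply: ler_sum => i _; rewrite normrM ler_pM// coord_le_norm.
by rewrite sumr_const card_ord -[leLHS]mulr_natl mulrA.
Qed.

(** The norm is the maximum norm, so the unit vectors and their opposites suffice as test vectors.
    This turns one-sided bounds on a subgradient into a norm bound. *)
Lemma vdot_le_norm1 x r : 0 <= r -> (forall z, `|z| <= 1 -> vdot x z <= r) ->
  `|x| <= r.
Proof.
move=> r0 H; apply: norm_le_coord => // i.
have d1 : `|(delta_mx ord0 i : 'rV[R]_n)| <= 1.
  apply: norm_le_coord => // j; rewrite mxE.
  by case: (_ && _); rewrite ?normr1 ?normr0.
rewrite ler_norml -vdot_delta; apply/andP; split; last exact: H.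
by rewrite lerNl -vdotNr H// normrN.
Qed.

End Euclid.

(** * Metric forms of continuity, openness and compactness *)

Section NormedTopology.
Variables (R : realType).

Lemma nbhs_epsP (V : normedModType R) (x : V) (P : set V) :
  nbhs x P <-> exists2 e : R, 0 < e & forall y, `|y - x| < e -> P y.
Proof.
split=> [/nbhs_ballP[e /= e0 He]|[e e0 He]].
  by exists e => // y yx; apply: He; rewrite -ball_normE /= distrC.
apply/nbhs_ballP; exists e => //= y; rewrite -ball_normE /= distrC; exact: He.
Qed.

Lemma cont_epsP (U V : normedModType R) (f : U -> V) :
  (forall x (e : R), 0 < e ->
    exists2 d : R, 0 < d & forall y, `|y - x| < d -> `|f y - f x| < e) ->
  continuous f.
Proof.
move=> H x; apply/cvgrPdist_lt => e e0; have [d d0 Hd] := H x e e0.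
by apply/nbhs_epsP; exists d => // y yx; rewrite distrC; exact: Hd.
Qed.

Lemma cont_eps (U V : normedModType R) (f : U -> V) (x : U) (e : R) :
  continuous f -> 0 < e ->
  exists2 d : R, 0 < d & forall y, `|y - x| < d -> `|f y - f x| < e.
Proof.
move=> cf e0; have /cvgrPdist_lt/(_ e e0)/nbhs_epsP[d d0 Hd] := cf x.
by exists d => // y yx; rewrite distrC; exact: Hd.
Qed.

Lemma open_epsP (V : normedModType R) (A : set V) :
  open A <-> forall x, A x -> exists2 e : R, 0 < e & forall y, `|y - x| < e -> A y.
Proof.
rewrite openE; split=> H x Ax; first exact/nbhs_epsP/H.
by apply/nbhs_epsP/H.
Qed.

Lemma compact_closedT (V : normedModType R) (K : set V) : compact K -> closed K.
Proof. by apply: compact_closed; exact: norm_hausdorff. Qed.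

Lemma compact_norm_bound (V : normedModType R) (K : set V) : compact K ->
  exists2 r : R, 0 < r & forall x, K x -> `|x| <= r.
Proof.
move=> /compact_bounded /ex_strict_bound_gt0[r r0 H].
by exists r => // x Kx; exact/ltW/H.
Qed.

Lemma contD (T : topologicalType) (f g : T -> R) :
  continuous f -> continuous g -> continuous (fun x => f x + g x).
Proof. by move=> cf cg x; apply: (@cvgD R R^o); [exact: cf|exact: cg]. Qed.

Lemma contM (T : topologicalType) (f g : T -> R) :
  continuous f -> continuous g -> continuous (fun x => f x * g x).
Proof. by move=> cf cg x; apply: cvgM; [exact: cf|exact: cg]. Qed.

Lemma cont_cst (T : topologicalType) (a : R) : continuous (fun _ : T => a).
Proof. by move=> x; exact: cvg_cst. Qed.

Lemma contN (T : topologicalType) (f : T -> R) :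
  continuous f -> continuous (fun x => - f x).
Proof. by move=> cf x; apply: (@cvgN R R^o); exact: cf. Qed.

Lemma contB (T : topologicalType) (f g : T -> R) :
  continuous f -> continuous g -> continuous (fun x => f x - g x).
Proof. by move=> cf cg; apply: contD => //; exact: contN. Qed.

Lemma cont_sum (T : topologicalType) (I : Type) (s : seq I) (f : I -> T -> R) :
  (forall i, continuous (f i)) -> continuous (fun x => \sum_(i <- s) f i x).
Proof.
move=> cf; elim: s => [|i s IH].
  by under eq_fun do rewrite big_nil; exact: cont_cst.
by under eq_fun do rewrite big_cons; exact: contD.
Qed.

Lemma cont_comp (S T U : topologicalType) (f : S -> T) (g : T -> U) :
  continuous f -> continuous g -> continuous (fun x => g (f x)).
Proof. by move=> cf cg x; apply: continuous_comp; [exact: cf|exact: cg]. Qed.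

Lemma cont_shift (V : normedModType R) (a : V) : continuous (fun x => x + a).
Proof. by move=> x; apply: cvgD; [exact: cvg_id|exact: cvg_cst]. Qed.

Lemma cont_refl (V : normedModType R) (a : V) : continuous (fun x => a - x).
Proof. by move=> x; apply: cvgB; [exact: cvg_cst|exact: cvg_id]. Qed.

Lemma cont_norm (V : normedModType R) : continuous (fun x : V => `|x| : R).
Proof. by move=> x; exact: (@norm_continuous R V x). Qed.

Definition thick (V : normedModType R) (e : R) (A : set V) : set V :=
  [set x | exists2 y, A y & `|x - y| < e].

Lemma sub_thick (V : normedModType R) e (A : set V) : 0 < e -> A `<=` thick e A.
Proof. by move=> e0 x Ax; exists x => //; rewrite subrr normr0. Qed.

Lemma open_thick (V : normedModType R) e (A : set V) : open (thick e A).
Proof.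
apply/open_epsP => x [y Ay xy]; exists (e - `|x - y|); first by rewrite subr_gt0.
move=> z zx; exists y => //; rewrite -(subrK x z) -addrA.
by rewrite (le_lt_trans (ler_normD _ _))// -ltrBrDr.
Qed.

(** Each point of [K] has a ball inside [U]; halving its radius leaves room for nearby centres, and
    near-covering compactness makes the admissible radius uniform over [K]. *)
Lemma compact_thick (V : normedModType R) (K U : set V) :
  compact K -> open U -> K `<=` U -> exists2 e : R, 0 < e & thick e K `<=` U.
Proof.
move=> /compact_near_coveringP cK /open_epsP oU KU.
have := cK R (0^'+) (fun e x => forall y, `|y - x| < e -> U y) _.
case.
  move=> x Kx; have [e e0 He] := oU x (KU x Kx).
  exists ([set y | `|y - x| < e / 2], [set d | d < e / 2]) => /=.
    split; first by apply/nbhs_epsP; exists (e / 2) => //; rewrite divr_gt0.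
    by apply: nbhs_right_lt; rewrite divr_gt0.
  case=> z d /= [zx de] y yz; apply: He; rewrite -(subrK z y) -addrA.
  rewrite (le_lt_trans (ler_normD _ _))// (splitr e) ltrD// (lt_trans yz)//.
(* Every positive parameter below [e] is admissible; [e / 2] is one. *)
move=> e /= e0 He; exists (e / 2); first by rewrite divr_gt0.
have := He (e / 2); rewrite /= sub0r normrN gtr0_norm ?divr_gt0//.
rewrite ltr_pdivrMr// ltr_pMr// ltr1n => /(_ erefl erefl) H.
move=> y [x Kx yx]; exact: (H x Kx).
Qed.

Lemma compact_EVT_min_pos (T : topologicalType) (f : T -> R) (A : set T) :
  compact A -> continuous f -> (forall x, A x -> 0 < f x) ->
  exists2 e : R, 0 < e & forall x, A x -> e <= f x.
Proof.
move=> cA cf f0; have [->|/set0P A0] := eqVneq A set0; first by exists 1.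
have [c /set_mem Ac H] := compact_EVT_min A0 cA (continuous_subspaceT cf).
by exists (f c); [exact: f0|move=> x Ax; exact/H/mem_set].
Qed.

End NormedTopology.

(** * Continuous functions of compact support *)

Section CompactSupport.
Variables (R : realType) (n : nat).
Notation V := 'rV[R]_n.
Implicit Types (phi psi : V -> R).

Lemma compact_cball (x0 : V) (r : R) : compact [set x : V | `|x - x0| <= r].
Proof.
apply: bounded_closed_compact.
  exists (`|x0| + r); split; first by rewrite num_real.
  move=> M Mr x /= xr; rewrite -(subrK x0 x) (le_trans (ler_normD _ _))//.
  by rewrite (le_trans _ (ltW Mr))// addrC lerD2l.
have cn : continuous (fun x : V => `|x - x0| : R^o).
  apply: (@cont_epsP R V R^o) => x e e0; exists e => // y yx.
  by apply: le_lt_trans yx; rewrite (le_trans (ler_dist_dist _ _))// opprB addrA subrK.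
apply: (@closed_comp _ _ (fun x : V => `|x - x0| : R^o) [set y | y <= r]).
  by move=> x _; exact: cn.
exact: closed_le.
Qed.

Lemma compact_ball0 (r : R) : compact [set x : V | `|x| <= r].
Proof.
by have := @compact_cball 0 r; congr compact; apply/seteqP; split=> x /=; rewrite subr0.
Qed.

Lemma CcP phi : Cc phi <-> continuous phi /\
  exists2 r : R, 0 < r & forall x, r < `|x| -> phi x = 0.
Proof.
split=> [[cp [K [cK HK]]]|[cp [r r0 H]]]; split=> //.
  have [r r0 Hr] := compact_norm_bound cK; exists r => // x xr.
  by apply: HK => /Hr; rewrite leNgt xr.
exists [set x | `|x| <= r]; split; first exact: compact_ball0.
by move=> x /= /negP; rewrite -ltNge; exact: H.
Qed.

Lemma mulmx_norm m (A : 'M[R]_(n, m)) : exists2 C : R, 0 < C &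
  forall x : V, `|x *m A| <= C * `|x|.
Proof.
exists (1 + n%:R * `|A|).
  by rewrite ltr_pwDl// mulr_ge0.
move=> x; have C0 : 0 <= 1 + n%:R * `|A| by rewrite addr_ge0// mulr_ge0.
apply: norm_le_coord; first by rewrite mulr_ge0.
move=> i; rewrite mxE (le_trans (ler_norm_sum _ _ _))//.
apply: (@le_trans _ _ (\sum_(j < n) `|A| * `|x|)).
  apply: ler_sum => j _; rewrite normrM mulrC ler_pM// ?coord_le_norm//.
  rewrite [leRHS]/Num.Def.normr /= mx_normrE.
  exact: (@le_bigmax _ _ _ (0 : R) (fun ij => `|A ij.1 ij.2|) (j, i)).
rewrite sumr_const card_ord -[leLHS]mulr_natl mulrA ler_wpM2r// lerDr//.
Qed.

Lemma mulmx_cont m (A : 'M[R]_(n, m)) : continuous (fun x : V => x *m A).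
Proof.
apply: (@cont_epsP R V 'rV[R]_m) => x e e0.
have [C C0 HC] := mulmx_norm A.
exists (e / C); first by rewrite divr_gt0.
by move=> y yx; rewrite -mulmxBl (le_lt_trans (HC _))// mulrC -ltr_pdivlMr.
Qed.

Lemma Cc0 : Cc (fun _ : V => 0 : R).
Proof.
apply/CcP; split; first exact: cst_continuous.
by exists 1.
Qed.

Lemma Cc_lin phi psi a b : Cc phi -> Cc psi -> Cc (fun x => a * phi x + b * psi x).
Proof.
move=> /CcP[cp [r r0 Hr]] /CcP[cq [s s0 Hs]]; apply/CcP; split.
  by apply: contD; apply: contM => //; exact: cont_cst.
exists (Num.max r s); first by rewrite lt_max r0.
by move=> x; rewrite gt_max => /andP[? ?]; rewrite Hr// Hs// !mulr0 addr0.
Qed.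

Lemma CcB phi psi : Cc phi -> Cc psi -> Cc (fun x => phi x - psi x).
Proof.
move=> Cp Cq; have := Cc_lin 1 (-1) Cp Cq; congr Cc.
by apply/funext => x; rewrite mul1r mulN1r.
Qed.

Lemma CcN phi : Cc phi -> Cc (fun x => - phi x).
Proof.
move=> Cp; have := CcB Cc0 Cp; congr Cc.
by apply/funext => x; rewrite sub0r.
Qed.

Lemma CcZ phi a : Cc phi -> Cc (fun x => a * phi x).
Proof.
move=> Cp; have := Cc_lin a 0 Cp Cp; congr Cc.
by apply/funext => x; rewrite mul0r addr0.
Qed.

Lemma CcD phi psi : Cc phi -> Cc psi -> Cc (fun x => phi x + psi x).
Proof.
move=> Cp Cq; have := Cc_lin 1 1 Cp Cq; congr Cc.
by apply/funext => x; rewrite !mul1r.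
Qed.

Lemma Cc_sum (I : Type) (s : seq I) (F : I -> V -> R) : (forall i, Cc (F i)) ->
  Cc (fun x => \sum_(i <- s) F i x).
Proof.
move=> H; elim: s => [|i s IH].
  by under eq_fun do rewrite big_nil; exact: Cc0.
by under eq_fun do rewrite big_cons; exact: CcD.
Qed.

Lemma CcM phi (chi : V -> R) : Cc phi -> continuous chi -> Cc (fun x => phi x * chi x).
Proof.
move=> /CcP[cp [r r0 Hr]] cc; apply/CcP; split.
  exact: contM.
by exists r => // x /Hr ->; rewrite mul0r.
Qed.

Lemma Cc_shift phi a : Cc phi -> Cc (fun x => phi (x + a)).
Proof.
move=> /CcP[cp [r r0 Hr]]; apply/CcP; split.
  by apply: cont_comp cp; exact: (@cont_shift R V).
exists (r + `|a|); first by rewrite ltr_pwDl.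
move=> x xr; apply: Hr; rewrite -(ltrD2r `|a|) (lt_le_trans xr)//.
by rewrite -{1}(addrK a x) (le_trans (ler_normB _ _)).
Qed.

Lemma Cc_refl phi a : Cc phi -> Cc (fun x => phi (a - x)).
Proof.
move=> /CcP[cp [r r0 Hr]]; apply/CcP; split.
  by apply: cont_comp cp; exact: (@cont_refl R V).
exists (r + `|a|); first by rewrite ltr_pwDl.
move=> x xr; apply: Hr; rewrite -(ltrD2r `|a|) (lt_le_trans xr)//.
by rewrite -{1}(subKr a x) (le_trans (ler_normB _ _))// addrC.
Qed.

Lemma Cc_mulmx phi (g : 'M[R]_n) : g \in unitmx -> Cc phi -> Cc (fun x => phi (x *m g)).
Proof.
move=> ug /CcP[cp [r r0 Hr]]; apply/CcP; split.
  by apply: cont_comp cp; exact: mulmx_cont.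
have [C C0 HC] := mulmx_norm (invmx g).
exists (C * r); first by rewrite mulr_gt0.
move=> x xr; apply: Hr; rewrite -(ltr_pM2l C0) (lt_le_trans xr)//.
by rewrite -{1}(mulmxK ug x).
Qed.

Lemma Cc_bounded phi : Cc phi -> exists2 M : R, 0 < M & forall x, `|phi x| <= M.
Proof.
move=> /CcP[cp [r r0 Hr]].
have : compact (phi @` [set x | `|x| <= r]).
  apply: continuous_compact; last exact: compact_ball0.
  exact: continuous_subspaceT.
move=> /compact_norm_bound[M M0 HM]; exists M => // x.
have [xr|/Hr->] := leP `|x| r; first by apply: HM; exists x.
by rewrite normr0 ltW.
Qed.

Lemma Cc_unif_cont phi (e : R) : Cc phi -> 0 < e ->
  exists2 d : R, 0 < d & forall x y, `|x - y| < d -> `|phi x - phi y| < e.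
Proof.
move=> /CcP[cp [r r0 Hr]] e0.
have /compact_near_coveringP cK := @compact_ball0 r.
have := cK R (0^'+) (fun d x => forall y, `|y - x| < d -> `|phi y - phi x| < e) _.
case.
  move=> x Kx; have [d d0 Hd] := cont_eps x cp (divr_gt0 e0 (ltr0n _ 2)).
  exists ([set y | `|y - x| < d / 2], [set c | c < d / 2]) => /=.
    split; first by apply/nbhs_epsP; exists (d / 2) => //; rewrite divr_gt0.
    by apply: nbhs_right_lt; rewrite divr_gt0.
  case=> z c /= [zx cd] y yz.
  rewrite -(subrK (phi x) (phi y)) -addrA (splitr e).
  rewrite (le_lt_trans (ler_normD _ _))// ltrD//.
    apply: Hd; rewrite -(subrK z y) -addrA.
    by rewrite (le_lt_trans (ler_normD _ _))// (splitr d) ltrD// (lt_trans yz).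
  by rewrite distrC Hd// (lt_trans zx)// ltr_pdivrMr// ltr_pMr// ltr1n.
move=> d /= d0 Hd; exists (d / 2); first by rewrite divr_gt0.
have := Hd (d / 2); rewrite /= sub0r normrN gtr0_norm ?divr_gt0//.
rewrite ltr_pdivrMr// ltr_pMr// ltr1n => /(_ erefl erefl) H.
move=> x y xy.
have [yr|yr] := leP `|y| r; first exact: (H y).
have [xr|xr] := leP `|x| r; first by rewrite distrC (H x xr)// -opprB normrN.
by rewrite !Hr// subrr normr0.
Qed.

Lemma Cc_bump (r : R) : 0 < r -> exists chi : V -> R, [/\ Cc chi, forall x, 0 <= chi x <= 1 &
  forall x, `|x| <= r -> chi x = 1].
Proof.
move=> r0; exists (fun x => Num.max 0 (Num.min 1 (2 - `|x| / r))); split.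
- apply/CcP; split.
    apply: (@cont_epsP R V R^o) => x e e0.
    exists (e * r); first by rewrite mulr_gt0.
    move=> y yx.
    have lip (a b : R) : `|Num.max 0 (Num.min 1 a) - Num.max 0 (Num.min 1 b)| <= `|a - b|.
      have h1 := ler_norm (a - b); have h2 := ler_norm (b - a).
      rewrite [X in _ <= X]distrC in h2; rewrite ler_norml.
      have e1 : Num.max 0 1 = 1 :> R by rewrite (max_idPr _).
      have [ha|ha] := leP 1 a; have [hb|hb] := leP 1 b; rewrite ?e1; last first;
        do 2?[case: (leP 0 _) => ?]; lra.
    apply: (le_lt_trans (lip _ _)).
    rewrite opprD addrACA subrr add0r opprK -mulNr -mulrDl normrM.
    rewrite (gtr0_norm (_ : 0 < r^-1)) ?invr_gt0// ltr_pdivrMr//.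
    by rewrite addrC (le_lt_trans (ler_dist_dist _ _))// distrC.
  exists (2 * r); first by rewrite mulr_gt0.
  move=> x xr; apply/max_idPl; rewrite ge_min subr_le0 ler_pdivlMr// (ltW xr) orbT//.
- move=> x; rewrite le_max lexx /= ge_max ler01 /= ge_min lexx//.
- move=> x xr; rewrite (min_idPl _) ?(max_idPr _)//.
  by rewrite lerBrDl -lerBrDr -[2]/(1+1) addrK ler_pdivrMr// mul1r.
Qed.

End CompactSupport.

(** * Lebesgue outer measure through coverings by open boxes *)

Section LebOuter.
Variables (R : realType) (n : nat).
Notation V := 'rV[R]_n.+1.
Implicit Types (A B : set V) (a b : V).
Local Notation leb := (@leb_outer R n.+1).

Lemma box_vol_ge0 a b : (forall i, a ord0 i <= b ord0 i) -> 0 <= box_vol a b.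
Proof. by move=> ab; apply: prodr_ge0 => i _; rewrite subr_ge0. Qed.

(** The dimension is [n.+1]: in dimension [0] the empty product would give [1]. Degenerate boxes can
    thus pad a finite covering to a sequence at no cost. *)
Lemma box_volxx a : box_vol a a = 0.
Proof. by rewrite /box_vol (bigD1 ord0)//= subrr mul0r. Qed.

Lemma leb_ge0 A : (0 <= leb A)%E.
Proof.
apply: le_ereal_inf_tmp => _ [a [b [ab [_ ->]]]].
by apply: nneseries_ge0 => k _ _; rewrite lee_fin box_vol_ge0.
Qed.

Lemma leb_le_cover A (a b : nat -> V) : (forall k i, a k ord0 i <= b k ord0 i) ->
  A `<=` \bigcup_k obox (a k) (b k) ->
  (leb A <= \sum_(0 <= k <oo) (box_vol (a k) (b k))%:E)%E.
Proof. by move=> ab AB; apply: ereal_inf_lbound; exists a, b. Qed.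

Lemma leb_cover_adherent A (e : R) : 0 < e -> leb A != +oo%E ->
  exists a b : nat -> V, [/\ forall k i, a k ord0 i <= b k ord0 i,
    A `<=` \bigcup_k obox (a k) (b k) &
    (\sum_(0 <= k <oo) (box_vol (a k) (b k))%:E < leb A + e%:E)%E].
Proof.
move=> e0 Aoo; have Afin : leb A \is a fin_num.
  by rewrite ge0_fin_numE ?ltey//; exact: leb_ge0.
by have [_ [a [b [ab [AB ->]]]] H] := lb_ereal_inf_adherent e0 Afin; exists a, b.
Qed.

Lemma leb_mono A B : A `<=` B -> (leb A <= leb B)%E.
Proof.
move=> AB; apply: le_ereal_inf_tmp => _ [a [b [ab [Bc ->]]]].
by apply: leb_le_cover => //; exact: subset_trans Bc.
Qed.

(** Take coverings of the sets [A k] that are optimal up to [e / 2 ^ k.+1], and enumerate all their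
    boxes through a bijection from [nat] to [nat * nat]. *)
Lemma leb_sigma_subadd (A : nat -> set V) :
  (leb (\bigcup_k A k) <= \sum_(0 <= k <oo) leb (A k))%E.
Proof.
have [[i ioo]|] := pselect (exists i, leb (A i) = +oo%E).
  rewrite (eseries_pinfty _ _ ioo) ?leey// => k _.
  by rewrite -ltNye (lt_le_trans _ (leb_ge0 _)).
rewrite -forallNE => Aoo; apply/lee_addgt0Pr => e e0.
rewrite (le_trans _ (epsilon_trick _ _ (ltW e0)))//; last by move=> k; exact: leb_ge0.
pose P k (c : (nat -> V) * (nat -> V)) :=
  [/\ forall l i, c.1 l ord0 i <= c.2 l ord0 i,
    A k `<=` \bigcup_l obox (c.1 l) (c.2 l) &
    (\sum_(0 <= l <oo) (box_vol (c.1 l) (c.2 l))%:E <=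
      leb (A k) + (e / (2 ^ k.+1)%:R)%:E)%E].
have [c Pc] : {c : nat -> _ & forall k, P k (c k)}.
  apply: (@choice _ _ P) => k; have /eqP Ak := Aoo k.
  have ek : 0 < e / (2 ^ k.+1)%:R by rewrite divr_gt0// ltr0n expn_gt0.
  have [a [b [ab AB H]]] := leb_cover_adherent ek Ak.
  by exists (a, b); split => //; exact: ltW.
have /card_esym/ppcard_eqP[f] := card_nat2.
pose a k := (c (f k).1).1 (f k).2; pose b k := (c (f k).1).2 (f k).2.
have ab k i : a k ord0 i <= b k ord0 i by have [+ _ _] := Pc (f k).1; apply.
apply: (@le_trans _ _ (\sum_(0 <= k <oo) (box_vol (a k) (b k))%:E)%E).
  apply: leb_le_cover => // x [k _ Akx].
  have [_ /(_ x Akx)[l _ Hx] _] := Pc k.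
  exists (f^-1%FUN (k, l)) => //=.
  by rewrite /a /b invK ?inE.
pose v (kl : nat * nat) := (box_vol ((c kl.1).1 kl.2) ((c kl.1).2 kl.2))%:E.
have v0 kl : (0 <= v kl)%E.
  by rewrite lee_fin box_vol_ge0//; have [+ _ _] := Pc kl.1; apply.
rewrite nneseries_esumT; last by move=> k; exact: (v0 (f k)).
rewrite -[X in (X <= _)%E](@reindex_esum R _ _ setT setT f v)//.
rewrite [X in esum X](_ : _ = [set: nat] `*`` (fun=> [set: nat])); last first.
  by apply/seteqP; split.
rewrite -(@esum_esum _ _ _ _ _ (fun k l => v (k, l)))//.
rewrite -nneseries_esumT; last by move=> k; apply: esum_ge0 => l _; exact: v0.
apply: lee_nneseries => [k _ _|k _]; first by apply: esum_ge0 => l _; exact: v0.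
rewrite -nneseries_esumT; last by move=> l; exact: v0.
by have [_ _] := Pc k.
Qed.

Lemma leb_obox a b : (forall i, a ord0 i <= b ord0 i) ->
  (leb (obox a b) <= (box_vol a b)%:E)%E.
Proof.
move=> ab.
have := @leb_le_cover (obox a b) (fun k => if k is 0%N then a else 0)
  (fun k => if k is 0%N then b else 0).
rewrite nneseries_recl//; last by move=> [|k] _; rewrite lee_fin ?box_volxx ?box_vol_ge0.
rewrite eseries0 ?adde0.
  apply; first by case=> [|k] i //.
  by move=> x ?; exists 0%N.
by case=> // k _ _; rewrite box_volxx.
Qed.

Lemma leb0 : leb set0 = 0%E.
Proof.
apply/eqP; rewrite eq_le leb_ge0 andbT.
have := @leb_obox 0 0 (fun=> lexx _); rewrite box_volxx; apply: le_trans.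
exact: leb_mono.
Qed.

Lemma leb_setU A B : (leb (A `|` B) <= leb A + leb B)%E.
Proof.
rewrite -bigcup2E (le_trans (leb_sigma_subadd _))//.
rewrite (nneseries_split 0 2); last by move=> k _; exact: leb_ge0.
rewrite eseries0 ?adde0; last by case=> [|[|k]]//= _ _; exact: leb0.
by rewrite add0n big_nat_recr//= big_nat1.
Qed.

Lemma leb_bigU (I : Type) (s : seq I) (P : pred I) (F : I -> set V) :
  (leb (\big[setU/set0]_(i <- s | P i) F i) <= \sum_(i <- s | P i) leb (F i))%E.
Proof.
elim/big_rec2 : _ => [|i x A Pi IH]; first by rewrite leb0.
by rewrite (le_trans (leb_setU _ _))// leeD2l.
Qed.

Lemma leb_finU (I : finType) (P : pred I) (F : I -> set V) A :
  (forall x, A x -> exists2 i, P i & F i x) ->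
  (leb A <= \sum_(i | P i) leb (F i))%E.
Proof.
move=> AF; apply: le_trans (leb_bigU _ _ _); apply: leb_mono => x /AF[i Pi Fix].
by rewrite -bigcup_seq_cond; exists i => //=; rewrite mem_index_enum.
Qed.

(** Continuity at [0] of the volume of a box whose sides are lengthened by [s]; it absorbs boundary
    layers of boxes. *)
Lemma prod_addr_cvg (c : 'I_n.+1 -> R) (e : R) : 0 < e ->
  exists2 t : R, 0 < t & forall s, 0 <= s <= t ->
    \prod_(i < n.+1) (c i + s) <= \prod_(i < n.+1) c i + e.
Proof.
move=> e0.
have cv : continuous (fun s : R => \prod_(i < n.+1) (c i + s)).
  elim: (index_enum _) => [|i l IH].
    by under eq_fun do rewrite big_nil; exact: cont_cst.
  under eq_fun do rewrite big_cons; apply: contM => //.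
  by apply: contD; [exact: cont_cst|move=> x; exact: cvg_id].
have [d d0 Hd] := @cont_eps R R^o R^o _ 0 e cv e0.
exists (d / 2); first by rewrite divr_gt0.
move=> s /andP[s0 sd].
have sd' : `|s - 0| < d by rewrite subr0 ger0_norm//; lra.
have /ltW := Hd s sd'; rewrite ler_norml lerBlDl => /andP[_].
by congr (_ <= _ + _); apply: eq_bigr => i _; rewrite addr0.
Qed.

Definition cbox a b : set V := [set x | forall i, a ord0 i <= x ord0 i <= b ord0 i].

Lemma leb_cbox a b : (forall i, a ord0 i <= b ord0 i) ->
  (leb (cbox a b) <= (box_vol a b)%:E)%E.
Proof.
move=> ab; apply/lee_addgt0Pr => e e0; rewrite -EFinD.
have [t t0 Ht] := prod_addr_cvg (fun i => b ord0 i - a ord0 i) e0.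
pose a' : V := \row_i (a ord0 i - t / 2); pose b' : V := \row_i (b ord0 i + t / 2).
have ab' i : a' ord0 i <= b' ord0 i by rewrite !mxE; have := ab i; lra.
apply: (@le_trans _ _ (leb (obox a' b'))).
  by apply: leb_mono => x Hx i; rewrite !mxE; have := Hx i; lra.
rewrite (le_trans (leb_obox ab'))// lee_fin.
have := Ht t; rewrite lexx (ltW t0) => /(_ isT); apply: le_trans.
by rewrite le_eqVlt; apply/orP; left; apply/eqP; apply: eq_bigr => i _; rewrite !mxE; field.
Qed.

(** A covering of [A] is pushed forward box by box, so a bound on the images of open boxes is
    enough. *)
Lemma leb_image (T : V -> V) (C : R) A : 0 < C ->
  (forall a b, (forall i, a ord0 i <= b ord0 i) ->
    (leb (T @` obox a b) <= (C * box_vol a b)%:E)%E) ->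
  (leb (T @` A) <= C%:E * leb A)%E.
Proof.
move=> C0 HT; rewrite -lee_pdivrMl//; apply: le_ereal_inf_tmp => _ [a [b [ab [Ac ->]]]].
rewrite lee_pdivrMl// -nneseriesZl; last by move=> k _; rewrite lee_fin box_vol_ge0.
apply: (@le_trans _ _ (leb (\bigcup_k T @` obox (a k) (b k)))).
  by apply: leb_mono => _ [x /Ac[k _ xk] <-]; exists k => //; exists x.
apply: (le_trans (leb_sigma_subadd _)); apply: lee_nneseries => [k _ _|k _].
  exact: leb_ge0.
by rewrite -EFinM HT.
Qed.

Lemma leb_shift_le A (c : V) : (leb [set (x + c)%R | x in A] <= leb A)%E.
Proof.
rewrite -[leRHS]mul1e; apply: leb_image => // a b ab; rewrite mul1r.
apply: (@le_trans _ _ (leb (obox (a + c) (b + c)))).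
  by apply: leb_mono => _ [x xab <-] i; rewrite !mxE !ltrD2r.
rewrite (le_trans (leb_obox _))//; first by move=> i; rewrite !mxE lerD2r.
rewrite lee_fin le_eqVlt; apply/orP; left; apply/eqP; apply: eq_bigr => i _.
by rewrite !mxE; ring.
Qed.

Lemma leb_shift A (c : V) : leb [set (x + c)%R | x in A] = leb A.
Proof.
apply/eqP; rewrite eq_le leb_shift_le /=.
have := leb_shift_le [set x + c | x in A] (- c); congr (leb _ <= _)%E.
apply/seteqP; split=> [_ [_ [x Ax <-] <-]|x Ax]; first by rewrite addrK.
by exists (x + c); [exists x|rewrite addrK].
Qed.

Lemma leb_opp_le A : (leb [set (- x)%R | x in A] <= leb A)%E.
Proof.
rewrite -[leRHS]mul1e; apply: leb_image => // a b ab; rewrite mul1r.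
apply: (@le_trans _ _ (leb (obox (- b) (- a)))).
  by apply: leb_mono => _ [x xab <-] i; rewrite !mxE !ltrN2 andbC.
rewrite (le_trans (leb_obox _))//; first by move=> i; rewrite !mxE lerN2.
rewrite lee_fin le_eqVlt; apply/orP; left; apply/eqP; apply: eq_bigr => i _.
by rewrite !mxE; ring.
Qed.

Lemma leb_opp A : leb [set (- x)%R | x in A] = leb A.
Proof.
apply/eqP; rewrite eq_le leb_opp_le /=.
have := leb_opp_le [set - x | x in A]; congr (leb _ <= _)%E.
apply/seteqP; split=> [_ [_ [x Ax <-] <-]|x Ax]; first by rewrite opprK.
by exists (- x); [exists x|rewrite opprK].
Qed.

Lemma leb_bounded A (r : R) : (forall x, A x -> `|x| <= r) -> (leb A < +oo)%E.
Proof.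
move=> Ar; pose c : V := const_mx `|r|.
apply: (@le_lt_trans _ _ (box_vol (- c) c)%:E); last by rewrite ltry.
have cc i : (- c) ord0 i <= c ord0 i by rewrite !mxE; have := normr_ge0 r; lra.
apply: le_trans (leb_cbox cc); apply: leb_mono => x Ax i; rewrite !mxE.
by rewrite -ler_norml (le_trans (coord_le_norm _ _))// (le_trans (Ar x Ax))// ler_norm.
Qed.

Lemma leb_fin A (r : R) : (forall x, A x -> `|x| <= r) -> leb A \is a fin_num.
Proof. by move=> Ar; rewrite ge0_fin_numE ?leb_ge0//; exact: leb_bounded Ar. Qed.

Lemma open_obox a b : open (obox a b).
Proof.
rewrite openE => x Hx; exists (fun _ i => `]a ord0 i, b ord0 i[%classic).
  move=> i j; rewrite ord1; apply: open_nbhs_nbhs; split; first exact: interval_open.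
  by rewrite /= in_itv/=; exact: Hx.
by move=> y Hy i; have := Hy ord0 i; rewrite /= in_itv.
Qed.

Lemma leb_regular A (e : R) : 0 < e -> leb A != +oo%E -> exists U : set V,
  [/\ open U, A `<=` U & (leb U <= leb A + e%:E)%E].
Proof.
move=> e0 Aoo; have [a [b [ab Ac H]]] := leb_cover_adherent e0 Aoo.
exists (\bigcup_k obox (a k) (b k)); split => //.
  by apply: bigcup_open => k _; exact: open_obox.
by apply: le_trans (ltW H); exact: leb_le_cover.
Qed.

Lemma compact_leb_regular K (e : R) : 0 < e -> compact K ->
  exists2 d : R, 0 < d & (leb (thick d K) <= leb K + e%:E)%E.
Proof.
move=> e0 cK; have [r r0 Kr] := @compact_norm_bound R V K cK.
have Koo : leb K != +oo%E by rewrite lt_eqF//; exact: leb_bounded Kr.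
have [U [oU KU HU]] := leb_regular e0 Koo.
have [d d0 Hd] := @compact_thick R V K U cK oU KU.
by exists d => //; apply: le_trans HU; exact: leb_mono.
Qed.

End LebOuter.

(** * Counting grid points, and additivity of the outer measure on compact sets *)

Section Lattice.
Variables (R : realType) (n : nat).
Notation V := 'rV[R]_n.+1.
Implicit Types (A B : set V) (a b : V).
Local Notation leb := (@leb_outer R n.+1).

(** Mass given to [A] by the weights [w i] placed at the points [p i]. It covers both the counting
    measure of a grid and the Monge-Ampere measure of a piecewise linear function. *)
Definition dmass (I : finType) (w : I -> R) (p : I -> V) A : R :=
  \sum_(i | p i \in A) w i.

Lemma dmass_mono (I : finType) (w : I -> R) (p : I -> V) A B :
  (forall i, 0 <= w i) -> A `<=` B -> dmass w p A <= dmass w p B.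
Proof.
move=> w0 AB; rewrite /dmass [leLHS]big_mkcond [leRHS]big_mkcond.
apply: ler_sum => i _; have [/set_mem/AB/mem_set ->//|_] := boolP (p i \in A).
by case: ifP.
Qed.

Lemma dmass_finU (I J : finType) (w : I -> R) (p : I -> V) A (B : J -> set V) :
  (forall i, 0 <= w i) -> (forall x, A x -> exists j, B j x) ->
  dmass w p A <= \sum_j dmass w p (B j).
Proof.
move=> w0 AB; rewrite /dmass big_mkcond /=.
under [leRHS]eq_bigr do rewrite big_mkcond.
rewrite exchange_big /=; apply: ler_sum => i _.
have nn j : 0 <= (if p i \in B j then w i else 0) by case: ifP.
have [/set_mem/AB[j Hj]|_] := boolP (p i \in A); last exact: sumr_ge0.
rewrite (bigD1 j)//= mem_set// lerDl; exact: sumr_ge0.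
Qed.

Lemma dmassUI (I : finType) (w : I -> R) (p : I -> V) A B :
  dmass w p A + dmass w p B = dmass w p (A `|` B) + dmass w p (A `&` B).
Proof.
rewrite /dmass !(big_mkcond (fun i => p i \in _)) /= -!big_split /=.
apply: eq_bigr => i _; rewrite in_setU in_setI.
by case: (p i \in A); case: (p i \in B); rewrite ?(addr0, add0r).
Qed.

Lemma count_itv (N : nat) (al be : R) : al <= be ->
  \sum_(z < N) (al < z%:R < be)%R%:R <= be - al + 1.
Proof.
move=> ab.
(* The bound is capped at [N] so that it can be proved by induction on [N]. *)
suff H : \sum_(z < N) (al < z%:R < be)%R%:R <= Num.max 0 (Num.min N%:R (be + 1) - al).
  apply: (le_trans H); rewrite ge_max; apply/andP; split; first by lra.
  have mi : Num.min N%:R (be + 1) <= be + 1 by rewrite ge_min lexx orbT.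
  lra.
elim: N => [|N IH]; first by rewrite big_ord0 le_max lexx.
rewrite big_ord_recr /=; move: IH; set S := \sum_(_ < _) _ => IH.
have N1 : N.+1%:R = N%:R + 1 :> R by rewrite -addn1 natrD.
have [/andP[h1 h2]|_] := boolP (al < N%:R < be); rewrite N1 /=; last first.
  rewrite addr0 (le_trans IH)// ge_max !le_max lexx /= lerD2r le_min !ge_min lexx orbT.
  by rewrite andbT lerDl ler01 orbT.
move: IH; rewrite (min_idPl (_ : N%:R <= be + 1)); last by lra.
rewrite (min_idPl (_ : N%:R + 1 <= be + 1)); last by lra.
rewrite (max_idPr _) ?(max_idPr _); lra.
Qed.

(* The points of [h Z^(n+1)] in the cube of radius [1 / h], with [h = 1 / (J + 1)]: as [J]
   grows the grid both refines and exhausts the space. *)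
Definition mesh (J : nat) : R := J.+1%:R^-1.
Definition lat (J : nat) := {ffun 'I_n.+1 -> 'I_(2 * J.+1 ^ 2).+1}.
Definition lpt (J : nat) (z : lat J) : V :=
  \row_i (mesh J * ((z i)%:R - (J.+1 ^ 2)%:R)).
Definition lmass J A : R := dmass (fun _ : lat J => mesh J ^+ n.+1) (@lpt J) A.

Lemma mesh_gt0 J : 0 < mesh J.
Proof. by rewrite invr_gt0. Qed.

(** The count factors over the coordinates, and along each of them an open interval of length
    [b - a] holds at most [(b - a) / h + 1] grid values. *)
Lemma lmass_obox J a b : (forall i, a ord0 i <= b ord0 i) ->
  lmass J (obox a b) <= \prod_i (b ord0 i - a ord0 i + mesh J).
Proof.
move=> ab; set h := mesh J; have h0 : 0 < h := mesh_gt0 J.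
pose M : R := (J.+1 ^ 2)%:R.
pose F (i : 'I_n.+1) (k : 'I_(2 * J.+1 ^ 2).+1) : R :=
  h * (a ord0 i < h * (k%:R - M) < b ord0 i)%R%:R.
have -> : lmass J (obox a b) = \sum_(z : lat J) \prod_i F i (z i).
  rewrite /lmass /dmass big_mkcond; apply: eq_bigr => z _.
  rewrite big_split /= prodr_const card_ord.
  have [zab|zab] := boolP (_ \in _).
    rewrite big1 ?mulr1// => i _.
    by have /set_mem/(_ i) := zab; rewrite mxE => ->.
  suff [i Hi] : exists i, ~~ (a ord0 i < h * ((z i)%:R - M) < b ord0 i).
    by rewrite (bigD1 i)//= (negbTE Hi) mul0r mulr0.
  apply/existsP; rewrite -negb_forall; apply: contra zab => /forallP zab.
  by apply/mem_set => i; rewrite mxE; exact: zab.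
rewrite -(bigA_distr_bigA F); apply: ler_prod => i _; apply/andP; split.
  by apply: sumr_ge0 => k _; rewrite mulr_ge0// ltW.
rewrite -mulr_sumr.
have -> : b ord0 i - a ord0 i + h = h * ((b ord0 i / h + M) - (a ord0 i / h + M) + 1).
  by field; rewrite gt_eqF.
rewrite ler_pM2l//.
have le2 : a ord0 i / h + M <= b ord0 i / h + M.
  by rewrite lerD2r ler_pM2r// invr_gt0.
apply: le_trans (count_itv (2 * J.+1 ^ 2).+1 le2); apply: ler_sum => k _.
have -> : (a ord0 i / h + M < k%:R) = (a ord0 i < h * (k%:R - M)).
  by rewrite -ltrBrDr ltr_pdivrMr// mulrC.
have -> : (k%:R < b ord0 i / h + M) = (h * (k%:R - M) < b ord0 i).
  by rewrite -ltrBlDr ltr_pdivlMr// mulrC.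
by [].
Qed.

Lemma lpt_floor J (x : V) : `|x| <= J%:R -> exists z : lat J,
  forall i, lpt z ord0 i <= x ord0 i < lpt z ord0 i + mesh J.
Proof.
move=> xJ; set h := mesh J; have h0 : 0 < h := mesh_gt0 J.
have bnd i : - (J.+1 ^ 2)%:R <= x ord0 i / h <= (J.+1 ^ 2)%:R.
  have := le_trans (coord_le_norm x i) xJ.
  rewrite -ler_norml normrM [X in _ * X]gtr0_norm ?invr_gt0// invrK => H.
  rewrite expnS expn1 natrM ler_pM//.
  by rewrite (le_trans H)// ler_nat.
pose f i := Num.floor (x ord0 i / h) + (J.+1 ^ 2)%:Z.
have f0 i : 0 <= f i.
  rewrite -lerBlDr sub0r floor_ge_int.
  by have /andP[H _] := bnd i; rewrite mulrNz.
have fM i : (absz (f i) < (2 * J.+1 ^ 2).+1)%N.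
  rewrite ltnS -lez_nat gez0_abs// /f mul2n -addnn PoszD lerD2r.
  have /andP[_ H] := bnd i.
  by rewrite -(@ler_int R) (le_trans (ge_floor _)).
exists [ffun i => Ordinal (fM i)] => i; rewrite mxE ffunE /=.
have -> : (absz (f i))%:R - (J.+1 ^ 2)%:R = (Num.floor (x ord0 i / h))%:~R :> R.
  rewrite -[(absz _)%:R]/((absz (f i))%:~R) gez0_abs// /f intrD.
  by rewrite addrK.
have fl := ge_floor (x ord0 i / h); have fs := floorD1_gt (x ord0 i / h).
rewrite -/h; apply/andP; split.
  by rewrite mulrC -ler_pdivlMr.
by rewrite -[X in _ < _ + X]mulr1 -mulrDr mulrC -ltr_pdivrMr// -intrD1.
Qed.

(** Volume of the bounding box of the image of the unit cube under [x |-> x *m T]: a crude upper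
    substitute for the absolute value of the determinant. *)
Definition col_sums (T : 'M[R]_n.+1) : R := \prod_j \sum_i `|T i j|.

(** The image of [A] is covered by the bounding boxes of the images of the grid cells that meet [A],
    each of volume [h ^+ n.+1 * col_sums T]. The base points of these cells lie in the thickening of
    [A]. *)
Lemma leb_lmass_mulmx (T : 'M[R]_n.+1) J (e : R) A : mesh J < e ->
  (forall x, A x -> `|x| <= J%:R) ->
  (leb [set x *m T | x in A] <= (col_sums T * lmass J (thick e A))%:E)%E.
Proof.
move=> he AJ; set h := mesh J; have h0 : 0 < h := mesh_gt0 J.
(* Corners of the bounding box of the image of the cell with base point [lpt z] and side [h]: each
   entry of [T] contributes to one side according to its sign. *)
pose lo (z : lat J) : V := \row_j ((lpt z *m T) ord0 j + \sum_i Num.min 0 (h * T i j)).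
pose hi (z : lat J) : V := \row_j ((lpt z *m T) ord0 j + \sum_i Num.max 0 (h * T i j)).
have lohi z i : lo z ord0 i <= hi z ord0 i.
  rewrite !mxE lerD2l; apply: ler_sum => j _.
  by rewrite le_max ge_min lexx.
have vol z : box_vol (lo z) (hi z) = h ^+ n.+1 * col_sums T.
  have -> : h ^+ n.+1 = \prod_(j < n.+1) h by rewrite prodr_const card_ord.
  rewrite /box_vol /col_sums -big_split /=.
  apply: eq_bigr => j _; rewrite !mxE addrAC opprD addrA subrr add0r addrC -sumrB.
  rewrite mulr_sumr; apply: eq_bigr => i _.
  rewrite -{3}(gtr0_norm h0) -normrM.
  have [H|H] := leP 0 (h * T i j); first by rewrite subr0 ger0_norm.
  by rewrite sub0r ltr0_norm.
apply: (@le_trans _ _ (\sum_(z : lat J | lpt z \in thick e A) leb (cbox (lo z) (hi z)))%E).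
  apply: leb_finU => _ [x Ax <-]; have [z Hz] := lpt_floor (AJ x Ax); exists z.
    apply/mem_set; exists x => //; apply: le_lt_trans he.
    apply: norm_le_coord; first exact: ltW.
    move=> i; have := Hz i; rewrite [(lpt z - x) ord0 i]mxE [(- x) ord0 i]mxE ler_norml.
    by rewrite -/h => /andP[H1 H2]; apply/andP; split; lra.
  move=> j; rewrite !mxE.
  have -> : \sum_i x ord0 i * T i j =
    \sum_i lpt z ord0 i * T i j + \sum_i (x ord0 i - lpt z ord0 i) * T i j.
    by rewrite -big_split; apply: eq_bigr => i _ /=; rewrite -mulrDl addrC subrK.
  rewrite !lerD2l; apply/andP; split; apply: ler_sum => i _;
    have /andP[H1 H2] := Hz i; rewrite -/h in H2;
    set u := x ord0 i - _; have u0 : 0 <= u by [rewrite subr_ge0|rewrite /u; lra];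
    have uh : u <= h by rewrite /u; lra.
  - have [T0|T0] := leP 0 (T i j); first by rewrite ge_min mulr_ge0.
    by rewrite ge_min ler_nM2r// uh orbT.
  - have [T0|T0] := leP 0 (T i j); first by rewrite le_max ler_wpM2r// orbT.
    by rewrite le_max mulr_ge0_le0// ltW.
rewrite (@le_trans _ _ (\sum_(z : lat J | lpt z \in thick e A) (h ^+ n.+1 * col_sums T)%:E)%E)//.
  by apply: lee_sum => z _; rewrite -(vol z); exact: leb_cbox.
by rewrite sumEFin lee_fin /lmass /dmass mulr_sumr; apply: ler_sum => z _; rewrite mulrC.
Qed.

Lemma col_sums1 : col_sums 1%:M = 1.
Proof.
rewrite /col_sums big1// => j _; rewrite (bigD1 j)//= big1 ?addr0 ?mxE ?eqxx ?normr1//.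
by move=> i ij; rewrite mxE (negbTE ij) normr0.
Qed.

Lemma leb_lmass J (e : R) A : mesh J < e -> (forall x, A x -> `|x| <= J%:R) ->
  (leb A <= (lmass J (thick e A))%:E)%E.
Proof.
move=> he AJ; have := leb_lmass_mulmx 1%:M he AJ; rewrite col_sums1 mul1r.
by congr (leb _ <= _)%E; apply/seteqP; split=> [_ [x Ax <-]|x Ax];
  rewrite ?mulmx1//; exists x; rewrite ?mulmx1.
Qed.

Lemma mesh_cvg (e : R) : 0 < e -> exists N, forall J, (N <= J)%N -> mesh J < e.
Proof.
move=> e0; exists (Num.truncn e^-1).+1 => J NJ.
rewrite /mesh invf_plt ?posrE// (lt_le_trans (truncnS_gt _))// ler_nat.
by rewrite (leq_trans NJ).
Qed.

(** The converse of [leb_lmass]: a nearly optimal covering of [K] is reduced to finitely many boxes,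
    and on each box the count is bounded by the volume up to an error vanishing with the mesh. *)
Lemma lmass_compact K (e : R) : 0 < e -> compact K -> exists2 d : R, 0 < d &
  exists N, forall J, (N <= J)%N -> ((lmass J (thick d K))%:E <= leb K + e%:E)%E.
Proof.
move=> e0 cK; have [r r0 Kr] := @compact_norm_bound R V K cK.
have Koo : leb K != +oo%E by rewrite lt_eqF//; exact: leb_bounded Kr.
have e20 : 0 < e / 2 by rewrite divr_gt0.
have [a [b [ab Kc H]]] := leb_cover_adherent e20 Koo.
have /compact_near_coveringP ncK := cK.
have := ncK nat \oo (fun m x => exists k : 'I_m, obox (a k) (b k) x) _.
case.
  move=> x /Kc[k _ xk]; exists (obox (a k) (b k), [set m | (k < m)%N]) => /=.
    split; first by apply: open_nbhs_nbhs; split => //; exact: open_obox.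
    by exists k.+1.
  by case=> y m /= [yk km]; exists (Ordinal km).
move=> m _ /(_ m (leqnn m)) Km.
pose U := \bigcup_(k in [set k | (k < m)%N]) obox (a k) (b k).
have oU : open U by apply: bigcup_open => k _; exact: open_obox.
have KU : K `<=` U by move=> x /Km[k xk]; exists k => //=; exact: ltn_ord.
have [d d0 dU] := @compact_thick R V K U cK oU KU.
exists d => //.
(* Half of [e] is shared among the [m] boxes; [m.+1] keeps the divisor positive when [m] is [0]. *)
have m0 : 0 < e / 2 / m.+1%:R by rewrite divr_gt0.
have HN (k : 'I_m) : exists N, forall J, (N <= J)%N ->
    lmass J (obox (a k) (b k)) <= box_vol (a k) (b k) + e / 2 / m.+1%:R.
  have [t t0 Ht] := prod_addr_cvg (fun i => b k ord0 i - a k ord0 i) m0.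
  have [N HN] := mesh_cvg t0; exists N => J NJ.
  by rewrite (le_trans (lmass_obox J (ab k)))// Ht// (ltW (mesh_gt0 _)) ltW// HN.
have [N HN'] := choice HN.
exists (\max_k N k)%N => J NJ.
apply: (@le_trans _ _ (\sum_(k < m) (box_vol (a k) (b k) + e / 2 / m.+1%:R))%:E).
  rewrite lee_fin.
  apply: le_trans (@dmass_finU _ 'I_m _ _ (thick d K) (fun k => obox (a k) (b k)) _ _) _.
  - by move=> z; rewrite exprn_ge0// ltW// mesh_gt0.
  - by move=> x /dU[k /= km xk]; exists (Ordinal km).
  apply: ler_sum => k _; apply: HN'; apply: leq_trans NJ.
  exact: (leq_bigmax_cond (F := N)).
rewrite big_split /= EFinD.
have -> : e%:E = ((e / 2)%:E + (e / 2)%:E)%E by rewrite -EFinD -splitr.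
rewrite addeA; apply: leeD.
  apply: le_trans (ltW H); rewrite -sumEFin -(big_mkord xpredT (fun k => (box_vol (a k) (b k))%:E)).
  by apply: nneseries_lim_ge => k _ _; rewrite lee_fin box_vol_ge0.
rewrite lee_fin sumr_const card_ord -[_ *+ m]mulr_natr -mulrA ler_piMr ?(ltW e20)//.
by rewrite mulrC ler_pdivrMr// mul1r ler_nat.
Qed.

Lemma compact_bigball (r : R) : exists N : nat, forall J, (N <= J)%N -> r <= J%:R.
Proof.
exists (Num.truncn r).+1 => J NJ.
by rewrite (le_trans (ltW (truncnS_gt _)))// ler_nat.
Qed.

(* Counting lattice points in thickenings turns the strong additivity of finite
   counting measures into that of the outer measure on compact sets. *)
Lemma leb_compactUI A B : compact A -> compact B ->
  (leb A + leb B <= leb (A `|` B) + leb (A `&` B))%E.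
Proof.
move=> cA cB.
have clA := @compact_closedT R V _ cA; have clB := @compact_closedT R V _ cB.
have cU : compact (A `|` B) by exact: compactU.
have cI : compact (A `&` B) by exact: compact_closedI.
apply/lee_addgt0Pr => e e0; have e20 : 0 < e / 2 by rewrite divr_gt0.
have [d1 d10 [N1 H1]] := lmass_compact e20 cU.
have [d2 d20 [N2 H2]] := lmass_compact e20 cI.
(* A point near both sets is near their intersection. By compactness of [A] it is enough to look
   near one point of [A]: either that point lies in [B], or it keeps a positive distance from the
   closed set [B]. *)
have [d3 d30 H3] : exists2 d3 : R, 0 < d3 &
    thick d3 A `&` thick d3 B `<=` thick d2 (A `&` B).
  have /compact_near_coveringP ncA := cA.
  have := ncA R (0^'+) (fun c x => forall y, thick c B y -> `|y - x| < c ->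
    thick d2 (A `&` B) y) _.
  case.
    move=> x Ax; have [Bx|nBx] := pselect (B x).
      exists ([set y | `|y - x| < d2 / 2], [set c | c < d2 / 2]) => /=.
        split; first by apply/(@nbhs_epsP R V); exists (d2 / 2) => //; rewrite divr_gt0.
        by apply: nbhs_right_lt; rewrite divr_gt0.
      case=> z c /= [zx cd] y _ yz; exists x => //.
      rewrite -(subrK z y) -addrA (le_lt_trans (ler_normD _ _))// (splitr d2).
      by rewrite ltrD// (lt_trans yz).
    have oB : open (~` B) by exact: closed_openC.
    have [c c0 Hc] := (@open_epsP R V (~` B)).1 oB x nBx.
    exists ([set y | `|y - x| < c / 3], [set u | u < c / 3]) => /=.
      split; first by apply/(@nbhs_epsP R V); exists (c / 3) => //; rewrite divr_gt0.
      by apply: nbhs_right_lt; rewrite divr_gt0.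
    case=> z u /= [zx uc] y [t Bt yt] yz; exfalso; apply: (Hc t) => //.
    have -> : t - x = - (y - t) + (y - z) + (z - x).
      by rewrite opprB !addrA subrK subrK.
    rewrite (le_lt_trans (ler_normD _ _))//.
    have := ler_normD (- (y - t)) (y - z); rewrite normrN; lra.
  move=> c /= c0 Hc; exists (c / 2); first by rewrite divr_gt0.
  have := Hc (c / 2); rewrite /= sub0r normrN gtr0_norm ?divr_gt0//.
  rewrite ltr_pdivrMr// ltr_pMr// ltr1n => /(_ erefl erefl) H.
  by move=> y [[x Ax yx] By]; exact: (H x Ax y).
have [rA rA0 HA] := @compact_norm_bound R V A cA.
have [rB rB0 HB] := @compact_norm_bound R V B cB.
have [N3 HN3] := compact_bigball rA; have [N4 HN4] := compact_bigball rB.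
pose d := Num.min d1 d3; have d0 : 0 < d by rewrite lt_min d10.
have [N5 HN5] := mesh_cvg d0.
pose J := (N1 + N2 + N3 + N4 + N5)%N.
have JA : (leb A <= (lmass J (thick d A))%:E)%E.
  apply: leb_lmass; first by apply: HN5; rewrite /J; lia.
  by move=> x /HA xr; rewrite (le_trans xr)// HN3// /J; lia.
have JB : (leb B <= (lmass J (thick d B))%:E)%E.
  apply: leb_lmass; first by apply: HN5; rewrite /J; lia.
  by move=> x /HB xr; rewrite (le_trans xr)// HN4// /J; lia.
apply: (le_trans (leeD JA JB)); rewrite -EFinD /lmass dmassUI EFinD.
have -> : e%:E = ((e / 2)%:E + (e / 2)%:E)%E by rewrite -EFinD -splitr.
rewrite addeACA; apply: leeD.
  apply: (@le_trans _ _ (lmass J (thick d1 (A `|` B)))%:E); last first.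
    by apply: H1; rewrite /J; lia.
  rewrite lee_fin; apply: dmass_mono; first by move=> z; rewrite exprn_ge0// ltW// mesh_gt0.
  have dd1 : d <= d1 by rewrite ge_min lexx.
  by move=> x [[y Ay xy]|[y By xy]]; exists y;
    [left| exact: lt_le_trans dd1|right|exact: lt_le_trans dd1].
apply: (@le_trans _ _ (lmass J (thick d2 (A `&` B)))%:E); last first.
  by apply: H2; rewrite /J; lia.
rewrite lee_fin; apply: dmass_mono; first by move=> z; rewrite exprn_ge0// ltW// mesh_gt0.
have dd3 : d <= d3 by rewrite ge_min lexx orbT.
move=> x [[y Ay xy] [z Bz xz]]; apply: H3; split.
  by exists y => //; exact: lt_le_trans dd3.
by exists z => //; exact: lt_le_trans dd3.
Qed.

End Lattice.

(** * Behaviour of the outer measure under linear maps *)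

Section LebLinear.
Variables (R : realType) (n : nat).
Notation V := 'rV[R]_n.+1.
Implicit Types (A B : set V) (a b : V) (T : 'M[R]_n.+1).
Local Notation leb := (@leb_outer R n.+1).

(** Only an upper bound: it composes under products, and equality is recovered at the end by
    applying the bound to the inverse matrix. *)
Definition scales_by (T : 'M[R]_n.+1) (c : R) :=
  forall A, (leb [set x *m T | x in A] <= c%:E * leb A)%E.

Lemma scales_by_mul T U c d : 0 <= d -> scales_by T c -> scales_by U d ->
  scales_by (T *m U) (c * d).
Proof.
move=> d0 HT HU A.
have -> : [set x *m (T *m U) | x in A] = [set x *m U | x in [set x *m T | x in A]].
  apply/seteqP; split=> [_ [x Ax <-]|_ [_ [x Ax <-] <-]]; rewrite ?mulmxA.
    by exists (x *m T) => //; exists x.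
  by exists x => //; rewrite mulmxA.
rewrite (le_trans (HU _))// mulrC EFinM -muleA lee_wpmul2l//.
Qed.

(** On a box, [leb_lmass_mulmx] bounds the image by a grid count and [lmass_obox] bounds that count
    by the volume, with an error that vanishes with the mesh. *)
Lemma scales_by_col_sums T : 0 < col_sums T -> scales_by T (col_sums T).
Proof.
move=> C0 A; apply: leb_image => // a b ab.
apply/lee_addgt0Pr => e e0; rewrite -EFinD.
have e1 : 0 < e / col_sums T by rewrite divr_gt0.
have [t t0 Ht] := prod_addr_cvg (fun i => b ord0 i - a ord0 i) e1.
(* Two thirds of [t] widen the box on both sides for the thickening; the last third absorbs the
   mesh. *)
have t3 : 0 < t / 3 by rewrite divr_gt0.
have [N1 HN1] := @mesh_cvg R _ t3.
have [N2 HN2] := compact_bigball (`|a| + `|b|).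
pose J := (N1 + N2)%N.
have hJ : mesh R J < t / 3 by apply: HN1; rewrite /J; lia.
pose a' : V := \row_i (a ord0 i - t / 3); pose b' : V := \row_i (b ord0 i + t / 3).
have ab' i : a' ord0 i <= b' ord0 i by rewrite !mxE; have := ab i; lra.
rewrite (le_trans (leb_lmass_mulmx T (J := J) (e := t / 3) _ _))//.
  move=> x xab; rewrite (@le_trans _ _ (`|a| + `|b|))//; last by apply: HN2; rewrite /J; lia.
  apply: norm_le_coord; first by rewrite addr_ge0.
  move=> i; have /andP[h1 h2] := xab i.
  have := coord_le_norm a i; have := coord_le_norm b i.
  rewrite !ler_norml => /andP[? ?] /andP[? ?]; apply/andP; split; lra.
rewrite lee_fin.
have -> : col_sums T * box_vol a b + e = col_sums T * (box_vol a b + e / col_sums T).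
  by field; rewrite gt_eqF.
rewrite ler_pM2l//.
apply: (@le_trans _ _ (lmass J (obox a' b'))).
  apply: dmass_mono; first by move=> z; rewrite exprn_ge0// ltW// mesh_gt0.
  move=> x [y yab xy] i; rewrite !mxE; have /andP[h1 h2] := yab i.
  have := le_lt_trans (coord_le_norm (x - y) i) xy.
  rewrite [(x - y) ord0 i]mxE [(- y) ord0 i]mxE ltr_norml => /andP[? ?].
  by apply/andP; split; lra.
apply: (le_trans (lmass_obox J ab')).
have hJ0 := mesh_gt0 R J.
have := Ht (2 * (t / 3) + mesh R J) _; rewrite /box_vol => H; apply: le_trans (H _); last first.
  by apply/andP; split; lra.
rewrite le_eqVlt; apply/orP; left; apply/eqP; apply: eq_bigr => i _.
by rewrite !mxE; field.
Qed.

Lemma col_sums_diag (d : 'rV[R]_n.+1) : col_sums (diag_mx d) = \prod_j `|d ord0 j|.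
Proof.
apply: eq_bigr => j _; rewrite (bigD1 j)//= big1 ?addr0 ?mxE ?eqxx//.
by move=> i ij; rewrite mxE (negbTE ij) mulr0n normr0.
Qed.

Lemma col_sums_perm (s : 'S_n.+1) : col_sums (perm_mx s) = 1 :> R.
Proof.
rewrite /col_sums big1// => j _; rewrite (bigD1 (s^-1 j)%g)//= big1 ?addr0.
  by rewrite !mxE permKV eqxx normr1.
move=> i ij; rewrite !mxE; case: eqP => [E|]; last by rewrite normr0.
by move: ij; rewrite -E permK eqxx.
Qed.

(* Conjugating by [diag (l ^ rho)] with [l] large makes a triangular matrix
   almost diagonal, so that the product of its column sums tends to its determinant. *)
Lemma scales_by_trig T (rho : 'I_n.+1 -> nat) :
  (forall i j, i != j -> (rho j <= rho i)%N -> T i j = 0) ->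
  (forall j, T j j != 0) -> scales_by T (\prod_j `|T j j|).
Proof.
move=> Ttrig Td A; have [->|A0] := eqVneq (leb A) +oo%E.
  rewrite gt0_muley ?leey//; rewrite lte_fin prodr_gt0// => j _.
  by rewrite normr_gt0.
have P0 : 0 < \prod_j `|T j j| by apply: prodr_gt0 => j _; rewrite normr_gt0.
have Afin : leb A \is a fin_num by rewrite ge0_fin_numE ?leb_ge0// ltey.
have LA := leb_ge0 A; rewrite -(fineK Afin) in LA *.
set c := fine (leb A) in LA *; rewrite lee_fin in LA.
apply/lee_addgt0Pr => e e0; rewrite -EFinM -EFinD.
have c1 : 0 < c + 1 by rewrite ltr_wpDl.
have e1 : 0 < e / (c + 1) by rewrite divr_gt0.
have [t t0 Ht] := prod_addr_cvg (fun j => `|T j j|) e1.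
pose S : R := \sum_i \sum_j `|T i j|.
have S0 : 0 <= S by apply: sumr_ge0 => i _; apply: sumr_ge0.
(* With this [l] the off-diagonal entries of a column of [T'] have absolute sum at most
   [S / l <= t]. *)
pose l : R := 1 + S / t.
have l1 : 1 <= l by rewrite lerDl divr_ge0// ltW.
have l0 : 0 < l by rewrite (lt_le_trans ltr01).
pose dg : 'rV[R]_n.+1 := \row_j (l ^+ rho j).
pose dg' : 'rV[R]_n.+1 := \row_j (l ^- rho j).
pose T' := diag_mx dg *m T *m diag_mx dg'.
have D1 : diag_mx dg' *m diag_mx dg = 1%:M.
  rewrite mulmx_diag -diag_const_mx; congr diag_mx; apply/rowP => j.
  by rewrite !mxE mulVf// expf_neq0// gt_eqF.
have TE : T = diag_mx dg' *m T' *m diag_mx dg.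
  by rewrite /T' !mulmxA D1 mul1mx -mulmxA D1 mulmx1.
have T'E i j : T' i j = l ^+ rho i * T i j * l ^- rho j.
  by rewrite /T' mul_diag_mx mul_mx_diag !mxE.
have T'd j : T' j j = T j j.
  by rewrite T'E mulrAC mulfV ?mul1r// expf_neq0// gt_eqF.
have cT' : col_sums T' <= \prod_j `|T j j| + e / (c + 1).
  apply: le_trans (Ht t _); last by rewrite lexx ltW.
  apply: ler_prod => j _; apply/andP; split; first exact: sumr_ge0.
  rewrite (bigD1 j)//= T'd lerD2l.
  apply: (@le_trans _ _ (\sum_(i | i != j) `|T i j| / l)).
    apply: ler_sum => i ij; rewrite T'E.
    have [rji|rij] := leqP (rho j) (rho i).
      by rewrite Ttrig// mulr0 mul0r !normr0 mul0r.
    rewrite !normrM mulrAC mulrC ler_wpM2l// -normrM ger0_norm; last first.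
      by rewrite mulr_ge0// ?invr_ge0 exprn_ge0// ltW.
    rewrite ler_pdivrMr ?exprn_gt0// mulrC ler_pdivlMr// -exprSr.
    by rewrite ler_weXn2l.
  rewrite -mulr_suml ler_pdivrMr//.
  apply: (@le_trans _ _ S).
    rewrite /S exchange_big /= [leRHS](bigD1 j)//= -[leLHS]addr0; apply: lerD.
      by rewrite [leRHS](bigD1 j)//= lerDr.
    by apply: sumr_ge0 => k _; apply: sumr_ge0.
  rewrite /l mulrDr mulr1 mulrCA mulfV ?gt_eqF// mulr1.
  by rewrite lerDr ltW.
have cT'0 : 0 < col_sums T'.
  apply: prodr_gt0 => j _; rewrite (bigD1 j)//= T'd ltr_pwDl ?normr_gt0//.
  exact: sumr_ge0.
have dg0 : 0 < \prod_j `|dg ord0 j|.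
  by apply: prodr_gt0 => j _; rewrite normr_gt0 mxE expf_neq0// gt_eqF.
have dg'0 : 0 < \prod_j `|dg' ord0 j|.
  by apply: prodr_gt0 => j _; rewrite normr_gt0 mxE invr_neq0// expf_neq0// gt_eqF.
have dgdg' : (\prod_j `|dg' ord0 j|) * \prod_j `|dg ord0 j| = 1.
  rewrite -big_split big1// => j _ /=; rewrite -normrM !mxE mulVf ?normr1//.
  by rewrite expf_neq0// gt_eqF.
have H1 := @scales_by_col_sums (diag_mx dg); rewrite col_sums_diag in H1.
have H2 := @scales_by_col_sums (diag_mx dg'); rewrite col_sums_diag in H2.
have := scales_by_mul (ltW dg0) (scales_by_mul (ltW cT'0) (H2 dg'0)
  (scales_by_col_sums cT'0)) (H1 dg0).
rewrite -TE mulrAC dgdg' mul1r => /(_ A) /le_trans; apply.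
rewrite -(fineK Afin) -EFinM lee_fin -/c.
apply: (@le_trans _ _ ((\prod_j `|T j j| + e / (c + 1)) * c)); first by rewrite ler_wpM2r.
rewrite mulrDl lerD2l mulrAC ler_pdivrMr// ler_wpM2l// ?(ltW e0)// lerDl//.
Qed.

(** LUP decomposition: a permutation matrix has column sums [1], and the two triangular factors
    satisfy [scales_by_trig] for opposite gradings of the indices. *)
Lemma scales_by_det (g : 'M[R]_n.+1) : g \in unitmx -> scales_by g `|\det g|.
Proof.
move=> ug; have := cormen_lup_correct g; have := cormen_lup_perm g.
have := @cormen_lup_lower _ _ g; have := @cormen_lup_upper _ _ g.
case: (cormen_lup g) => -[P L] U /= HU HL /is_perm_mxP[s ->] E.
have dL : \det L = 1.
  rewrite det_trig; last by apply/is_trig_mxP => i j ij; rewrite HL ?(ltnW ij)// -(inj_eq val_inj) ltn_eqF.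
  by rewrite big1// => i _; rewrite HL// eqxx.
have dU : \det U = \prod_i U i i.
  rewrite -det_tr det_trig; first by apply: eq_bigr => i _; rewrite mxE.
  by apply/is_trig_mxP => i j ij; rewrite mxE HU.
have gE : g = perm_mx s^-1 *m L *m U.
  have {}E : perm_mx s *m g = L *m U := E; rewrite -mulmxA -E.
  by rewrite mulmxA -perm_mxM mulVg perm_mx1 mul1mx.
have dg : `|\det g| = `|\det U|.
  rewrite gE !det_mulmx dL mulr1 normrM det_perm normrX normrN1 expr1n mul1r//.
have U0 j : U j j != 0.
  have : \det g != 0 by rewrite -unitfE -unitmxE.
  by rewrite -normr_eq0 dg dU normr_eq0 => /prodf_neq0 /(_ j isT).
have SU : scales_by U (\prod_j `|U j j|).
  apply: (@scales_by_trig _ (@nat_of_ord _)) => // i j ij ji; apply: HU.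
  by rewrite ltn_neqAle ji andbT (inj_eq val_inj) eq_sym.
have SL : scales_by L (\prod_j `|L j j|).
  apply: (@scales_by_trig _ (fun i => (n - i)%N)) => // [i j ij ji|j]; last first.
    by rewrite HL// eqxx oner_neq0.
  rewrite HL ?(negbTE ij)//.
  by have := ltn_ord i; have := ltn_ord j; lia.
have SP : scales_by (perm_mx s^-1) 1.
  by rewrite -(col_sums_perm s^-1); apply: scales_by_col_sums; rewrite col_sums_perm.
rewrite dg dU normr_prod gE.
have pL : \prod_j `|L j j| = 1 by rewrite big1// => j _; rewrite HL// eqxx normr1.
have -> : \prod_i `|U i i| = 1 * (\prod_j `|L j j|) * \prod_i `|U i i|.
  by rewrite pL !mul1r.
by apply: scales_by_mul; [exact: prodr_ge0|apply: scales_by_mul => //; exact: prodr_ge0|].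
Qed.

Lemma leb_mulmx (g : 'M[R]_n.+1) A : g \in unitmx ->
  leb [set x *m g | x in A] = (`|\det g|%:E * leb A)%E.
Proof.
move=> ug; apply/eqP; rewrite eq_le scales_by_det//=.
have dg0 : 0 < `|\det g| by rewrite normr_gt0 -unitfE -unitmxE.
rewrite -lee_pdivlMl//.
have := @scales_by_det (invmx g) _ [set x *m g | x in A].
rewrite unitmx_inv det_inv normfV => /(_ ug); congr (leb _ <= _)%E.
apply/seteqP; split=> [_ [_ [x Ax <-] <-]|x Ax]; first by rewrite mulmxK.
by exists (x *m g); [exists x|rewrite mulmxK].
Qed.

Lemma leb_preimage_mulmx (g : 'M[R]_n.+1) A : g \in unitmx ->
  leb [set x | A (x *m g)] = (`|\det g|^-1%:E * leb A)%E.
Proof.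
move=> ug; rewrite -normfV -det_inv -leb_mulmx ?unitmx_inv//; congr leb.
apply/seteqP; split=> [x Ax|_ [x Ax <-]] /=; last by rewrite mulmxKV.
by exists (x *m g) => //; rewrite mulmxK.
Qed.

End LebLinear.

(** * Almost disjoint unions and null sets *)

Section NullSets.
Variables (R : realType) (n : nat).
Notation V := 'rV[R]_n.+1.
Implicit Types (A B : set V) (u : V).
Local Notation leb := (@leb_outer R n.+1).

Lemma leb_null_bigU (I : Type) (s : seq I) (F : I -> set V) :
  (forall i, leb (F i) = 0%E) -> leb (\big[setU/set0]_(i <- s) F i) = 0%E.
Proof.
move=> F0; apply/eqP; rewrite eq_le leb_ge0 andbT (le_trans (leb_bigU _ _ _))//.
by rewrite big1.
Qed.

Lemma leb_null_sub A B : A `<=` B -> leb B = 0%E -> leb A = 0%E.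
Proof.
by move=> AB B0; apply/eqP; rewrite eq_le leb_ge0 andbT -B0 leb_mono.
Qed.

(** Induction with [leb_compactUI]: each new piece meets the union of the others in a null set.
    Together with subadditivity this gives additivity for almost disjoint compact sets. *)
Lemma leb_superadd (I : choiceType) (s : seq I) (F : I -> set V) : uniq s ->
  (forall i, compact (F i)) ->
  (forall i j, i \in s -> j \in s -> i != j -> leb (F i `&` F j) = 0%E) ->
  (\sum_(i <- s) leb (F i) <= leb (\big[setU/set0]_(i <- s) F i))%E.
Proof.
move=> + cF; elim: s => [_ _|i s IH /= /andP[si us] F0]; first by rewrite !big_nil leb_ge0.
rewrite !big_cons; set B := \big[setU/set0]_(j <- s) _.
have cB : compact B by apply: bigsetU_compact.
apply: (@le_trans _ _ (leb (F i) + leb B)%E).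
  rewrite leeD2l// IH// => j k js ks jk; apply: F0 => //; rewrite inE ?js ?ks orbT//.
apply: (le_trans (leb_compactUI (cF i) cB)).
suff -> : leb (F i `&` B) = 0%E by rewrite adde0.
apply/eqP; rewrite eq_le leb_ge0 andbT.
apply: (@le_trans _ _ (leb (\big[setU/set0]_(j <- s) (F i `&` F j)))).
  by apply: leb_mono; rewrite /B -!bigcup_seq => x [Fx [j js Fj]]; exists j.
rewrite (le_trans (leb_bigU _ _ _))// big_seq big1// => j js.
apply: F0; rewrite ?inE ?eqxx ?js ?orbT//.
by apply: contraNneq si => ->.
Qed.

(** The translates of [A] by [(j / m) *: u] for [j < m] are pairwise disjoint, have the measure of
    [A] and stay in one ball. Hence [m] times the measure of [A] is bounded independently of [m]. *)
Lemma leb_null_translates A u : compact A ->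
  (forall (s : R) x, 0 < s -> A x -> ~ A (x + s *: u)) -> leb A = 0%E.
Proof.
move=> cA Au; have [r r0 Ar] := @compact_norm_bound R V A cA.
have Afin : leb A \is a fin_num by exact: leb_fin Ar.
apply/eqP; rewrite eq_le leb_ge0 andbT -(fineK Afin) lee_fin leNgt.
apply/negP => A0.
pose B : set V := [set x | `|x| <= r + `|u|].
have Bfin : leb B \is a fin_num by apply: (@leb_fin _ _ _ (r + `|u|)).
have B0 : 0 <= fine (leb B) by rewrite fine_ge0// leb_ge0.
pose m := (Num.truncn (fine (leb B) / fine (leb A))).+1.
have m0 : 0 < m%:R :> R by rewrite ltr0n.
pose F (j : nat) : set V := [set x + (j%:R / m%:R) *: u | x in A].
have cF j : compact (F j).
  apply: (@continuous_compact _ _ (fun x : V => x + (j%:R / m%:R) *: u)) => //.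
  by apply: continuous_subspaceT; exact: (@cont_shift R V).
have dF j k : (j < k)%N -> F j `&` F k = set0.
  move=> jk; apply/seteqP; split=> // _ [[x Ax <-] [y Ay E]].
  apply: (Au ((k%:R - j%:R) / m%:R) y _ Ay).
    by rewrite divr_gt0// subr_gt0 ltr_nat.
  suff -> : y + ((k%:R - j%:R) / m%:R) *: u = x by [].
  by rewrite mulrBl scalerBl addrA E addrK.
have := @leb_superadd _ (iota 0 m) F (iota_uniq _ _) cF.
have /[swap] /[apply] : forall i j, i \in iota 0 m -> j \in iota 0 m -> i != j ->
    leb (F i `&` F j) = 0%E.
  move=> i j _ _ ij; have [ij'|ij'] := ltnP i j; first by rewrite dF// leb0.
  by rewrite setIC dF ?leb0// ltn_neqAle eq_sym ij.
have Fl j : leb (F j) = (fine (leb A))%:E by rewrite leb_shift fineK.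
rewrite [X in (X <= _)%E](eq_bigr (fun=> (fine (leb A))%:E)); last by move=> j _; exact: Fl.
have sub : \big[setU/set0]_(i <- iota 0 m) F i `<=` B.
  rewrite -bigcup_seq => _ [j jm [x Ax <-]].
  rewrite /B /= (le_trans (ler_normD _ _))// lerD ?Ar// normrZ ler_piMl//.
  rewrite ger0_norm ?divr_ge0// ler_pdivrMr// mul1r ler_nat.
  by have : j \in iota 0 m by []; rewrite mem_iota add0n => /andP[_ /ltnW].
move=> /le_trans/(_ (leb_mono sub)); rewrite sumEFin -(fineK Bfin) lee_fin.
rewrite big_const_seq count_predT size_iota iter_addr_0 -[_ *+ m]mulr_natl -ler_pdivlMr//.
by rewrite leNgt truncnS_gt.
Qed.

Lemma vdot_gt0 u : u != 0 -> 0 < vdot u u.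
Proof.
move=> u0; have [i ui] : exists i, u ord0 i != 0.
  apply/existsP; apply: contraNT u0; rewrite negb_exists => /forallP H.
  apply/eqP/rowP => i; rewrite mxE; apply/eqP; have := H i; by rewrite negbK.
rewrite /vdot (bigD1 i)//= ltr_pwDl//; first by rewrite -expr2 exprn_even_gt0//= ui.
by apply: sumr_ge0 => j _; rewrite -expr2 sqr_ge0.
Qed.

Lemma leb_null_hyperplane A u (al : R) : u != 0 -> compact A ->
  (forall x, A x -> vdot x u = al) -> leb A = 0%E.
Proof.
move=> u0 cA Au; apply: (@leb_null_translates _ u) => // s x s0 /Au E /Au.
rewrite vdotDl E vdotZl; have := mulr_gt0 s0 (vdot_gt0 u0); lra.
Qed.

End NullSets.

(** * Darboux sums of nonincreasing functions *)

Section Darboux.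
Variable (R : realType).
Implicit Types (m : R -> \bar R) (d : R).

Lemma nonincreasing_emeasurable (D : set R) m : measurable D ->
  (forall s t, s <= t -> (m t <= m s)%E) -> measurable_fun D m.
Proof.
move=> mD m_ni.
apply: (measurability (@ErealGenCInfty.G R)) => [|/= _ [_] [r] -> <-].
  exact: ErealGenCInfty.measurableE.
apply: measurableI => //; apply: is_interval_measurable => s t/=.
rewrite !in_itv/= !andbT => fs ft u /andP[su ut].
by rewrite in_itv/= andbT (le_trans ft)// m_ni.
Qed.

Lemma itv_cyE (a : R) : [set t : R | a <= t] = `[a, +oo[%classic.
Proof. by apply/seteqP; split=> t /=; rewrite in_itv/= andbT. Qed.

Lemma darboux m d N : 0 < d -> (forall s t, s <= t -> (m t <= m s)%E) ->
  (forall t, (0 <= m t)%E) -> (forall t, N%:R * d <= t -> m t = 0%E) ->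
  (d%:E * \sum_(l < N) m (l.+1%:R * d)%R <=
     \int[lebesgue_measure]_(t in [set t : R | (0 <= t)%R]) m t)%E /\
  (\int[lebesgue_measure]_(t in [set t : R | (0 <= t)%R]) m t <=
     d%:E * \sum_(l < N) m (l%:R * d)%R)%E.
Proof.
move=> d0 m_ni m0 mN.
(* Tail integrals: consecutive ones differ by a single term of the Darboux sums, and [I N]
   vanishes. *)
pose I (k : nat) := (\int[lebesgue_measure]_(t in `[(k%:R * d)%R, +oo[%classic) m t)%E.
have mm D : measurable D -> measurable_fun D m by move=> mD; exact: nonincreasing_emeasurable.
have IN : I N = 0%E.
  rewrite /I; apply: integral0_eq => t /=; rewrite in_itv/= andbT; exact: mN.
have step k : (d%:E * m (k.+1%:R * d)%R + I k.+1 <= I k /\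
    I k <= d%:E * m (k%:R * d)%R + I k.+1)%E.
  have k1 : k.+1%:R * d = k%:R * d + d by rewrite -addn1 natrD mulrDl mul1r.
  have -> : I k = (\int[lebesgue_measure]_(t in `[(k%:R * d)%R, (k.+1%:R * d)%R[%classic) m t
      + I k.+1)%E.
    rewrite /I -ge0_integral_setU//=; last 2 first.
    - by apply: mm; apply: measurableU.
    - apply/disj_setPRL => t /=; rewrite !in_itv/= andbT => H1 /andP[_]; by rewrite ltNge H1.
    congr (integral _ _ _); apply/seteqP; split=> t /=; rewrite !in_itv/= !andbT.
      by move=> ->; have [_|_] := ltP t (k.+1%:R * d); [left|right].
    by move=> [/andP[]//|]; rewrite k1; lra.
  have mu_d : lebesgue_measure `[(k%:R * d)%R, (k.+1%:R * d)%R[%classic = d%:E.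
    rewrite lebesgue_measure_itv/= lte_fin k1 ltrDl d0 -EFinB; congr EFin; ring.
  split; apply: leeD => //.
    rewrite -mu_d muleC -integral_cst//; apply: ge0_le_integral => //.
    - by move=> t _; exact: m0.
    - exact: mm.
    - by move=> t /=; rewrite in_itv/= => /andP[_ /ltW]; exact: m_ni.
  rewrite -mu_d muleC -integral_cst//; apply: ge0_le_integral => //.
  - exact: mm.
  - by move=> t /=; rewrite in_itv/= => /andP[]; move/m_ni.
have tele k : (d%:E * \sum_(l < k) m (l.+1%:R * d)%R + I k <= I 0%N /\
    I 0%N <= d%:E * \sum_(l < k) m (l%:R * d)%R + I k)%E.
  elim: k => [|k [IH1 IH2]]; first by rewrite !big_ord0 mule0 add0e.
  have [S1 S2] := step k.
  rewrite !big_ord_recr /= !ge0_muleDr//; try exact: sume_ge0.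
  split.
    by rewrite -addeA (le_trans _ IH1)// leeD2l.
  by rewrite -addeA (le_trans IH2)// leeD2l.
have [T1 T2] := tele N; rewrite IN !adde0 in T1 T2.
have -> : (\int[lebesgue_measure]_(t in [set t : R | (0 <= t)%R]) m t)%E = I 0%N.
  by rewrite itv_cyE /I mul0r.
by split.
Qed.

End Darboux.

(** * Convergence of weighted point sums to layer-cake integrals *)

Section LayerCake.
Variables (R : realType) (n : nat).
Notation V := 'rV[R]_n.+1.
Implicit Types (phi : V -> R) (nu : set V -> \bar R).

Definition layer_pos nu phi : \bar R :=
  (\int[lebesgue_measure]_(t in [set t : R | (0 <= t)%R]) nu [set x | (t < phi x)%R])%E.

Lemma layer_integralE nu phi : layer_integral nu phi =
  fine (layer_pos nu phi) - fine (layer_pos nu (fun x => - phi x)).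
Proof.
rewrite /layer_integral; congr (_ - fine (integral _ _ _)); apply/funext => t.
by congr nu; apply/seteqP; split=> x /=; rewrite ltrNr.
Qed.

(** Layer cake for a single number: this lower staircase and the upper one of [step_ge] enclose the
    positive part of [a]. Both are proved by induction on [L] after capping [a] at [L%:R * d]. *)
Lemma step_le (a d : R) L : 0 < d ->
  d * \sum_(l < L) (l.+1%:R * d < a)%R%:R <= Num.max a 0.
Proof.
move=> d0.
suff : d * \sum_(l < L) (l.+1%:R * d < a)%R%:R <= Num.max (Num.min a (L%:R * d)) 0.
  move/le_trans; apply; rewrite ge_max !le_max lexx orbT andbT.
  by rewrite ge_min lexx.
elim: L => [|L IH]; first by rewrite big_ord0 mulr0 le_max lexx orbT.
rewrite big_ord_recr /= mulrDr.
have L1 : L.+1%:R * d = L%:R * d + d by rewrite -addn1 natrD mulrDl mul1r.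
have L0 : 0 <= L%:R * d by rewrite mulr_ge0// ltW.
move: IH; set S := d * _ => IH.
have [H|H] := boolP (L.+1%:R * d < a); rewrite /= ?mulr1 ?mulr0 ?addr0.
  rewrite (min_idPr (ltW H)); move: IH; rewrite (min_idPr _); last by lra.
  rewrite (max_idPl _) // => IH; rewrite (max_idPl _); lra.
rewrite (le_trans IH)// ge_max !le_max lexx orbT andbT.
by apply/orP; left; rewrite le_min !ge_min lexx /= L1; apply/orP; right; lra.
Qed.

Lemma step_ge (a d : R) L : 0 < d -> a <= L%:R * d ->
  Num.max a 0 <= d * \sum_(l < L) (l%:R * d < a)%R%:R.
Proof.
move=> d0 aL.
suff : Num.max (Num.min a (L%:R * d)) 0 <= d * \sum_(l < L) (l%:R * d < a)%R%:R.
  by apply: le_trans; rewrite (min_idPl aL).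
elim: L {aL} => [|L IH].
  by rewrite big_ord0 mulr0 mul0r ge_max lexx andbT ge_min lexx orbT.
rewrite big_ord_recr /= mulrDr.
have L1 : L.+1%:R * d = L%:R * d + d by rewrite -addn1 natrD mulrDl mul1r.
have L0 : 0 <= L%:R * d by rewrite mulr_ge0// ltW.
move: IH; set S := d * _ => IH.
have [H|H] := boolP (L%:R * d < a); rewrite /= ?mulr1 ?mulr0 ?addr0.
  move: IH; rewrite (min_idPr (ltW H)) (max_idPl _)// => IH.
  rewrite ge_max; apply/andP; split; last by lra.
  by rewrite ge_min L1; apply/orP; right; lra.
apply: le_trans IH; rewrite ge_max !le_max lexx orbT andbT.
by apply/orP; left; rewrite le_min !ge_min lexx /= ; apply/orP; left; lra.
Qed.

Lemma sum_shift_le (a : nat -> R) L : (forall l, 0 <= a l) ->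
  \sum_(l < L) a l <= a 0%N + \sum_(l < L) a l.+1.
Proof.
move=> a0; have <- : \sum_(l < L.+1) a l = a 0%N + \sum_(l < L) a l.+1.
  by rewrite big_ord_recl.
by rewrite big_ord_recr /= lerDl.
Qed.

Variables (nu : set V -> \bar R) (I : nat -> finType).
Variables (w : forall j, I j -> R) (p : forall j, I j -> V).
Hypothesis nu_mono : forall A B, A `<=` B -> (nu A <= nu B)%E.
Hypothesis nu_ge0 : forall A, (0 <= nu A)%E.
Hypothesis nu0 : nu set0 = 0%E.
Hypothesis nu_fin : forall r : R, nu [set x | `|x| <= r] \is a fin_num.
Hypothesis w_ge0 : forall j i, 0 <= w (j := j) i.
Hypothesis nu_lb : forall (K U : set V) (e : R), compact K -> open U -> K `<=` U ->
  (exists r : R, U `<=` [set x | `|x| <= r]) -> 0 < e ->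
  exists N, forall j, (N <= j)%N -> ((dmass (@w j) (@p j) K)%:E <= nu U + e%:E)%E.
Hypothesis nu_ub : forall (K U : set V) (e : R), compact K -> open U -> K `<=` U ->
  (exists r : R, U `<=` [set x | `|x| <= r]) -> 0 < e ->
  exists N, forall j, (N <= j)%N -> (nu K <= (dmass (@w j) (@p j) U)%:E + e%:E)%E.

(** A portmanteau argument. The closed level set [K l] lies between [U l.+1] and [U l], so the
    hypotheses compare [dmass] and [nu] on consecutive levels. The shift by one level costs only the
    mass of the bottom level times the height [d]; no additivity of [nu] enters. *)
Lemma layer_pos_cvg phi (e : R) : Cc phi -> 0 < e -> exists N, forall j, (N <= j)%N ->
  `|\sum_i w i * Num.max (phi (p (j := j) i)) 0 - fine (layer_pos nu phi)| <= e.
Proof.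
move=> Cp e0; have [M M0 HM] := Cc_bounded Cp.
have /CcP[cp [r r0 Hr]] := Cp.
pose Us : set V := [set x | `|x| < r + 1].
have oUs : open Us.
  apply/(@open_epsP R V) => x xr; exists (r + 1 - `|x|); first by rewrite subr_gt0.
  move=> y yx; rewrite /Us /= -(subrK x y) (le_lt_trans (ler_normD _ _))//.
  by rewrite -ltrBrDr.
have bUs : exists r' : R, Us `<=` [set x | `|x| <= r'].
  by exists (r + 1) => x /ltW.
pose Ks : set V := [set x | `|x| <= r].
have KUs : Ks `<=` Us by move=> x; rewrite /Ks /Us /=; lra.
have cKs : compact Ks by exact: compact_ball0.
have bfin A : (exists r' : R, A `<=` [set x | `|x| <= r']) -> nu A \is a fin_num.
  move=> [r' Ar']; rewrite ge0_fin_numE//.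
  apply: le_lt_trans (nu_mono Ar') _; rewrite -ge0_fin_numE//; exact: nu_fin.
pose B0 := fine (nu Us); have B00 : 0 <= B0 by rewrite fine_ge0.
pose M1 := M + 1; have M10 : 0 < M1 by rewrite addr_gt0.
(* Each of the [L] levels of height [d] contributes an error [d * e'], in total [M1 * e' <= e / 2];
   the bound [1] is for the bottom level, in [sB]. *)
pose e' := Num.min 1 (e / 2 / M1).
have e'0 : 0 < e' by rewrite lt_min ltr01 !divr_gt0.
have e'1 : e' <= 1 by rewrite ge_min lexx.
have e'2 : M1 * e' <= e / 2.
  by rewrite mulrC -ler_pdivlMr// ge_min lexx orbT.
have B1 : 0 < 2 * B0 + 1 by rewrite ltr_wpDl// mulr_ge0.
(* Fine enough that the bottom levels of the two sums, of mass at most [B0 + 1] and [B0], contribute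
   together at most [e / 2] at height [d]. *)
pose L := (Num.truncn (M1 * (2 * B0 + 1) / (e / 2))).+1.
have L0 : 0 < L%:R :> R by rewrite ltr0n.
pose d := M1 / L%:R.
have d0 : 0 < d by rewrite divr_gt0.
have Ld : L%:R * d = M1 by rewrite /d mulrCA mulfV ?mulr1// gt_eqF.
have dB : d * (2 * B0 + 1) <= e / 2.
  rewrite /d mulrAC ler_pdivrMr// mulrC [X in _ <= X]mulrC -ler_pdivrMr ?divr_gt0//.
  by rewrite mulrC (le_trans (ltW (truncnS_gt _))).
pose U (l : nat) : set V := [set x | l%:R * d < phi x].
pose K (l : nat) : set V := [set x | l.+1%:R * d <= phi x].
have ld0 l : 0 <= l%:R * d by rewrite mulr_ge0// ltW.
have UKs l : U l `<=` Ks.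
  move=> x; rewrite /U /Ks /= => H; rewrite leNgt; apply/negP => /Hr E.
  by have := ld0 l; rewrite E in H; lra.
have bU l : exists r' : R, U l `<=` [set x | `|x| <= r'] by exists r; exact: UKs.
have oU l : open (U l).
  apply: (@open_comp _ _ phi [set y | l%:R * d < y]); first by move=> x _; exact: cp.
  exact: open_gt.
have KU l : K l `<=` U l.
  move=> x; rewrite /K /U /=; have -> : l.+1%:R * d = l%:R * d + d.
    by rewrite -addn1 natrD mulrDl mul1r.
  lra.
have UK l : U l.+1 `<=` K l by move=> x; rewrite /U /K /=; exact: ltW.
have cK l : compact (K l).
  apply: (@subclosed_compact _ _ Ks) => //; last exact: subset_trans (UKs l).
  apply: (@closed_comp _ _ phi [set y | l.+1%:R * d <= y]); first by move=> x _; exact: cp.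
  exact: closed_ge.
pose u l := fine (nu (U l)).
have uE l : nu (U l) = (u l)%:E by rewrite fineK// bfin.
have u0 l : 0 <= u l by rewrite fine_ge0.
have uB l : u l <= B0.
  rewrite -lee_fin -uE /B0 fineK ?bfin//; apply: nu_mono.
  exact: subset_trans (UKs l) KUs.
have [lay1 lay2] : d * (\sum_(l < L) u l.+1) <= fine (layer_pos nu phi) /\
    fine (layer_pos nu phi) <= d * (\sum_(l < L) u l).
  have := @darboux R (fun t => nu [set x | t < phi x]) d L d0.
  case.
  - by move=> s t st; apply: nu_mono => x /=; exact: le_lt_trans.
  - by move=> t; exact: nu_ge0.
  - move=> t; rewrite Ld /M1 => Mt; rewrite -nu0; congr nu.
    apply/seteqP; split=> x //=; have := HM x; rewrite ler_norml => /andP[_].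
    lra.
  rewrite -/(layer_pos nu phi).
  under eq_bigr do rewrite -/(U _) uE.
  under [X in _ -> (_ <= _ * X)%E -> _]eq_bigr do rewrite -/(U _) uE.
  rewrite !sumEFin -!EFinM => h1 h2.
  have lf : layer_pos nu phi \is a fin_num.
    by rewrite fin_numElt (lt_le_trans _ h1) ?ltNyr// (le_lt_trans h2)// ltry.
  by rewrite -!lee_fin fineK.
have [N0 HN0] := nu_lb cKs oUs KUs bUs e'0.
have [N1 HN1] := choice (fun l : 'I_L => nu_lb (cK l) (oU l) (@KU l) (bU l) e'0).
have [N2 HN2] := choice (fun l : 'I_L => nu_ub (cK l) (oU l) (@KU l) (bU l) e'0).
exists (N0 + \max_l N1 l + \max_l N2 l)%N => j Nj.
have Nj0 : (N0 <= j)%N by apply: leq_trans Nj; rewrite -addnA leq_addr.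
have Nj1 : (\max_l N1 l <= j)%N by apply: leq_trans Nj; rewrite addnAC leq_addl.
have Nj2 : (\max_l N2 l <= j)%N by apply: leq_trans Nj; rewrite leq_addl.
pose s l := dmass (@w j) (@p j) (U l).
have s0 l : 0 <= s l by apply: sumr_ge0.
have s1 (l : 'I_L) : s l.+1 <= u l + e'.
  have : (N1 l <= j)%N by exact: leq_trans (leq_bigmax l) _.
  move=> /HN1; rewrite uE -EFinD lee_fin; apply: le_trans.
  exact: dmass_mono.
have s2 (l : 'I_L) : u l.+1 <= s l + e'.
  have : (N2 l <= j)%N by exact: leq_trans (leq_bigmax l) _.
  move=> /HN2; rewrite -EFinD => H; rewrite -lee_fin -uE; apply: le_trans H.
  exact: nu_mono.
have sB : s 0%N <= B0 + e'.
  move: Nj0 => /HN0; rewrite -(fineK (bfin _ bUs)) -EFinD lee_fin; apply: le_trans.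
  by apply: dmass_mono => //; exact: UKs.
pose S := \sum_i w i * Num.max (phi (p (j := j) i)) 0.
(* Layer cake for the point masses: the sum over levels is exchanged with the sum over points. *)
have swap (k : nat -> nat) : d * \sum_(l < L) s (k l) =
    \sum_i w i * (d * \sum_(l < L) ((k l)%:R * d < phi (p (j := j) i))%R%:R).
  rewrite mulr_sumr /s /dmass.
  under eq_bigr do rewrite big_mkcond mulr_sumr.
  rewrite exchange_big /=; apply: eq_bigr => i _.
  rewrite mulrCA mulr_sumr mulr_sumr; apply: eq_bigr => l _; congr (_ * _).
  have [H|H] := boolP (p i \in U (k l)).
    by move: H => /set_mem; rewrite /U /= => ->; rewrite mulr1.
  have -> : ((k l)%:R * d < phi (p i)) = false.
    by apply/negbTE; apply: contra H => H; apply/mem_set.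
  by rewrite mulr0.
have S1 : d * (\sum_(l < L) s l.+1) <= S.
  by rewrite (swap succn); apply: ler_sum => i _; rewrite ler_wpM2l// step_le.
have S2 : S <= d * (\sum_(l < L) s l).
  rewrite (swap id); apply: ler_sum => i _; rewrite ler_wpM2l// step_ge//.
  by have := HM (p i); rewrite ler_norml Ld /M1 => /andP[_]; lra.
have A1 : d * (\sum_(l < L) s l) <= d * (s 0%N + \sum_(l < L) s l.+1).
  by rewrite ler_pM2l// sum_shift_le.
have A2 : d * (\sum_(l < L) u l) <= d * (u 0%N + \sum_(l < L) u l.+1).
  by rewrite ler_pM2l// sum_shift_le.
have A3 : d * (\sum_(l < L) s l.+1) <= d * (\sum_(l < L) u l) + M1 * e'.
  rewrite -Ld -mulrA mulrCA -mulrDr ler_pM2l//.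
  have -> : L%:R * e' = \sum_(l < L) e' by rewrite sumr_const card_ord mulr_natl.
  by rewrite -big_split; apply: ler_sum => l _; exact: s1.
have A4 : d * (\sum_(l < L) u l.+1) <= d * (\sum_(l < L) s l) + M1 * e'.
  rewrite -Ld -mulrA mulrCA -mulrDr ler_pM2l//.
  have -> : L%:R * e' = \sum_(l < L) e' by rewrite sumr_const card_ord mulr_natl.
  by rewrite -big_split; apply: ler_sum => l _; exact: s2.
have A5 : d * s 0%N <= d * (B0 + 1) by rewrite ler_pM2l// (le_trans sB)// lerD2l.
have A6 : d * u 0%N <= d * B0 by rewrite ler_pM2l// uB.
rewrite -/S ler_norml; rewrite !mulrDr ?mulr1 in A1 A2 A5 dB.
have A7 : d * (2 * B0) = 2 * (d * B0) by ring.
apply/andP; split; lra.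
Qed.

Lemma layer_cvg phi : Cc phi ->
  (fun j => \sum_i w i * phi (p (j := j) i)) @ \oo --> layer_integral nu phi.
Proof.
move=> Cp; apply/cvgrPdist_le => e e0.
have e20 : 0 < e / 2 by rewrite divr_gt0.
have [N1 H1] := layer_pos_cvg Cp e20.
have [N2 H2] := layer_pos_cvg (CcN Cp) e20.
exists (N1 + N2)%N => // j /= Nj.
have {}H1 := H1 j (leq_trans (leq_addr _ _) Nj).
have {}H2 := H2 j (leq_trans (leq_addl _ _) Nj).
have -> : \sum_i w i * phi (p (j := j) i) =
    \sum_i w i * Num.max (phi (p (j := j) i)) 0 -
    \sum_i w i * Num.max (- phi (p (j := j) i)) 0.
  rewrite -sumrB; apply: eq_bigr => i _; rewrite -mulrBr; congr (_ * _).
  have [h|h] := leP (phi (p i)) 0.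
    rewrite (max_idPl _); lra.
  rewrite (max_idPr _); lra.
rewrite layer_integralE; move: H1 H2; rewrite !ler_norml.
by move=> /andP[? ?] /andP[? ?]; apply/andP; split; lra.
Qed.

End LayerCake.

(** * Convex functions: local bounds, subgradients and their images *)

Section ConvexFunctions.
Variables (R : realType) (n : nat).
Notation V := 'rV[R]_n.+1.
Implicit Types (f : V -> R) (x y z : V).
Local Notation leb := (@leb_outer R n.+1).

(** Jensen's inequality for equal weights; the last of [m.+2] points is split off with weight
    [1 / m.+2]. *)
Lemma convex_average f : convex_fun f -> forall (m : nat) (y : nat -> V),
  f (m.+1%:R^-1 *: \sum_(i < m.+1) y i) <= m.+1%:R^-1 * \sum_(i < m.+1) f (y i).
Proof.
move=> cf; elim=> [|m IH] y.
  by rewrite !big_ord_recl !big_ord0 !addr0 invr1 scale1r mul1r.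
rewrite big_ord_recr [X in _ <= _ * X]big_ord_recr /=.
set S := \sum_(i < m.+1) y i; set T := \sum_(i < m.+1) f (y i).
have p0 : m.+1%:R != 0 :> R by rewrite pnatr_eq0.
have q0 : m.+2%:R != 0 :> R by rewrite pnatr_eq0.
have q1 : m.+2%:R = m.+1%:R + 1 :> R by rewrite -[m.+2]addn1 natrD.
have t01 : 0 <= (m.+2%:R^-1 : R) <= 1.
  by rewrite invr_ge0 ler0n /= invf_le1 ?ltr0n// ler1n.
have u : 1 - m.+2%:R^-1 = m.+2%:R^-1 * m.+1%:R :> R.
  by apply: (mulfI q0); rewrite mulrBr mulr1 mulrA mulfV// mul1r q1 addrK.
have -> : m.+2%:R^-1 *: (S + y m.+1) =
    (1 - m.+2%:R^-1) *: (m.+1%:R^-1 *: S) + m.+2%:R^-1 *: y m.+1.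
  by rewrite u scalerA -mulrA mulfV// mulr1 -scalerDr.
rewrite (le_trans (cf _ _ _ t01))// mulrDr lerD2r u -mulrA.
by rewrite ler_pM2l ?invr_gt0// (le_trans (ler_wpM2l _ (IH y)))// mulrA mulfV// mul1r.
Qed.

(** [x] is the average of [n.+1] points on the coordinate axes, where convexity bounds [f] by its
    values at [c] and [- c] times the unit vectors. The lower bound compares [x] and [- x] at their
    midpoint [0]. *)
Lemma convex_bounded f (r : R) : convex_fun f -> 0 < r ->
  exists2 B : R, 0 < B & forall x, `|x| <= r -> `|f x| <= B.
Proof.
move=> cf r0.
(* Averaging divides by [n.+1], so the axis points have coordinates up to [n.+1] times [r]. *)
pose c : R := n.+1%:R * r.
have c0 : 0 < c by rewrite mulr_gt0.
pose e (i : nat) : V := delta_mx ord0 (inord i).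
pose M : R := \sum_(i < n.+1) (`|f (c *: e i)| + `|f (- c *: e i)|).
have M0 : 0 <= M by apply: sumr_ge0 => i _; rewrite addr_ge0.
have line (t : R) i : `|t| <= c -> f (t *: e i) <= `|f (c *: e i)| + `|f (- c *: e i)|.
  move=> tc; pose s := (t + c) / (2 * c).
  have tc' : - c <= t <= c by rewrite -ler_norml.
  have s01 : 0 <= s <= 1.
    rewrite divr_ge0/= ?ler_pdivrMr ?mulr_gt0 ?mulr_ge0//; [lra|lra|by rewrite ltW].
  have -> : t *: e i = (1 - s) *: (- c *: e i) + s *: (c *: e i).
    rewrite !scalerA -scalerDl; congr (_ *: _); rewrite /s; field; lra.
  rewrite (le_trans (cf _ _ _ s01))// addrC.
  have /andP[s0 s1] := s01.
  apply: lerD.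
    rewrite (le_trans (ler_norm _))// normrM ger0_norm// ler_piMl//.
  rewrite (le_trans (ler_norm _))// normrM ger0_norm ?subr_ge0// ler_piMl//; lra.
have ub x : `|x| <= r -> f x <= M.
  move=> xr.
  pose y (i : nat) : V := (n.+1%:R * x ord0 (inord i)) *: e i.
  have xE : x = n.+1%:R^-1 *: \sum_(i < n.+1) y i.
    rewrite scaler_sumr [LHS]row_sum_delta; apply: eq_bigr => i _.
    by rewrite /y /e inord_val scalerA mulrA mulVf ?mul1r.
  rewrite {1}xE (le_trans (convex_average cf _ _))//.
  apply: (@le_trans _ _ (\sum_(i < n.+1) (`|f (c *: e i)| + `|f (- c *: e i)|) / n.+1%:R)).
    rewrite mulr_sumr; apply: ler_sum => i _; rewrite mulrC ler_pM2r ?invr_gt0//.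
    apply: line; rewrite normrM ger0_norm// ler_pM2l// (le_trans (coord_le_norm _ _))//.
  rewrite -mulr_suml ler_pdivrMr// ler_peMr// ler1n//.
exists (M + 2 * `|f 0| + 1); first by have := normr_ge0 (f 0); lra.
move=> x xr; rewrite ler_norml; apply/andP; split; last first.
  by rewrite (le_trans (ub x xr))//; have := normr_ge0 (f 0); lra.
have h01 : 0 <= (1 / 2 : R) <= 1 by lra.
have := cf x (- x) _ h01; have := ub (- x); rewrite normrN => /(_ xr).
have -> : (1 - 1 / 2) *: x + (1 / 2) *: - x = 0.
  rewrite scalerN -scalerBl; have -> : 1 - 1 / 2 - 1 / 2 = 0 :> R by field.
  by rewrite scale0r.
have := ler_norm (f 0); have := ler_norm (- f 0); rewrite normrN; lra.
Qed.

(** The segment from [x] to [y] is prolonged by length [1] beyond [y], to a point [z] of norm at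
    most [r + 1]. Convexity bounds the increment up to [y] by the fraction [t <= |y - x|] of the
    increment up to [z], which is at most [2 * B]. *)
Lemma convex_lipschitz f (r B : R) : convex_fun f -> 0 <= B ->
  (forall x, `|x| <= r + 1 -> `|f x| <= B) ->
  forall x y, `|x| <= r -> `|y| <= r -> `|f x - f y| <= 2 * B * `|x - y|.
Proof.
move=> cf B0 fB.
suff H x y : `|x| <= r -> `|y| <= r -> f y - f x <= 2 * B * `|y - x|.
  move=> x y xr yr; have h1 := H x y xr yr; have h2 := H y x yr xr.
  rewrite [`|y - x|]distrC in h1; rewrite ler_norml.
  by apply/andP; split; [rewrite lerNl opprB|].
move=> xr yr; have [->|xy] := eqVneq x y; first by rewrite !subrr normr0 mulr0.
set d := `|y - x|; have d0 : 0 < d by rewrite normr_gt0 subr_eq0 eq_sym.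
pose z := y + d^-1 *: (y - x).
have zr : `|z| <= r + 1.
  rewrite (le_trans (ler_normD _ _))// lerD// normrZ ger0_norm ?invr_ge0 ?(ltW d0)//.
  by rewrite mulVf ?gt_eqF.
pose t := d / (1 + d).
have t01 : 0 <= t <= 1.
  rewrite divr_ge0/= ?ler_pdivrMr; lra.
have yE : y = (1 - t) *: x + t *: z.
  have -> : 1 - t = (1 + d)^-1 by rewrite /t; field; lra.
  rewrite /z scalerDr scalerA scalerBr addrC -addrA.
  have -> : t * d^-1 = (1 + d)^-1 by rewrite /t; field; lra.
  by rewrite subrK -scalerDl /t -[X in _ + X]mul1r -mulrDl addrC mulfV ?scale1r//; lra.
have := cf x z t t01; rewrite -yE => H.
have td : t <= d by rewrite /t ler_pdivrMr ?ler_peMr; lra.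
have fz := fB z zr; have fx : `|f x| <= B by apply: fB; lra.
have fzx : f z - f x <= 2 * B by move: fz fx; rewrite !ler_norml; lra.
have -> : f y - f x = f y - ((1 - t) * f x + t * f z) + t * (f z - f x) by ring.
rewrite -[leRHS]add0r lerD ?subr_le0//.
have [neg|pos] := leP (f z - f x) 0.
  rewrite (@le_trans _ _ 0)//; last by rewrite !mulr_ge0// ltW.
  by rewrite mulr_ge0_le0//; lra.
have /andP[t0 _] := t01.
by rewrite mulrC ler_pM// ltW.
Qed.

Lemma convex_continuous f : convex_fun f -> continuous f.
Proof.
move=> cf; apply: (@cont_epsP R V R^o) => x e e0.
have r0 : 0 < `|x| + 1 + 1 by rewrite !ltr_wpDl ?addr_ge0.
have [B B0 HB] := convex_bounded cf r0.
exists (Num.min 1 (e / (2 * B))).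
  by rewrite lt_min ltr01 divr_gt0// mulr_gt0.
move=> y; rewrite lt_min => /andP[y1 ye].
have yr : `|y| <= `|x| + 1.
  by rewrite -(subrK x y) (le_trans (ler_normD _ _))// addrC lerD2l ltW.
have xr : `|x| <= `|x| + 1 by rewrite lerDl.
rewrite (le_lt_trans (convex_lipschitz cf (ltW B0) HB yr xr))//.
by rewrite mulrC -ltr_pdivlMr// mulr_gt0.
Qed.

Lemma convex_shift f x0 : convex_fun f -> convex_fun (fun z => f (z + x0)).
Proof.
move=> cf x y t t01; have := cf (x + x0) (y + x0) t t01; congr (f _ <= _).
by rewrite !scalerDr addrACA -scalerDl subrK scale1r.
Qed.

Lemma convex_mulmx f (g : 'M[R]_n.+1) : convex_fun f -> convex_fun (fun z => f (z *m g)).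
Proof.
move=> cf x y t t01; have := cf (x *m g) (y *m g) t t01; congr (f _ <= _).
by rewrite mulmxDl !scalemxAl.
Qed.

(* The Hahn-Banach extension, one coordinate at a time. *)
Lemma subgradient_ex f x0 : convex_fun f -> exists y, subdiff f x0 y.
Proof.
move=> cf0; pose g z := f (z + x0) - f x0.
have cg : convex_fun g.
  move=> x y t t01; have := convex_shift x0 cf0 x y t01; rewrite /g; lra.
have g0 : g 0 = 0 by rewrite /g add0r subrr.
suff H k : (k <= n.+1)%N -> exists y : V, (forall i : 'I_n.+1, (k <= i)%N -> y ord0 i = 0) /\
    forall z, (forall i : 'I_n.+1, (k <= i)%N -> z ord0 i = 0) -> vdot y z <= g z.
  have [y [_ Hy]] := H n.+1 (leqnn _); exists y => z.
  have Hz : forall i : 'I_n.+1, (n.+1 <= i)%N -> (z - x0) ord0 i = 0.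
    by move=> i; rewrite leqNgt ltn_ord.
  by have := Hy _ Hz; rewrite /g subrK; lra.
elim: k => [_|k IH kn].
  exists 0; split=> [i _|z z0]; first by rewrite mxE.
  suff -> : z = 0 by rewrite vdot0l g0.
  by apply/rowP => i; rewrite z0// mxE.
have [y [y0 Hy]] := IH (ltnW kn).
pose ko : 'I_n.+1 := Ordinal kn; pose e : V := delta_mx ord0 ko.
pose Z := [set u : V | forall i : 'I_n.+1, (k <= i)%N -> u ord0 i = 0].
have ye : vdot y e = 0 by rewrite vdot_delta y0.
have ue u : Z u -> vdot e u = 0 by move=> Zu; rewrite vdotC vdot_delta Zu.
have ee : vdot e e = 1 by rewrite vdot_delta mxE !eqxx.
(* Compatibility of the constraints on the value [a] along [e]: the lower bounds, from negative
   multiples of [e], stay below the upper bounds, from positive multiples. *)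
have key u u' (s s' : R) : Z u -> Z u' -> 0 < s -> 0 < s' ->
    (vdot y u - g (u - s *: e)) / s <= (g (u' + s' *: e) - vdot y u') / s'.
  move=> Zu Zu' s0 s'0.
  rewrite ler_pdivrMr// mulrAC ler_pdivlMr//.
  pose t : R := s / (s + s').
  have t01 : 0 <= t <= 1 by rewrite divr_ge0/= ?ler_pdivrMr; lra.
  have := cg (u - s *: e) (u' + s' *: e) t t01.
  have t1 : 1 - t = s' / (s + s') by rewrite /t; field; lra.
  have -> : (1 - t) *: (u - s *: e) + t *: (u' + s' *: e) = (1 - t) *: u + t *: u'.
    rewrite !scalerDr !scalerN !scalerA addrACA.
    have -> : t * s' = (1 - t) * s by rewrite t1 /t; field; lra.
    by rewrite [X in _ + X]addrC subrr addr0.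
  have Zuu : Z ((1 - t) *: u + t *: u').
    by move=> i ki; rewrite !mxE Zu// Zu'// !mulr0 addr0.
  have := Hy _ Zuu; rewrite vdotDr !vdotZr => h1 h2.
  have := le_trans h1 h2; rewrite t1 /t => {}h.
  have ss : 0 < s + s' by lra.
  have E (X Y : R) : s' / (s + s') * X + s / (s + s') * Y = (s' * X + s * Y) / (s + s').
    by field; rewrite gt_eqF.
  by move: h; rewrite !E ler_pM2r ?invr_gt0//; lra.
pose S := [set c | exists u s, [/\ Z u, 0 < s & c = (vdot y u - g (u - s *: e)) / s]].
have Z0 : Z 0 by move=> i _; rewrite mxE.
have Sub u' s' : Z u' -> 0 < s' -> ubound S ((g (u' + s' *: e) - vdot y u') / s').
  by move=> Zu' s'0 _ [u [s [Zu s0 ->]]]; exact: key.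
have Ssup : has_sup S.
  split; first by exists ((vdot y 0 - g (0 - 1 *: e)) / 1); exists 0, 1.
  by exists ((g (0 + 1 *: e) - vdot y 0) / 1); exact: Sub.
pose a := sup S; exists (y + a *: e); split=> [i ki|z Hz].
  rewrite !mxE y0 ?(ltnW ki)// eqxx /= (_ : (i == ko) = false) ?mulr0 ?addr0//.
  by apply/negbTE; rewrite -(inj_eq val_inj) /= gtn_eqF.
have [u [s [Zu zE]]] : exists u (s : R), Z u /\ z = u + s *: e.
  exists (z - z ord0 ko *: e), (z ord0 ko); rewrite subrK; split=> // i ki.
  rewrite !mxE eqxx /=; have [->|ik] := eqVneq i ko; first by rewrite mulr1 subrr.
  rewrite mulr0 subr0 Hz// ltn_neqAle ki andbT eq_sym; apply: contra ik => /eqP E.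
  by apply/eqP/val_inj.
have -> : vdot (y + a *: e) z = vdot y u + s * a.
  by rewrite zE vdotDl !vdotDr !vdotZr !vdotZl ye ue// ee; ring.
have [s0|s0|s0] := ltgtP s 0.
- have Sm : S ((vdot y u - g (u - (- s) *: e)) / - s).
    by exists u, (- s); split=> //; lra.
  have := sup_upper_bound Ssup Sm.
  rewrite scaleNr opprK -zE ler_pdivrMr; last by lra.
  by rewrite -/a; lra.
- have : a <= (g (u + s *: e) - vdot y u) / s by apply: sup_le_ub; [exact: Ssup.1|exact: Sub].
  by rewrite ler_pdivlMr// -zE; lra.
- by rewrite s0 mul0r addr0 zE s0 scale0r addr0 Hy.
Qed.

Lemma subdiff_norm f x y (r B : R) : `|x| <= r -> 0 <= B ->
  (forall z, `|z| <= r + 1 -> `|f z| <= B) -> subdiff f x y -> `|y| <= 2 * B.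
Proof.
move=> xr B0 fB yx; apply: vdot_le_norm1; first by rewrite mulr_ge0.
move=> z z1; have := yx (z + x); rewrite addrK.
have zr : `|z + x| <= r + 1 by rewrite (le_trans (ler_normD _ _))// addrC lerD.
have := fB _ zr; have : `|f x| <= B by apply: fB; lra.
rewrite !ler_norml; lra.
Qed.

(** A local supporting hyperplane is global: [z] is contracted towards [x] by a factor [t], and
    convexity turns the inequality at the contracted point into the one at [z]. *)
Lemma subdiff_local f x y (e : R) : convex_fun f -> 0 < e ->
  (forall z, `|z - x| < e -> f x + vdot y (z - x) <= f z) -> subdiff f x y.
Proof.
move=> cf e0 H z.
pose t : R := Num.min 1 (e / (`|z - x| + 1)).
have d0 : 0 < `|z - x| + 1 by rewrite ltr_wpDl.
have t0 : 0 < t by rewrite lt_min ltr01 divr_gt0.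
have t1 : t <= 1 by rewrite ge_min lexx.
have te : t * `|z - x| < e.
  rewrite (@lt_le_trans _ _ (t * (`|z - x| + 1)))//; first by rewrite ltr_pM2l// ltrDl.
  by rewrite -ler_pdivlMr// ge_min lexx orbT.
have t01 : 0 <= t <= 1 by rewrite (ltW t0).
have := cf x z t t01.
have -> : (1 - t) *: x + t *: z = x + t *: (z - x).
  by rewrite scalerBl scale1r scalerBr addrA addrAC.
have := H (x + t *: (z - x)); rewrite [X in `|X|]addrC addKr normrZ gtr0_norm// => /(_ te).
rewrite [x + _]addrC addrK vdotZr => h1 h2.
have h3 := le_trans h1 h2.
have : t * vdot y (z - x) <= t * (f z - f x) by lra.
by rewrite ler_pM2l//; lra.
Qed.

Lemma subdiff_monotone f x x' y y' : subdiff f x y -> subdiff f x' y' ->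
  0 <= vdot (y - y') (x - x').
Proof.
move=> /(_ x') h /(_ x) h'; move: h h'.
rewrite !vdotBl !vdotBr; lra.
Qed.

Lemma subdiff_common f x x' y : subdiff f x y -> f x' = f x + vdot y (x' - x) ->
  subdiff f x' y.
Proof.
by move=> yx E z; have := yx z; rewrite E !vdotBr; lra.
Qed.

Lemma subdiff_mulmx f (g : 'M[R]_n.+1) x : g \in unitmx ->
  subdiff (fun z => f (z *m g)) x = [set y *m g^T | y in subdiff f (x *m g)].
Proof.
move=> ug; have ugT : g^T \in unitmx by rewrite unitmx_tr.
apply/seteqP; split=> [y yx|_ [y yx <-] z]; last first.
  by rewrite vdot_mulmx trmxK mulmxBl; exact: yx.
exists (y *m invmx g^T); last by rewrite mulmxKV.
move=> z; have := yx (z *m invmx g); rewrite mulmxKV//; congr (_ + _ <= _).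
by rewrite -{1}(mulmxKV ugT y) [LHS]vdot_mulmx trmxK mulmxBl mulmxKV.
Qed.

(** Nonnegativity of this function for every [z] defines the graph of the subdifferential, which is
    therefore closed. *)
Lemma cont_subdiff_gap (f : V -> R) z : continuous f ->
  continuous (fun p : V * V => f z - f p.1 - vdot p.2 (z - p.1)).
Proof.
move=> cf; apply: contB.
  apply: contB; first exact: cont_cst.
  by apply: (@cont_comp _ _ _ fst f) => //; move=> p; exact: cvg_fst.
apply: cont_sum => i; apply: contM.
  apply: (@cont_comp _ _ _ snd (fun v : V => v ord0 i)); first by move=> p; exact: cvg_snd.
  exact: coord_continuous.
apply: (@cont_comp _ _ _ fst (fun v : V => (z - v) ord0 i)); first by move=> p; exact: cvg_fst.
apply: (@cont_comp _ _ _ (fun v : V => z - v) (fun v : V => v ord0 i)).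
  exact: (@cont_refl R V).
exact: coord_continuous.
Qed.

(** The image is the projection of the part of the graph over [K], which is closed, and bounded by
    [subdiff_norm]. *)
Lemma compact_subdiff_image f K : convex_fun f -> compact K ->
  compact (subdiff_image f K).
Proof.
move=> cf cK; have [r r0 Kr] := @compact_norm_bound R V K cK.
have r1 : 0 < r + 1 by rewrite addr_gt0.
have [B B0 HB] := convex_bounded cf r1.
pose G := (K `*` [set y : V | `|y| <= 2 * B]) `&`
  \bigcap_(z in [set: V]) [set p : V * V | 0 <= f z - f p.1 - vdot p.2 (z - p.1)].
have -> : subdiff_image f K = snd @` G.
  apply/seteqP; split=> [y [x Kx yx]|_ [[x y] [[Kx _] H] <-]].
    exists (x, y) => //; split; first split=> //=.
      exact: (subdiff_norm (Kr x Kx) (ltW B0) HB).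
    by move=> z _ /=; have := yx z; lra.
  by exists x => // z; have := H z I; rewrite /=; lra.
apply: continuous_compact; first by apply: continuous_subspaceT => p; exact: cvg_snd.
apply: compact_closedI; first by apply: compact_setX => //; exact: compact_ball0.
apply: closed_bigI => z _.
apply: (@closed_comp _ _ (fun p : V * V => f z - f p.1 - vdot p.2 (z - p.1)) [set t | 0 <= t]).
  by move=> p _; exact: (@cont_subdiff_gap f z (@convex_continuous f cf) p).
exact: closed_ge.
Qed.

(** Suppose [y + s e_i] is a subgradient at [x] in [K] and [y] one at [x'] in [K']. Monotonicity of
    the subdifferential forces [x_i >= x'_i], against the separation. So the set of common
    subgradients misses all its positive translates along [e_i]. *)
Lemma subdiff_image_separated_null f (K K' : set V) i (al be : R) : convex_fun f ->
  compact K -> compact K' -> al < be ->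
  (forall x, K x -> x ord0 i <= al) -> (forall x, K' x -> be <= x ord0 i) ->
  leb (subdiff_image f K `&` subdiff_image f K') = 0%E.
Proof.
move=> cf cK cK' ab Kal K'be.
have cA := compact_subdiff_image cf cK; have cB := compact_subdiff_image cf cK'.
apply: (@leb_null_translates R n _ (delta_mx ord0 i)).
  by apply: compact_closedI => //; exact: (@compact_closedT R V).
move=> s y s0 [_ [x' K'x' yx']] [[x Kx ysx] _].
have := subdiff_monotone ysx yx'; rewrite addrC addKr vdotZl vdotC vdot_delta.
rewrite !mxE pmulr_rge0// => h; have := Kal x Kx; have := K'be x' K'x'; lra.
Qed.

Lemma compact_finite_cover (K : set V) (e : R) : compact K -> 0 < e ->
  exists s : seq V, forall x, K x -> exists2 c, c \in s & `|x - c| < e.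
Proof.
move=> cK e0; have : cover_compact K by rewrite -compact_cover.
move=> /(_ V K (fun c : V => [set x | `|x - c| < e])); case.
- move=> c _; apply/(@open_epsP R V) => x xc; exists (e - `|x - c|); first by rewrite subr_gt0.
  move=> y yx; rewrite /= -(subrK x y) -addrA (le_lt_trans (ler_normD _ _))//.
  by rewrite -ltrBrDr.
- by move=> x Kx; exists x => //=; rewrite subrr normr0.
move=> D _ H; exists (finmap.enum_fset D) => x /H[c Dc xc]; exists c => //.
Qed.

(** This stands in for the almost everywhere differentiability of the Legendre transform. Both sets
    are cut into finitely many small pieces, and two nonempty pieces, one from each set, are
    separated in some coordinate. *)
Lemma subdiff_image_disjoint_null f (K K' : set V) : convex_fun f ->
  compact K -> compact K' -> K `&` K' = set0 ->
  leb (subdiff_image f K `&` subdiff_image f K') = 0%E.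
Proof.
move=> cf cK cK' KK'.
have [d d0 Hd] : exists2 d : R, 0 < d & forall x x', K x -> K' x' -> d <= `|x - x'|.
  have oC : open (~` K') by apply: closed_openC; exact: (@compact_closedT R V).
  have KC : K `<=` ~` K'.
    by move=> x Kx K'x; have : (K `&` K') x by []; rewrite KK'.
  have [d d0 Hd] := @compact_thick R V K _ cK oC KC; exists d => // x x' Kx K'x'.
  rewrite leNgt; apply/negP => xx'; apply: (Hd x') => //.
  by exists x => //; rewrite -opprB normrN.
(* Within a piece of radius [d / 8] each coordinate varies by at most [d / 4], which leaves a gap of
   at least [d / 2] in a coordinate where two chosen points are [d] apart. *)
have d8 : 0 < d / 8 by rewrite divr_gt0.
have [s Hs] := compact_finite_cover cK d8; have [s' Hs'] := compact_finite_cover cK' d8.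
pose P (c : V) := K `&` [set x | `|x - c| <= d / 8].
pose P' (c : V) := K' `&` [set x | `|x - c| <= d / 8].
have cP c : compact (P c).
  by apply: compact_closedI => //; apply: (@compact_closedT R V); exact: compact_cball.
have cP' c : compact (P' c).
  by apply: compact_closedI => //; apply: (@compact_closedT R V); exact: compact_cball.
pose F (cc : V * V) := subdiff_image f (P cc.1) `&` subdiff_image f (P' cc.2).
have F0 cc : leb (F cc) = 0%E.
  case: cc => c c'.
  have [[[x Px] [x' Px']]|nP] := pselect (P c !=set0 /\ P' c' !=set0); last first.
    apply: leb_null_sub (leb0 R n) => y [[x Px _] [x' Px' _]].
    by apply: nP; split; [exists x|exists x'].
  have [i xi] : exists i, d <= `|x ord0 i - x' ord0 i|.
    apply: contrapT => /forallNP H; have := Hd x x' Px.1 Px'.1.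
    rewrite leNgt; apply/negP; rewrite negbK; apply: norm_lt_coord => // i.
    by have := H i; rewrite !mxE => /negP; rewrite -ltNge.
  have near (c0 z z0 : V) : `|z - c0| <= d / 8 -> `|z0 - c0| <= d / 8 ->
      `|z ord0 i - z0 ord0 i| <= d / 4.
    move=> h1 h2; have := coord_le_norm (z - c0) i; have := coord_le_norm (z0 - c0) i.
    have mB (a b : V) : (a - b) ord0 i = a ord0 i - b ord0 i by rewrite !mxE.
    rewrite !mB.
    move=> /le_trans/(_ h2) + /le_trans/(_ h1); rewrite !ler_norml; lra.
  have nx z : P c z -> `|z ord0 i - x ord0 i| <= d / 4.
    by move=> Pz; exact: (near c _ _ Pz.2 Px.2).
  have nx' z : P' c' z -> `|z ord0 i - x' ord0 i| <= d / 4.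
    by move=> Pz; exact: (near c' _ _ Pz.2 Px'.2).
  rewrite /F /=; have [le_xx'|lt_xx'] := leP (x ord0 i) (x' ord0 i).
    rewrite ler0_norm ?subr_le0// in xi.
    apply: (@subdiff_image_separated_null f _ _ i (x ord0 i + d / 4) (x' ord0 i - d / 4)) => //.
    - by lra.
    - by move=> z /nx; rewrite ler_norml; lra.
    - by move=> z /nx'; rewrite ler_norml; lra.
  rewrite gtr0_norm ?subr_gt0// in xi; rewrite setIC.
  apply: (@subdiff_image_separated_null f _ _ i (x' ord0 i + d / 4) (x ord0 i - d / 4)) => //.
  - by lra.
  - by move=> z /nx'; rewrite ler_norml; lra.
  - by move=> z /nx; rewrite ler_norml; lra.
have sub : subdiff_image f K `&` subdiff_image f K' `<=`
    \big[setU/set0]_(cc <- [seq (c, c') | c <- s, c' <- s']) F cc.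
  move=> y [[x Kx yx] [x' Kx' yx']]; rewrite -bigcup_seq.
  have [c cs xc] := Hs x Kx; have [c' cs' xc'] := Hs' x' Kx'.
  exists (c, c'); first by apply/allpairsP; exists (c, c').
  by split; [exists x => //; split => //; exact: ltW|exists x' => //; split => //; exact: ltW].
exact: leb_null_sub sub (leb_null_bigU _ F0).
Qed.

End ConvexFunctions.

(** * Semicontinuity of Monge-Ampere mass under locally uniform convergence *)

Section SubdiffConvergence.
Variables (R : realType) (n : nat).
Notation V := 'rV[R]_n.+1.
Local Notation leb := (@leb_outer R n.+1).
Variables (fs : nat -> V -> R) (f : V -> R).
Hypothesis cfs : forall j, convex_fun (fs j).
Hypothesis cf : convex_fun f.
Hypothesis fsf : loc_unif_cvg fs f.

Lemma loc_unif_ball (r e : R) : 0 < e -> exists N : nat, forall j, (N <= j)%N ->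
  forall x : V, `|x| <= r -> `|fs j x - f x| < e.
Proof.
by move=> e0; have [N HN] := fsf (@compact_ball0 R n.+1 r) e0; exists N => j Nj x xr; exact: HN.
Qed.

(** A pair [(x, y)] with [y] outside the thickening violates the subgradient inequality of [f] at
    some [z], and the violation persists for nearby pairs and large [j]. Compactness of the set of
    candidate pairs makes the rank of [j] uniform. *)
Lemma subdiff_image_usc (K : set V) (eta : R) : compact K -> 0 < eta ->
  exists N, forall j, (N <= j)%N -> subdiff_image (fs j) K `<=` thick eta (subdiff_image f K).
Proof.
move=> cK eta0; have [r r0 Kr] := @compact_norm_bound R V K cK.
have r1 : 0 < r + 1 by rewrite addr_gt0.
have [B B0 HB] := convex_bounded cf r1.
have [N0 HN0] := @loc_unif_ball (r + 1) 1 ltr01.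
pose C : R := 2 * (B + 1).
pose Z := K `*` [set y : V | `|y| <= C].
have cZ : compact Z by apply: compact_setX => //; exact: compact_ball0.
have /compact_near_coveringP ncZ := cZ.
have := ncZ nat \oo (fun j p => subdiff (fs j) p.1 p.2 -> thick eta (subdiff_image f K) p.2) _.
case.
  move=> [x y] [/= Kx yC].
  have [yT|yT] := pselect (thick eta (subdiff_image f K) y).
    exists (snd @^-1` thick eta (subdiff_image f K), setT) => /=.
      split; last exact: filterT.
      apply: (@cvg_snd _ _ (nbhs x) (nbhs y)); apply: open_nbhs_nbhs.
      by split => //; exact: (@open_thick R V).
    by case=> -[x' y'] j /= [H _].
  have [z Hz] : exists z, f z < f x + vdot y (z - x).
    apply: contrapT => /forallNP H; apply: yT; apply: (@sub_thick R V) => //.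
    by exists x => // z; rewrite leNgt; apply/negP; exact: H.
  pose G (p : V * V) := f z - f p.1 - vdot p.2 (z - p.1).
  have cG : continuous G by exact: cont_subdiff_gap (@convex_continuous R n f cf).
  pose g := - G (x, y) / 2.
  have g0 : 0 < g by rewrite /g /G /=; lra.
  have [N HN] := @loc_unif_ball (r + 1 + `|z|) (g / 2) (divr_gt0 g0 (ltr0n _ 2)).
  exists ([set p : V * V | G p < - g /\ `|p.1| <= r + 1], [set j | (N <= j)%N]) => /=.
    split; last by exists N.
    apply: filterI.
      have : nbhs (x, y) (G @^-1` [set t | t < - g]).
        apply: cG; apply: open_nbhs_nbhs; split; first exact: open_lt.
        by rewrite /= /g /G /=; lra.
      by [].
    have : nbhs (x, y) (fst @^-1` [set v : V | `|v| <= r + 1]).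
      apply: (@cvg_fst _ _ (nbhs x) (nbhs y)).
      apply/(@nbhs_epsP R V); exists 1 => // v vx; rewrite /= -(subrK x v).
      by rewrite (le_trans (ler_normD _ _))// addrC lerD ?Kr// ltW.
    by [].
  case=> -[x' y'] j /= [[Gp x'r] Nj] /(_ z) H; exfalso.
  have z0 := normr_ge0 z; have r0' := ltW r0.
  have h1 := HN j Nj z; have h2 := HN j Nj x'.
  have {}h1 : `|fs j z - f z| < g / 2 by apply: h1; lra.
  have {}h2 : `|fs j x' - f x'| < g / 2 by apply: h2; lra.
  move: h1 h2 Gp; rewrite !ltr_norml /G /=; lra.
move=> N _ HN; exists (N0 + N)%N => j Nj y [x Kx yx].
apply: (HN j _ (x, y)) => //=; first by exact: leq_trans (leq_addl _ _) Nj.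
split=> //=; apply: (subdiff_norm (Kr x Kx) _ _ yx); first by rewrite addr_ge0// ltW.
move=> z zr; have := HN0 j (leq_trans (leq_addr _ _) Nj) z zr; have := HB z zr.
rewrite !ler_norml ltr_norml; lra.
Qed.

Lemma leb_subdiff_usc (K : set V) (e : R) : compact K -> 0 < e ->
  exists N, forall j, (N <= j)%N ->
    (leb (subdiff_image (fs j) K) <= leb (subdiff_image f K) + e%:E)%E.
Proof.
move=> cK e0; have [d d0 Hd] := compact_leb_regular e0 (compact_subdiff_image cf cK).
have [N HN] := subdiff_image_usc cK d0; exists N => j Nj.
by apply: le_trans Hd; apply: leb_mono; exact: HN.
Qed.

(** Let [y] be a subgradient of [f] at a point of [K] and at no boundary point of [U]. Then [f]
    tilted by [y] is larger on the boundary by a fixed gap. The gap survives for large [j] and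
    nearby slopes, so the minimum over the closure of [U] is attained inside [U] and the slope lies
    in [subdiff_image (fs j) U]. The excluded slopes form a null set, thickened to measure at most
    [e]. *)
Lemma leb_subdiff_lsc (K U : set V) (r e : R) : compact K -> open U -> K `<=` U ->
  U `<=` [set x | `|x| <= r] -> 0 < e ->
  exists N, forall j, (N <= j)%N ->
    (leb (subdiff_image f K) <= leb (subdiff_image (fs j) U) + e%:E)%E.
Proof.
move=> cK oU KU Ur e0.
have cball := @compact_ball0 R n.+1 r.
have clU : closure U `<=` [set x | `|x| <= r].
  apply: subset_trans (closure_subset Ur) _.
  exact: (@compact_closedT R V).
have cclU : compact (closure U).
  by apply: subclosed_compact clU => //; exact: closed_closure.
pose Bd := closure U `&` ~` U.
have cBd : compact Bd by apply: compact_closedI => //; exact: open_closedC.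
have KBd : K `&` Bd = set0.
  by apply/seteqP; split=> // x [Kx [_ nUx]]; apply: nUx; exact: KU.
have A0 := subdiff_image_disjoint_null cf cK cBd KBd.
have cA : compact (subdiff_image f K `&` subdiff_image f Bd).
  apply: compact_closedI; first exact: compact_subdiff_image.
  by apply: (@compact_closedT R V); exact: compact_subdiff_image.
have [d d0 Hd] := compact_leb_regular e0 cA; rewrite A0 add0e in Hd.
set A := subdiff_image f K `&` subdiff_image f Bd in cA A0 Hd.
pose Z := subdiff_image f K `&` ~` thick d A.
have cZ : compact Z.
  apply: compact_closedI; first exact: compact_subdiff_image.
  by apply: open_closedC; exact: (@open_thick R V).
have /compact_near_coveringP ncZ := cZ.
have := ncZ nat \oo (fun j y => subdiff_image (fs j) U y) _.
case.
  move=> y [[x Kx yx] yA].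
  have rx : `|x| <= r by apply: Ur; exact: KU.
  have r0 : 0 <= r by apply: le_trans rx.
  have [g g0 Hg] : exists2 g : R, 0 < g & forall z, Bd z -> g <= f z - f x - vdot y (z - x).
    have cg : continuous (fun z : V => f z - f x - vdot y (z - x)).
      apply: contB.
        by apply: contB; [exact: convex_continuous|exact: cont_cst].
      apply: cont_sum => i; apply: contM; first exact: cont_cst.
      apply: (@cont_comp _ _ _ (fun v : V => v - x) (fun v : V => v ord0 i)).
        exact: (@cont_shift R V).
      exact: coord_continuous.
    apply: compact_EVT_min_pos => // z Bdz; rewrite lt_neqAle; apply/andP; split; last first.
      by have := yx z; lra.
    apply/eqP => E; apply: yA; apply: (@sub_thick R V) => //.
    split; first by exists x.
    by exists z => //; apply: subdiff_common yx _; lra.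
  have [N HN] := @loc_unif_ball r (g / 8) (divr_gt0 g0 (ltr0n _ 8)).
  (* Slopes within [c] of [y] change the tilt by at most [g / 8] over the ball of radius [r], whose
     points are at distance at most [2 * r] from [x]; the [+ 1] keeps the divisor positive when [r]
     is [0]. *)
  pose c : R := g / 8 / (n.+1%:R * (2 * r + 1)).
  have c0 : 0 < n.+1%:R * (2 * r + 1) by rewrite mulr_gt0//; lra.
  exists ([set y' : V | `|y' - y| < c], [set j | (N <= j)%N]) => /=.
    split; last by exists N.
    by apply/(@nbhs_epsP R V); exists c => //; rewrite !divr_gt0.
  case=> y' j /= [y'y Nj].
  have dev z : `|z| <= r -> `|vdot (y' - y) (z - x)| <= g / 8.
    move=> zr; rewrite (le_trans (norm_vdot _ _))//.
    have zx : `|z - x| <= 2 * r + 1.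
      by rewrite (le_trans (ler_normB _ _))//; lra.
    rewrite mulrAC (@le_trans _ _ (n.+1%:R * (2 * r + 1) * `|y' - y|))//.
      by rewrite ler_wpM2r// ler_wpM2l.
    by rewrite mulrC -ler_pdivlMr// ltW.
  pose h z := fs j z - vdot y' z.
  have ch : continuous h.
    apply: contB; first exact: convex_continuous.
    by apply: cont_sum => i; apply: contM; [exact: cont_cst|exact: coord_continuous].
  have hx z : Bd z -> h x < h z.
    move=> Bdz; have zr : `|z| <= r by apply: clU; case: Bdz.
    have := Hg z Bdz; have := dev z zr; have := HN j Nj z zr; have := HN j Nj x rx.
    rewrite /h vdotBl !vdotBr !ltr_norml ler_norml; lra.
  have clx : closure U x by apply: subset_closure; exact: KU.
  have [m /set_mem clm Hm] := compact_EVT_min (ex_intro _ x clx) cclU (continuous_subspaceT ch).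
  have Um : U m.
    apply: contrapT => nUm; have := hx m (conj clm nUm).
    by rewrite ltNge Hm//; exact/mem_set.
  exists m => //; have [s s0 Hs] := (@open_epsP R V U).1 oU m Um.
  apply: (subdiff_local (cfs j) s0) => z zm.
  have := Hm z (mem_set (subset_closure (Hs z zm))); rewrite /h vdotBr; lra.
move=> N _ HN; exists N => j Nj.
apply: (@le_trans _ _ (leb (subdiff_image (fs j) U `|` thick d A))).
  apply: leb_mono => y yK; have [yA|yA] := pselect (thick d A y); first by right.
  by left; apply: (HN j Nj).
by rewrite (le_trans (leb_setU _ _))// leeD2l.
Qed.

End SubdiffConvergence.

(** * Piecewise linear functions and general position *)

Section Polyhedral.
Variables (R : realType) (n : nat).
Notation V := 'rV[R]_n.+1.

(** The default value of the maximum is a member of the family, since the reals have no least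
    element. *)
Definition pl N (y : 'I_N.+1 -> V) (c : 'I_N.+1 -> R) (x : V) : R :=
  \big[Num.max/(vdot x (y ord0) + c ord0)]_(i < N.+1) (vdot x (y i) + c i).

Definition active N (y : 'I_N.+1 -> V) (c : 'I_N.+1 -> R) (x : V) (i : 'I_N.+1) : bool :=
  vdot x (y i) + c i == pl y c x.

(* Redirecting the inactive indices to [b] keeps the germ of [pl y c] at a point a
   function of the form [pl] over the same index type. *)
Definition restr N (y : 'I_N.+1 -> V) (S : pred 'I_N.+1) (b : 'I_N.+1) : 'I_N.+1 -> V :=
  fun i => if S i then y i else y b.

Section Basic.
Variables (N : nat) (y : 'I_N.+1 -> V) (c : 'I_N.+1 -> R).

Lemma pl_ge x i : vdot x (y i) + c i <= pl y c x.
Proof. exact: (le_bigmax _ (fun i => vdot x (y i) + c i)). Qed.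

Lemma pl_active x : exists b, active y c x b.
Proof.
rewrite /active /pl; elim/big_ind : _ => [|u v [i /eqP <-] [j /eqP <-]|i _].
- by exists ord0.
- by have [_|_] := leP (vdot x (y i) + c i) (vdot x (y j) + c j); [exists j|exists i].
- by exists i.
Qed.

Lemma pl_eq x v : (forall i, vdot x (y i) + c i <= v) ->
  (exists i, vdot x (y i) + c i = v) -> pl y c x = v.
Proof.
move=> H [i E]; apply/eqP; rewrite eq_le -{2}E pl_ge andbT.
by have [j /eqP <-] := pl_active x; exact: H.
Qed.

Lemma convex_pl : convex_fun (pl y c).
Proof.
move=> x z t /andP[t0 t1]; have [j /eqP <-] := pl_active ((1 - t) *: x + t *: z).
rewrite vdotDl !vdotZl.
have -> : (1 - t) * vdot x (y j) + t * vdot z (y j) + c j =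
  (1 - t) * (vdot x (y j) + c j) + t * (vdot z (y j) + c j) by ring.
by apply: lerD; rewrite ler_wpM2l ?subr_ge0// pl_ge.
Qed.

(** Near [x0] the inactive pieces stay strictly below the active piece [b]; the active ones share
    their value at [x0] and differ only by their slopes. *)
Lemma pl_local x0 b : active y c x0 b -> exists2 e : R, 0 < e & forall x, `|x - x0| < e ->
  pl y c x = pl y c x0 + pl (restr y (active y c x0) b) (fun=> 0) (x - x0).
Proof.
move=> ab.
have : nbhs x0 [set x : V | forall i, ~~ active y c x0 i ->
    vdot x (y i) + c i < vdot x (y b) + c b].
  apply: (@filter_forall _ _ (fun i (x : V) => ~~ active y c x0 i ->
    vdot x (y i) + c i < vdot x (y b) + c b) (nbhs x0)) => i.
  have [ai|ai] := boolP (active y c x0 i).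
    by near=> x.
  have cg : continuous (fun x : V => vdot x (y b) + c b - (vdot x (y i) + c i)).
    by apply: contB; (apply: contD; last exact: cont_cst); apply: cont_sum => j;
      apply: contM; try exact: cont_cst; exact: coord_continuous.
  have : nbhs x0 ((fun x : V => vdot x (y b) + c b - (vdot x (y i) + c i)) @^-1` [set t | 0 < t]).
    apply: cg; apply: open_nbhs_nbhs; split; first exact: open_gt.
    by rewrite /= subr_gt0 (eqP ab) lt_neqAle ai pl_ge.
  by apply: filterS => x /=; rewrite subr_gt0.
move=> /(@nbhs_epsP R V)[e e0 He]; exists e => // x xe.
set S := active y c x0.
have val i : S i -> vdot x (y i) + c i = pl y c x0 + vdot (x - x0) (y i).
  by move=> /eqP <-; rewrite vdotBl; ring.
have le_b i : S i -> vdot (x - x0) (y i) <= pl (restr y S b) (fun=> 0) (x - x0).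
  move=> Si; have := @le_bigmax _ _ _ (vdot (x - x0) (restr y S b ord0) + 0)
    (fun i => vdot (x - x0) (restr y S b i) + 0) i.
  by rewrite /restr Si addr0.
apply: pl_eq => [i|].
  have [Si|Si] := boolP (S i); first by rewrite val// lerD2l le_b.
  by rewrite (le_trans (ltW (He x xe i Si)))// val// lerD2l le_b.
suff [i Si E] : exists2 i, S i & vdot (x - x0) (y i) = pl (restr y S b) (fun=> 0) (x - x0).
  by exists i; rewrite val// E.
have : exists j, vdot (x - x0) (restr y S b j) + 0 == pl (restr y S b) (fun=> 0) (x - x0).
  rewrite /pl; elim/big_ind : _ => [|u v [i /eqP <-] [j /eqP <-]|i _].
  - by exists ord0.
  - by case: leP; [exists j|exists i].
  - by exists i.
move=> [j /eqP]; rewrite addr0 /restr; case: ifP => Sj E; [by exists j|by exists b].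
Unshelve. all: by end_near. Qed.

End Basic.

(** Maximum of supporting affine functions at the points of a [d]-net: it never exceeds [f], and
    next to a net point it falls short at most by the Lipschitz errors of [f] and of the supporting
    function. *)
Lemma pl_approx f (r e : R) : convex_fun f -> 0 < r -> 0 < e ->
  exists N (y : 'I_N.+1 -> V) c, forall x, `|x| <= r -> `|pl y c x - f x| <= e.
Proof.
move=> cf r0 e0.
have r3 : 0 < r + 1 + 1 + 1 by rewrite !addr_gt0.
have [B B0 HB] := convex_bounded cf r3.
have Lip := convex_lipschitz cf (ltW B0) HB.
have C0 : 0 < 2 * B + n.+1%:R * (2 * B) by rewrite addr_gt0 ?mulr_gt0.
(* [2 * B] is a Lipschitz constant of [f] and bounds the norm of its subgradients; the factor [n.+1]
   comes from [norm_vdot]. *)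
pose d : R := Num.min 1 (e / (2 * B + n.+1%:R * (2 * B))).
have d0 : 0 < d by rewrite lt_min ltr01 divr_gt0.
have [s Hs] := compact_finite_cover (@compact_ball0 R n.+1 r) d0.
have [Y HY] := choice (fun x0 => subgradient_ex x0 cf).
(* The last index falls on the default point [0], whose supporting function is as good as any other;
   it keeps the index type nonempty. *)
pose p (i : 'I_(size s).+1) : V := nth 0 s i.
exists (size s), (fun i => Y (p i)), (fun i => f (p i) - vdot (p i) (Y (p i))) => x xr.
set y := (fun i => Y (p i)); set c := (fun i => _).
have val i : vdot x (y i) + c i = f (p i) + vdot (Y (p i)) (x - p i).
  by rewrite vdotBr /y /c ![vdot (Y _) _]vdotC; ring.
have ub : pl y c x <= f x.
  by have [i /eqP <-] := pl_active y c x; rewrite val; exact: HY.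
have [q qs xq] := Hs x xr.
have qi : (index q s < (size s).+1)%N by rewrite ltnW// ltnS index_mem.
have pq : p (Ordinal qi) = q by rewrite /p /= nth_index.
have := pl_ge y c x (Ordinal qi); rewrite val pq => lb.
have d1 : d <= 1 by rewrite ge_min lexx.
have qr : `|q| <= r + 1.
  rewrite -(subrK x q) (le_trans (ler_normD _ _))// addrC lerD// distrC.
  by rewrite (le_trans (ltW xq)).
have qr1 : `|q| <= r + 1 + 1 by lra.
have xr1 : `|x| <= r + 1 + 1 by lra.
have h1 := Lip x q xr1 qr1.
have h2 : `|Y q| <= 2 * B by exact: (subdiff_norm qr1 (ltW B0) HB (HY q)).
have h3 := norm_vdot (Y q) (x - q).
have h4 : n.+1%:R * `|Y q| * `|x - q| <= n.+1%:R * (2 * B) * `|x - q|.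
  by rewrite ler_wpM2r// ler_wpM2l.
have h5 : (2 * B + n.+1%:R * (2 * B)) * `|x - q| <= e.
  by rewrite mulrC -ler_pdivlMr// (le_trans (ltW xq))// ge_min lexx orbT.
rewrite mulrDl in h5.
have h6 := le_trans h3 h4.
move: h1 h6; rewrite !ler_norml => /andP[? ?] /andP[? ?]; apply/andP; split; lra.
Qed.

Definition frame N (y : 'I_N.+1 -> V) b (iota : 'I_n.+1 -> 'I_N.+1) : 'M[R]_n.+1 :=
  \matrix_(j < n.+1) (y (iota j) - y b).

(* No further affine piece meets the [n + 2] pieces that determine a vertex. *)
Definition generic N (y : 'I_N.+1 -> V) (c : 'I_N.+1 -> R) :=
  forall b (iota : 'I_n.+1 -> 'I_N.+1) k x, frame y b iota \in unitmx ->
    (forall j, vdot x (y (iota j)) + c (iota j) = vdot x (y b) + c b) ->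
    vdot x (y k) + c k = vdot x (y b) + c b -> k = b \/ exists j, k = iota j.

(* Perturbing [c i] by [t ^ i.+1]: a coincidence of [n + 2] values in general
   position forces [t] to be a root of a fixed nonzero polynomial. *)
Lemma generic_perturb N (y : 'I_N.+1 -> V) (c : 'I_N.+1 -> R) (e : R) : 0 < e ->
  exists c', (forall i, `|c' i - c i| <= e) /\ generic y c'.
Proof.
move=> e0.
(* [al] holds the coordinates of [y k - y b] in the frame. If the pieces [b], [iota j] and [k] agree
   at a point, their perturbed offsets satisfy the same linear relation, which says that [t] is a
   root of [P]. *)
pose al b (iota : {ffun 'I_n.+1 -> 'I_N.+1}) k : 'rV[R]_n.+1 :=
  (y k - y b) *m invmx (frame y b iota).
pose P b (iota : {ffun 'I_n.+1 -> 'I_N.+1}) k : {poly R} :=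
  ((c k - c b)%:P + 'X^(k.+1) - 'X^(b.+1)) -
  \sum_j al b iota k ord0 j *: ((c (iota j) - c b)%:P + 'X^((iota j).+1) - 'X^(b.+1)).
pose good b (iota : {ffun 'I_n.+1 -> 'I_N.+1}) (k : 'I_N.+1) :=
  (k != b) && [forall j, k != iota j].
(* Only one term of [P] contains ['X^k.+1], so that its coefficient is [1]. *)
have P0 b iota k : good b iota k -> P b iota k != 0.
  move=> /andP[kb /forallP ki]; apply/eqP => /polyP/(_ k.+1).
  rewrite coef0 /P coefB !coefD !coefN coefC !coefXn eqxx eqSS (inj_eq val_inj) (negbTE kb) /=.
  rewrite coef_sum big1 => [|j _].
    by rewrite !subr0 add0r => /eqP; rewrite oner_eq0.
  rewrite coefZ coefB coefD coefC !coefXn /= !eqSS !(inj_eq val_inj) (negbTE kb).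
  by rewrite (negbTE (ki j)) addr0 subr0 mulr0.
pose Q : {poly R} := \prod_(t : 'I_N.+1 * {ffun 'I_n.+1 -> 'I_N.+1} * 'I_N.+1 |
  good t.1.1 t.1.2 t.2) P t.1.1 t.1.2 t.2.
have Q0 : Q != 0 by apply/prodf_neq0 => t; exact: P0.
pose e1 : R := Num.min 1 e.
have e10 : 0 < e1 by rewrite lt_min ltr01.
have [t [t0 t1 Qt]] : exists t : R, [/\ 0 < t, t <= e1 & ~~ root Q t].
  apply: contrapT => /forallNP H.
  (* These [size Q] distinct candidates, one more than the degree of [Q], cannot all be roots. *)
  pose rs := [seq e1 / m.+1%:R | m <- iota 0 (size Q)].
  have := @max_poly_roots _ Q rs Q0; rewrite size_map size_iota ltnn.
  have -> : all (root Q) rs.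
    apply/allP => _ /mapP[m _ ->]; apply: contrapT => /negP nr.
    apply: (H (e1 / m.+1%:R)); split=> //; first by rewrite divr_gt0.
    by rewrite ler_pdivrMr// ler_peMr ?ler1n// ltW.
  move=> /(_ isT); rewrite map_inj_uniq ?iota_uniq; first by move=> /(_ isT).
  move=> m m' /(mulfI (lt0r_neq0 e10)) /invr_inj /eqP.
  by rewrite eqr_nat eqSS => /eqP.
exists (fun i => c i + t ^+ i.+1); split=> [i|].
  rewrite addrC addKr ger0_norm ?exprn_ge0 ?(ltW t0)//.
  rewrite exprS (@le_trans _ _ t)//; last by rewrite (le_trans t1)// ge_min lexx orbT.
  rewrite ler_piMr ?(ltW t0)// exprn_ile1 ?(ltW t0)// (le_trans t1)// ge_min lexx//.
move=> b io k x uD Hi Hk.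
have fE : frame y b io = frame y b [ffun j => io j].
  by apply/matrixP => i j; rewrite !mxE ffunE.
have [gd|] := boolP (good b [ffun j => io j] k); last first.
  rewrite negb_and negbK negb_forall => /orP[/eqP ->|/existsP[j]]; first by left.
  by rewrite negbK ffunE => /eqP ->; right; exists j.
exfalso; have : ~~ root (P b [ffun j => io j] k) t.
  apply: contra Qt => rt; rewrite /Q /root horner_prod.
  by apply/eqP; rewrite (bigD1 (b, [ffun j => io j], k))//= (eqP rt) mul0r.
move=> /negP; apply; apply/eqP; rewrite /P !hornerE horner_sum.
have yk : vdot x (y k - y b) = \sum_j al b [ffun j => io j] k ord0 j * vdot x (y (io j) - y b).
  rewrite -{1}(mulmxKV uD (y k - y b)) fE -/(al b [ffun j => io j] k) vdotC vdotE.
  rewrite -mulmxA mxE; apply: eq_bigr => j _; congr (_ * _).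
  by rewrite vdotC vdotE !mxE; apply: eq_bigr => l _; rewrite !mxE ffunE.
have ck : c k + t ^+ k.+1 - (c b + t ^+ b.+1) = - vdot x (y k - y b).
  by rewrite vdotBr; move: Hk; lra.
have ci j : c (io j) + t ^+ (io j).+1 - (c b + t ^+ b.+1) = - vdot x (y (io j) - y b).
  by rewrite vdotBr; have := Hi j; lra.
have -> : c k - c b + t ^+ k.+1 - t ^+ b.+1 = - vdot x (y k - y b) by rewrite -ck; ring.
rewrite yk -sumrN -sumrB big1// => j _; rewrite !hornerE ffunE.
have -> : c (io j) - c b + t ^+ (io j).+1 - t ^+ b.+1 = - vdot x (y (io j) - y b).
  by rewrite -ci; ring.
by ring.
Qed.

Lemma pl_perturb N (y : 'I_N.+1 -> V) (c c' : 'I_N.+1 -> R) (e : R) :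
  (forall i, `|c' i - c i| <= e) -> forall x, `|pl y c' x - pl y c x| <= e.
Proof.
move=> H x; have [i /eqP Ei] := pl_active y c x; have [j /eqP Ej] := pl_active y c' x.
have := H i; have := H j; have := pl_ge y c x j; have := pl_ge y c' x i.
rewrite !ler_norml; lra.
Qed.

Lemma generic_pl_dense f : convex_fun f ->
  exists (N : nat -> nat) (y : forall j, 'I_(N j).+1 -> V) (c : forall j, 'I_(N j).+1 -> R),
    (forall j, generic (y j) (c j)) /\ loc_unif_cvg (fun j => pl (y j) (c j)) f.
Proof.
move=> cf.
have H (j : nat) : exists p : {N : nat & (('I_N.+1 -> V) * ('I_N.+1 -> R))%type},
    generic (projT2 p).1 (projT2 p).2 /\
    forall x, `|x| <= j.+1%:R -> `|pl (projT2 p).1 (projT2 p).2 x - f x| <= j.+1%:R^-1.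
  have e0 : 0 < (j.+1%:R^-1 : R) / 2 by rewrite divr_gt0// invr_gt0.
  have [N [y [c Hc]]] := pl_approx cf (ltr0n _ j.+1 : 0 < (j.+1%:R : R)) e0.
  have [c' [Hc' g]] := generic_perturb y c e0.
  exists (existT _ N (y, c')); split=> //= x xj.
  have := Hc x xj; have := pl_perturb y Hc' x; rewrite !ler_norml.
  by move: (j.+1%:R^-1 : R) => d /andP[? ?] /andP[? ?]; apply/andP; split; lra.
have [p Hp] := choice H.
exists (fun j => projT1 (p j)), (fun j => (projT2 (p j)).1), (fun j => (projT2 (p j)).2).
split=> [j|K cK e e0]; first by have [] := Hp j.
have [r r0 Kr] := @compact_norm_bound R V K cK.
have [N1 HN1] := @mesh_cvg R e e0; have [N2 HN2] := compact_bigball r.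
exists (N1 + N2)%N => j Nj x Kx; have [_ Hj] := Hp j.
apply: le_lt_trans (Hj x _) _; last exact: HN1 (leq_trans (leq_addr _ _) Nj).
rewrite (le_trans (Kr x Kx))// (le_trans (HN2 j (leq_trans (leq_addl _ _) Nj)))//.
by rewrite ler_nat.
Qed.

(** Support function of the simplex with vertices [0] and the unit vectors; the vertex [0] is the
    default value of the maximum. *)
Definition simplex_fun (w : V) : R := \big[Num.max/0]_j w ord0 j.

Lemma simplex_fun_ge0 w : 0 <= simplex_fun w.
Proof. exact: bigmax_ge_id. Qed.

Lemma simplex_fun_ge (w : V) j : w ord0 j <= simplex_fun w.
Proof. exact: (le_bigmax _ (fun j => w ord0 j)). Qed.

Lemma simplex_fun_eq (w : V) : simplex_fun w = 0 \/ exists j, simplex_fun w = w ord0 j.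
Proof.
rewrite /simplex_fun; elim/big_ind : _ => [|u v Hu Hv|j _]; [by left| |by right; exists j].
by case: leP.
Qed.

Lemma convex_simplex_fun : convex_fun simplex_fun.
Proof.
move=> x z t /andP[t0 t1].
have t1' : 0 <= 1 - t by rewrite subr_ge0.
have [->|[j ->]] := simplex_fun_eq ((1 - t) *: x + t *: z).
  by rewrite addr_ge0 ?mulr_ge0 ?simplex_fun_ge0.
by rewrite !mxE lerD// ler_wpM2l ?simplex_fun_ge.
Qed.

(* At each point a generic [pl] is, up to an affine function, either a function of
   fewer variables or a linear image of [simplex_fun]. *)
Lemma generic_vertex N (y : 'I_N.+1 -> V) c x0 b : generic y c -> active y c x0 b ->
  row_full (\matrix_i (restr y (active y c x0) b i - y b)) ->
  exists2 D : 'M[R]_n.+1, D \in unitmx &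
    forall z, pl (restr y (active y c x0) b) (fun=> 0) z = vdot z (y b) + simplex_fun (z *m D).
Proof.
move=> gen ab rf; set S := active y c x0 in ab rf *; set A := \matrix_i _ in rf.
pose io := fullrankfun rf; have uA := fullrowsub_unit rf.
(* An inactive index would give a zero row in an invertible matrix. *)
have Sio j : S (io j).
  apply: contraLR uA => nS; rewrite unitmxE unitfE negbK.
  apply/eqP; rewrite (expand_det_row _ j) big1// => l _.
  by rewrite !mxE /restr -/(io j) (negbTE nS) subrr mul0r.
have fE : frame y b io = rowsub (fullrankfun rf) A.
  by apply/matrixP => i j; rewrite !mxE /restr -/(io i) Sio.
have uD : frame y b io \in unitmx by rewrite fE.
have SE k : S k -> k = b \/ exists j, k = io j.
  move=> Sk; apply: (gen b io k x0 uD) => [j|].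
    by rewrite (eqP (Sio j)) (eqP ab).
  by rewrite (eqP Sk) (eqP ab).
exists (frame y b io)^T; first by rewrite unitmx_tr.
move=> z.
have zD j : (z *m (frame y b io)^T) ord0 j = vdot z (y (io j)) - vdot z (y b).
  by rewrite -vdotBr vdotE !mxE; apply: eq_bigr => l _; rewrite !mxE.
apply: pl_eq => [i|].
  rewrite addr0 /restr; case: ifP => Si; last by rewrite lerDl simplex_fun_ge0.
  have [->|[j ->]] := SE i Si; first by rewrite lerDl simplex_fun_ge0.
  by rewrite -lerBlDl -zD simplex_fun_ge.
have [->|[j ->]] := simplex_fun_eq (z *m (frame y b io)^T).
  by exists b; rewrite /restr ab.
by exists (io j); rewrite /restr Sio zD; ring.
Qed.

End Polyhedral.

(** * Lower volume bounds and the standard simplex *)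

Section SimplexVolume.
Variables (R : realType) (n : nat).
Notation V := 'rV[R]_n.+1.
Local Notation leb := (@leb_outer R n.+1).

(** The offsets [0, ..., J] in each coordinate already give [J.+1 ^ n.+1] grid points in the ball,
    of total mass exactly [1]. *)
Lemma lmass_unit_ball J : 1 <= lmass J [set x : V | `|x| <= 1].
Proof.
have JM (k : 'I_J.+1) : (J.+1 ^ 2 + k < (2 * J.+1 ^ 2).+1)%N.
  rewrite ltnS mul2n -addnn leq_add2l (leq_trans (ltnW (ltn_ord k)))//.
  by rewrite leq_pmulr.
pose z (f : {ffun 'I_n.+1 -> 'I_J.+1}) : lat n J := [ffun i => Ordinal (JM (f i))].
have zinj : injective z.
  move=> f g /ffunP H; apply/ffunP => i; have := H i; rewrite !ffunE => /(congr1 val) /= /eqP.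
  by rewrite eqn_add2l => /eqP; exact: val_inj.
have h0 : 0 < mesh R J := mesh_gt0 R J.
have zp f : lpt R (z f) \in [set x : V | `|x| <= 1].
  apply/mem_set => /=; apply: norm_le_coord => // i; rewrite mxE ffunE /= natrD addrC addKr.
  rewrite ger0_norm; last by rewrite mulr_ge0// ltW.
  by rewrite mulrC ler_pdivrMr// mul1r ler_nat ltnW.
apply: (@le_trans _ _ (\sum_(u in z @: [set: {ffun 'I_n.+1 -> 'I_J.+1}]%SET) mesh R J ^+ n.+1)).
  rewrite sumr_const card_imset// cardsT card_ffun !card_ord -[_ *+ _]mulr_natl natrX.
  by rewrite -exprMn mulfV ?expr1n// pnatr_eq0.
rewrite /lmass /dmass big_mkcond [leRHS]big_mkcond; apply: ler_sum => u _.
case: ifP => [/imsetP[f _ ->]|_]; first by rewrite zp.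
by case: ifP => // _; rewrite exprn_ge0// ltW.
Qed.

(** An infimum over coverings is bounded below through the grid: the counts stay at least [1], and
    [lmass_compact] bounds them by the measure plus [1 / 2]. *)
Lemma leb_unit_ball_gt0 : (0 < leb [set x : V | (`|x| <= 1)%R])%E.
Proof.
set K : set V := [set x | `|x| <= 1].
have cK : compact K by exact: compact_ball0.
have h0 : 0 < 1 / 2 :> R by rewrite divr_gt0.
have [d d0 [N HN]] := lmass_compact h0 cK.
have := HN N (leqnn N); rewrite lt0e leb_ge0 andbT => H; apply/eqP => E.
move: H; rewrite E add0e lee_fin => H.
have : lmass N K <= lmass N (thick d K).
  apply: dmass_mono; first by move=> z; rewrite exprn_ge0// ltW// mesh_gt0.
  exact: (@sub_thick R V).
have := lmass_unit_ball N; rewrite -/K; lra.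
Qed.

Lemma leb_cube_gt0 (s : R) : 0 < s ->
  (0 < leb [set x : V | forall i, (0 <= x ord0 i <= s)%R])%E.
Proof.
move=> s0; rewrite lt0e leb_ge0 andbT; apply/eqP => E.
have := leb_unit_ball_gt0; suff -> : leb [set x : V | (`|x| <= 1)%R] = 0%E by rewrite ltxx.
have ug : ((2 / s)%:M : 'M[R]_n.+1) \in unitmx.
  by rewrite unitmxE unitfE det_scalar expf_neq0// gt_eqF// divr_gt0.
have := leb_mulmx [set x : V | forall i, 0 <= x ord0 i <= s] ug; rewrite E mule0.
rewrite -(@leb_shift _ _ _ (const_mx (-1))) => E2.
apply: leb_null_sub E2 => x /= x1.
exists (x + const_mx 1); last by apply/rowP => i; rewrite !mxE addrK.
exists ((s / 2) *: (x + const_mx 1)); last first.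
  rewrite mul_mx_scalar scalerA; have -> : 2 / s * (s / 2) = 1 by field; rewrite gt_eqF.
  by rewrite scale1r.
move=> i; rewrite !mxE; have := le_trans (coord_le_norm x i) x1; rewrite ler_norml.
move=> /andP[? ?]; rewrite mulr_ge0/=; last 2 first.
- by rewrite divr_ge0// ltW.
- lra.
by rewrite mulrAC ler_pdivrMr// ler_pM2l//; lra.
Qed.

Lemma subdiff_simplex_coord (y : V) : subdiff (@simplex_fun R n) 0 y ->
  forall i, 0 <= y ord0 i <= 1.
Proof.
move=> Hy i.
have S0 : simplex_fun (0 : V) = 0.
  by have [//|[j ->]] := simplex_fun_eq (0 : V); rewrite mxE.
have := Hy (delta_mx ord0 i); have := Hy (- delta_mx ord0 i).
rewrite !subr0 S0 !add0r vdotNr vdot_delta.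
have e1 : simplex_fun (delta_mx ord0 i : V) <= 1.
  have [->|[j ->]] := simplex_fun_eq (delta_mx ord0 i : V); first exact: ler01.
  by rewrite mxE; case: (_ && _).
have e2 : simplex_fun (- delta_mx ord0 i : V) <= 0.
  have [->//|[j ->]] := simplex_fun_eq (- delta_mx ord0 i : V).
  by rewrite !mxE oppr_le0.
lra.
Qed.

(** Volume of the standard simplex, which is the subdifferential at [0] of its support function. It
    normalizes the comparison of [Psi] with [monge_ampere]. *)
Definition simplex_vol : R := fine (leb (subdiff (@simplex_fun R n) 0)).

Lemma simplex_volE : leb (subdiff (@simplex_fun R n) 0) = simplex_vol%:E.
Proof.
rewrite fineK//; apply: (@leb_fin _ _ _ 1) => y /subdiff_simplex_coord Hy.
by apply: norm_le_coord => // i; have /andP[h1 h2] := Hy i; rewrite ger0_norm.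
Qed.

Lemma simplex_vol_gt0 : 0 < simplex_vol.
Proof.
rewrite -lte_fin -simplex_volE.
(* The cube of side [1 / n.+1] at the origin lies in the simplex. *)
have s0 : 0 < (n.+1%:R^-1 : R) by rewrite invr_gt0.
apply: lt_le_trans (leb_cube_gt0 s0) _; apply: leb_mono => y Hy z.
have -> : simplex_fun (0 : V) = 0.
  by have [//|[j ->]] := simplex_fun_eq (0 : V); rewrite mxE.
rewrite subr0 add0r.
apply: (@le_trans _ _ (\sum_(i < n.+1) n.+1%:R^-1 * simplex_fun z)).
  apply: ler_sum => i _; have /andP[h1 h2] := Hy i.
  apply: (@le_trans _ _ (y ord0 i * simplex_fun z)).
    by rewrite ler_wpM2l// simplex_fun_ge.
  by rewrite ler_wpM2r// simplex_fun_ge0.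
by rewrite sumr_const card_ord -[_ *+ _]mulr_natl mulrA mulfV// mul1r.
Qed.

End SimplexVolume.

(** * Monge-Ampere mass of a piecewise linear function, carried by its vertices *)

Section Vertices.
Variables (R : realType) (n : nat).
Notation V := 'rV[R]_n.+1.
Local Notation leb := (@leb_outer R n.+1).

Lemma compact_subdiff (f : V -> R) x : convex_fun f -> compact (subdiff f x).
Proof.
move=> cf; have := compact_subdiff_image cf (@compact_set1 _ x).
by congr compact; rewrite /subdiff_image bigcup_set1.
Qed.

Lemma subdiff_germ (f g : V -> R) x0 (a e : R) : convex_fun f -> convex_fun g -> 0 < e ->
  (forall x, `|x - x0| < e -> f x = a + g (x - x0)) -> subdiff f x0 = subdiff g 0.
Proof.
move=> cf cg e0 H.
have f0 : f x0 = a + g 0 by rewrite H subrr// normr0.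
apply/seteqP; split=> y Hy.
  apply: (subdiff_local cg e0) => z; rewrite subr0 => ze.
  have := Hy (z + x0); rewrite addrK f0 H ?addrK//; lra.
apply: (subdiff_local cf e0) => z ze.
by have := Hy (z - x0); rewrite subr0 f0 H//; lra.
Qed.

Lemma subdiff_addl (g : V -> R) (b : V) :
  subdiff (fun z => vdot z b + g z) 0 = [set y + b | y in subdiff g 0].
Proof.
apply/seteqP; split=> [y Hy|_ [y Hy <-] z]; last first.
  by have := Hy z; rewrite !subr0 vdot0l vdotDl [vdot b z]vdotC; lra.
exists (y - b); last by rewrite subrK.
by move=> z; have := Hy z; rewrite !subr0 vdot0l vdotBl [vdot b z]vdotC; lra.
Qed.

Lemma leb_subdiff_simplex (D : 'M[R]_n.+1) (b : V) : D \in unitmx ->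
  leb (subdiff (fun z => vdot z b + simplex_fun (z *m D)) 0) =
  (`|\det D| * simplex_vol R n)%:E.
Proof.
move=> uD; rewrite (subdiff_addl (fun z => simplex_fun (z *m D))) leb_shift.
rewrite subdiff_mulmx// mul0mx leb_mulmx ?unitmx_tr// det_tr simplex_volE EFinM//.
Qed.

Variables (N : nat) (y : 'I_N.+1 -> V) (c : 'I_N.+1 -> R).
Local Notation f := (pl y c).

Definition dirs (S : pred 'I_N.+1) b : 'M[R]_(N.+1, n.+1) :=
  \matrix_i (restr y S b i - y b).

Definition is_vertex x := exists b, active y c x b /\ row_full (dirs (active y c x) b).

Definition actset x : {set 'I_N.+1} := [set i | active y c x i]%SET.

Lemma restr_actset x b : restr y (fun i => i \in actset x) b = restr y (active y c x) b.
Proof. by apply/funext => i; rewrite /restr inE. Qed.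

(** The pieces active at both points make [x - x'] orthogonal to all the differences of active
    slopes, and these span. Vertices can thus be indexed by the finite type of active sets. *)
Lemma vertex_uniq x x' : is_vertex x -> actset x = actset x' -> x = x'.
Proof.
move=> [b [ab rf]] E.
have aE i : active y c x i = active y c x' i.
  by have := congr1 (fun A : {set _} => i \in A) E; rewrite /= !inE.
have ab' : active y c x' b by rewrite -aE.
apply/eqP; rewrite -subr_eq0; apply/eqP.
have H : dirs (active y c x) b *m (x - x')^T = 0.
  apply/matrixP => i j; rewrite ord1 [RHS]mxE.
  transitivity (vdot (restr y (active y c x) b i - y b) (x - x')).
    by rewrite vdotE !mxE; apply: eq_bigr => l _; rewrite !mxE.
  rewrite /restr; case: ifP => Si; last by rewrite subrr vdot0l.
  have Si' : active y c x' i by rewrite -aE.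
  move: Si Si' ab ab' => /eqP h1 /eqP h2 /eqP h3 /eqP h4.
  rewrite vdotBl !vdotBr ![vdot (y _) _]vdotC; lra.
apply: trmx_inj; rewrite trmx0.
by rewrite -[LHS]mul1mx -(mulVpmx rf) -mulmxA H mulmx0.
Qed.

(* The vertex with active set [S], and the junk value [0] when there is none. *)
Definition vtx (S : {set 'I_N.+1}) : V := xget 0 [set x | is_vertex x /\ actset x = S].
Definition vtx_ok (S : {set 'I_N.+1}) : bool := `[< exists x, is_vertex x /\ actset x = S >].
Definition vtx_mass (S : {set 'I_N.+1}) : R :=
  if vtx_ok S then fine (leb (subdiff f (vtx S))) else 0.

Lemma vtxP S : vtx_ok S -> is_vertex (vtx S) /\ actset (vtx S) = S.
Proof.
move=> /asboolP[x Hx].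
by apply: (@xgetPex _ (0 : V) [set x | is_vertex x /\ actset x = S]); exists x.
Qed.

Lemma vtx_actset x : is_vertex x -> vtx_ok (actset x) /\ vtx (actset x) = x.
Proof.
move=> vx; have ok : vtx_ok (actset x) by apply/asboolP; exists x.
split=> //; have [vv E] := vtxP ok; exact: vertex_uniq.
Qed.

Lemma vtx_mass_ge0 S : 0 <= vtx_mass S.
Proof. by rewrite /vtx_mass; case: ifP => // _; rewrite fine_ge0// leb_ge0. Qed.

Lemma vtx_massE S : vtx_ok S -> (vtx_mass S)%:E = leb (subdiff f (vtx S)).
Proof.
move=> ok; rewrite /vtx_mass ok fineK//.
have [r r0 Hr] := @compact_norm_bound R V _ (@compact_subdiff _ (vtx S) (@convex_pl _ _ _ y c)).
exact: leb_fin Hr.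
Qed.

(** Subdifferentials at distinct vertices are compact and overlap in null sets, so [leb_superadd]
    applies. *)
Lemma dmass_le_subdiff (K : set V) :
  ((dmass vtx_mass vtx K)%:E <= leb (subdiff_image f K))%E.
Proof.
pose L := [seq S <- enum {: {set 'I_N.+1}} | vtx_ok S & vtx S \in K].
apply: (@le_trans _ _ (\sum_(S <- L) leb (subdiff f (vtx S)))%E).
  rewrite big_filter big_enum_cond /= /dmass -sumEFin.
  rewrite [leRHS]big_mkcond [leLHS]big_mkcond.
  apply: lee_sum => S _; case: (boolP (vtx S \in K)) => HS; last by rewrite andbF.
  rewrite andbT; case: ifP => ok; first by rewrite vtx_massE.
  by rewrite /vtx_mass ok.
apply: (@le_trans _ _ (leb (\big[setU/set0]_(S <- L) subdiff f (vtx S)))).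
  apply: leb_superadd.
  - by rewrite filter_uniq// enum_uniq.
  - by move=> S; apply: compact_subdiff; exact: convex_pl.
  move=> S T; rewrite !mem_filter => /andP[/andP[okS _] _] /andP[/andP[okT _] _] ST.
  have vST : vtx S != vtx T.
    apply: contra ST => /eqP E; have [_ <-] := vtxP okS; have [_ <-] := vtxP okT.
    by rewrite E.
  have := @subdiff_image_disjoint_null R n f [set vtx S] [set vtx T] (@convex_pl _ _ _ y c)
    (@compact_set1 _ _) (@compact_set1 _ _).
  rewrite /subdiff_image !bigcup_set1; apply; apply/seteqP; split=> // z [-> E].
  by move/eqP : vST; apply.
apply: leb_mono; rewrite -bigcup_seq => z [S]; rewrite /= mem_filter => /andP[/andP[_ /set_mem KS] _] Hz.
by exists (vtx S).
Qed.

(** Some [u] in the cokernel is orthogonal to all the differences. The function is linear along [u],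
    so every subgradient at [0] lies in one hyperplane orthogonal to [u]. *)
Lemma leb_subdiff_flat S b : ~~ row_full (dirs S b) ->
  leb (subdiff (pl (restr y S b) (fun=> 0)) 0) = 0%E.
Proof.
move=> nrf; set A := dirs S b in nrf.
have [u u0 Au] : exists2 u : V, u != 0 & forall i, vdot u (restr y S b i) = vdot u (y b).
  have : cokermx A != 0.
    rewrite -mxrank_eq0 mxrank_coker subn_eq0 -ltnNge ltn_neqAle rank_leq_col andbT.
    by move: nrf; rewrite /row_full.
  move=> /matrix0Pn[i [j Hij]]; exists (col j (cokermx A))^T.
    by apply: contraNneq Hij => /matrixP/(_ ord0 i); rewrite !mxE => ->.
  move=> k; apply/eqP; rewrite -subr_eq0 -vdotBr.
  have /matrixP/(_ k j) := mulmx_coker A; rewrite !mxE => E; apply/eqP; rewrite -[RHS]E.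
  by apply: eq_bigr => l _; rewrite !mxE mulrC.
have P (t : R) : pl (restr y S b) (fun=> 0) (t *: u) = t * vdot u (y b).
  apply: pl_eq => [i|]; first by rewrite addr0 vdotZl Au.
  by exists b; rewrite addr0 vdotZl Au.
apply: (leb_null_hyperplane u0 (al := vdot u (y b))).
  by apply: compact_subdiff; exact: convex_pl.
move=> z Hz; have := Hz (1 *: u); have := Hz (-1 *: u).
have := P 0; rewrite scale0r mul0r => ->.
rewrite !P !subr0 !vdotZr; lra.
Qed.

Lemma subdiff_pl_germ x b : active y c x b ->
  subdiff f x = subdiff (pl (restr y (active y c x) b) (fun=> 0)) 0.
Proof.
move=> ab; have [e e0 He] := pl_local ab.
by apply: (subdiff_germ _ _ e0 He); exact: convex_pl.
Qed.

(** At a point that is not a vertex the subdifferential is that of a flat germ. Such a germ is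
    determined by an active set and a base index, so finitely many null sets cover this part. *)
Lemma subdiff_le_dmass (U : set V) :
  (leb (subdiff_image f U) <= (dmass vtx_mass vtx U)%:E)%E.
Proof.
pose X1 := subdiff_image f (U `&` [set x | is_vertex x]).
pose X2 := subdiff_image f [set x | ~ is_vertex x].
apply: (@le_trans _ _ (leb X1 + leb X2)%E).
  apply: le_trans (leb_setU _ _); apply: leb_mono => z [x Ux zx].
  by have [v|v] := pselect (is_vertex x); [left|right]; exists x.
have -> : leb X2 = 0%E.
  pose F (p : {set 'I_N.+1} * 'I_N.+1) :=
    subdiff (pl (restr y (fun i => i \in p.1) p.2) (fun=> 0)) 0.
  apply/eqP; rewrite eq_le leb_ge0 andbT.
  apply: (@le_trans _ _ (\sum_(p : {set 'I_N.+1} * 'I_N.+1 | ~~ row_full (dirs (fun i => i \in p.1) p.2)) leb (F p))%E).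
    apply: leb_finU => z [x nvx zx]; have [b ab] := pl_active y c x.
    exists (actset x, b) => /=; last by rewrite /F /= restr_actset -subdiff_pl_germ.
    apply/negP => rf; apply: nvx; exists b; split=> //.
    by move: rf; rewrite /dirs restr_actset.
  by rewrite big1// => p np; exact: leb_subdiff_flat.
rewrite adde0 /dmass -sumEFin.
apply: (@le_trans _ _ (\sum_(S | vtx_ok S && (vtx S \in U)) leb (subdiff f (vtx S)))%E).
  apply: leb_finU => z [x [Ux vx] zx]; have [ok E] := vtx_actset vx.
  by exists (actset x); rewrite E// ok; exact/mem_set.
rewrite [leRHS]big_mkcond [leLHS]big_mkcond; apply: lee_sum => S _.
case: (boolP (vtx S \in U)) => HS; rewrite ?andbT ?andbF//.
case: ifP => ok; first by rewrite vtx_massE.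
by rewrite lee_fin vtx_mass_ge0.
Qed.

End Vertices.

(** * Finite sums for Monge-Ampere and Lebesgue integrals *)

Section MongeAmpereApprox.
Variables (R : realType) (n : nat).
Notation V := 'rV[R]_n.+1.
Local Notation leb := (@leb_outer R n.+1).

Lemma leb_subdiff_fin (f : V -> R) (A : set V) (r : R) : convex_fun f ->
  A `<=` [set x | `|x| <= r] -> leb (subdiff_image f A) \is a fin_num.
Proof.
move=> cf Ar.
have [s s0 Hs] := @compact_norm_bound R V _ (compact_subdiff_image cf (@compact_ball0 R n.+1 r)).
by apply: (@leb_fin _ _ _ s) => y [x /Ar xr yx]; apply: Hs; exists x.
Qed.

(** The estimates required by [layer_cvg] come from semicontinuity along the approximation, since
    for each approximant the vertex masses give the Monge-Ampere mass exactly. *)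
Lemma MA_cvg (f : V -> R) (N : nat -> nat) (y : forall j, 'I_(N j).+1 -> V)
    (c : forall j, 'I_(N j).+1 -> R) (phi : V -> R) : convex_fun f -> Cc phi ->
  loc_unif_cvg (fun j => pl (y j) (c j)) f ->
  (fun j => \sum_S vtx_mass (y j) (c j) S * phi (vtx (y j) (c j) S)) @ \oo -->
    layer_integral (fun B => leb (subdiff_image f B)) phi.
Proof.
move=> cf Cp lu.
have cpl j : convex_fun (pl (y j) (c j)) by exact: convex_pl.
apply: (@layer_cvg R n _ (fun j => {set 'I_(N j).+1}) (fun j => vtx_mass (y j) (c j))
  (fun j => vtx (y j) (c j))) => //.
- by move=> A B AB; apply: leb_mono => p [x /AB Bx px]; exists x.
- by move=> A; exact: leb_ge0.
- by rewrite /subdiff_image bigcup_set0 leb0.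
- by move=> r; exact: (leb_subdiff_fin (r := r)).
- by move=> j S; exact: vtx_mass_ge0.
- move=> K U e cK oU KU _ e0; have [M HM] := leb_subdiff_usc cf lu cK e0.
  exists M => j Mj; apply: (le_trans (dmass_le_subdiff _ _ _)).
  apply: (le_trans (HM j Mj)); rewrite leeD2r//; apply: leb_mono => p [x /KU Ux px].
  by exists x.
- move=> K U e cK oU KU [r Ur] e0.
  have [M HM] := leb_subdiff_lsc cpl cf lu cK oU KU Ur e0.
  exists M => j Mj; apply: (le_trans (HM j Mj)); rewrite leeD2r//.
  exact: subdiff_le_dmass.
Qed.

(** Riemann sums for the layer-cake integral: its linear behaviour is accessible through these sums,
    which are visibly linear. *)
Lemma lebesgue_lattice_cvg (phi : V -> R) : Cc phi ->
  (fun j => \sum_(z : lat n j) mesh R j ^+ n.+1 * phi (lpt R z)) @ \oo -->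
    layer_integral leb phi.
Proof.
move=> Cp.
apply: (@layer_cvg R n leb (fun j => lat n j) (fun j _ => mesh R j ^+ n.+1)
  (fun j => @lpt R n j)) => //.
- exact: leb_mono.
- exact: leb_ge0.
- exact: leb0.
- by move=> r; exact: (leb_fin (r := r)).
- by move=> j z; rewrite exprn_ge0// ltW// mesh_gt0.
- move=> K U e cK oU KU _ e0; have [d d0 [M HM]] := lmass_compact e0 cK.
  exists M => j Mj; apply: (@le_trans _ _ (lmass j (thick d K))%:E).
    rewrite lee_fin; apply: dmass_mono; last exact: (@sub_thick R V).
    by move=> z; rewrite exprn_ge0// ltW// mesh_gt0.
  by rewrite (le_trans (HM j Mj))// leeD2r// leb_mono.
- move=> K U e cK oU KU _ e0; have [d d0 dU] := @compact_thick R V K U cK oU KU.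
  have [r r0 Kr] := @compact_norm_bound R V K cK.
  have [N1 HN1] := @mesh_cvg R d d0; have [N2 HN2] := compact_bigball r.
  exists (N1 + N2)%N => j Nj.
  have H := @leb_lmass R n j d K (HN1 _ (leq_trans (leq_addr _ _) Nj)).
  apply: le_trans (H _) _.
    by move=> x Kx; rewrite (le_trans (Kr x Kx))// HN2// (leq_trans (leq_addl _ _) Nj).
  rewrite -[leLHS]adde0; apply: leeD; last by rewrite lee_fin ltW.
  rewrite lee_fin; apply: dmass_mono => // z.
  by rewrite exprn_ge0// ltW// mesh_gt0.
Qed.

End MongeAmpereApprox.

(** * Supports of bounded linear functionals *)

Section LocalFunctionals.
Variables (R : realType) (n : nat).
Notation V := 'rV[R]_n.+1.

Lemma cont_max (T : topologicalType) (f : T -> R) (a : R) : continuous f ->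
  continuous (fun x => Num.max (f x) a).
Proof.
move=> cf; apply: (@cont_comp _ _ _ f (fun t : R => Num.max t a)) => //.
apply: (@cont_epsP R R^o R^o) => x e e0; exists e => // y; apply: le_lt_trans.
have h1 := ler_norm (y - x); have h2 := ler_norm (x - y); rewrite [X in _ <= X]distrC in h2.
by rewrite ler_norml; case: (leP y a) => ?; case: (leP x a) => ?; apply/andP; split; lra.
Qed.

Lemma cont_inv (T : topologicalType) (f : T -> R) : continuous f ->
  (forall x, f x != 0) -> continuous (fun x => (f x)^-1).
Proof. by move=> cf f0 x; apply: cvgV; [exact: f0|exact: cf]. Qed.

Definition is_linear (mu : (V -> R) -> R) := forall (phi psi : V -> R) (a b : R),
  Cc phi -> Cc psi -> mu (fun x => a * phi x + b * psi x) = a * mu phi + b * mu psi.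

Definition is_bounded (mu : (V -> R) -> R) := forall K : set V, compact K -> exists C : R,
  forall (phi : V -> R) (M : R), Cc phi -> (forall x, ~ K x -> phi x = 0) ->
    (forall x, `|phi x| <= M) -> `|mu phi| <= C * M.

Definition vanishes_near (mu : (V -> R) -> R) (x : V) := exists2 e : R, 0 < e &
  forall psi, Cc psi -> (forall z, e <= `|z - x| -> psi z = 0) -> mu psi = 0.

Section Linear.
Variable mu : (V -> R) -> R.
Hypothesis lmu : is_linear mu.

Lemma lin0 : mu (fun=> 0) = 0.
Proof.
by have := lmu 0 0 (@Cc0 R n.+1) (@Cc0 R n.+1); rewrite !mul0r addr0.
Qed.

Lemma linB phi psi : Cc phi -> Cc psi -> mu (fun x => phi x - psi x) = mu phi - mu psi.
Proof.
move=> Cp Cq; have := lmu 1 (-1) Cp Cq; rewrite mul1r mulN1r => <-.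
by congr mu; apply/funext => x; rewrite mul1r mulN1r.
Qed.

Lemma linD phi psi : Cc phi -> Cc psi -> mu (fun x => phi x + psi x) = mu phi + mu psi.
Proof.
move=> Cp Cq; have := lmu 1 1 Cp Cq; rewrite !mul1r => <-.
by congr mu; apply/funext => x; rewrite !mul1r.
Qed.

Lemma linZ phi a : Cc phi -> mu (fun x => a * phi x) = a * mu phi.
Proof.
move=> Cp; have := lmu a 0 Cp Cp; rewrite mul0r addr0 => <-.
by congr mu; apply/funext => x; rewrite mul0r addr0.
Qed.

Lemma lin_sum (I : Type) (s : seq I) (F : I -> V -> R) : (forall i, Cc (F i)) ->
  mu (fun x => \sum_(i <- s) F i x) = \sum_(i <- s) mu (F i).
Proof.
move=> CF; elim: s => [|i s IH].
  by rewrite big_nil -[RHS]lin0; congr mu; apply/funext => x; rewrite big_nil.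
rewrite big_cons -IH -linD//; last exact: Cc_sum.
by congr mu; apply/funext => x; rewrite big_cons.
Qed.

(** A partition of unity: tents on a finite subcover are divided by their sum [T], cut off from
    below at a positive lower bound [d] of [T] on [K] so that the quotient is continuous
    everywhere. *)
Lemma vanishes_locally phi (K : set V) : Cc phi -> compact K ->
  (forall x, ~ K x -> phi x = 0) -> (forall x, K x -> vanishes_near mu x) -> mu phi = 0.
Proof.
move=> Cp cK phiK vK.
have H x : exists e : R, K x -> 0 < e /\
    forall psi, Cc psi -> (forall z, e <= `|z - x| -> psi z = 0) -> mu psi = 0.
  have [/vK[e e0 He]|nK] := pselect (K x); first by exists e.
  by exists 1.
have [e He] := choice H.
have : cover_compact K by rewrite -compact_cover.
move=> /(_ V K (fun c : V => [set x | `|x - c| < e c])); case.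
- move=> c _; apply/(@open_epsP R V) => x xc; exists (e c - `|x - c|); first by rewrite subr_gt0.
  move=> y yx; rewrite /= -(subrK x y) -addrA (le_lt_trans (ler_normD _ _))//.
  by rewrite -ltrBrDr.
- by move=> x Kx; exists x => //=; rewrite subrr normr0; have [] := He x Kx.
move=> D DK HD.
pose psi (c x : V) := Num.max (e c - `|x - c|) 0.
have cpsi c : continuous (psi c).
  apply: cont_max; apply: contB; first exact: cont_cst.
  apply: (@cont_comp _ _ _ (fun x : V => x - c) (fun x : V => `|x|)).
    exact: (@cont_shift R V).
  exact: (@cont_norm R V).
pose s := finmap.enum_fset D.
pose T x := \sum_(c <- s) psi c x.
have cT : continuous T by exact: cont_sum.
have psi0 c x : 0 <= psi c x by rewrite le_max lexx orbT.
have [d d0 Hd] : exists2 d : R, 0 < d & forall x, K x -> d <= T x.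
  apply: compact_EVT_min_pos => // x /HD[c Dc /= xc].
  have cs : c \in s by [].
  rewrite /T (big_rem c)//= ltr_pwDl ?sumr_ge0//.
  by rewrite lt_max subr_gt0 xc.
pose W x := (Num.max (T x) d)^-1.
have cW : continuous W.
  apply: cont_inv; first exact: cont_max.
  by move=> x; rewrite gt_eqF// lt_max d0 orbT.
pose F c x := phi x * (psi c x * W x).
have CF c : Cc (F c) by apply: CcM => //; exact: contM.
have -> : phi = (fun x => \sum_(c <- s) F c x).
  apply/funext => x; rewrite /F -mulr_sumr -mulr_suml -/(T x).
  have [Kx|/phiK->] := pselect (K x); last by rewrite mul0r.
  rewrite /W (max_idPl (Hd x Kx)) mulfV ?mulr1// gt_eqF//.
  exact: lt_le_trans (Hd x Kx).
rewrite lin_sum// big_seq big1// => c cs.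
have Kc : K c by apply/set_mem; apply: DK.
have [ec0 Hc] := He c Kc; apply: Hc => // z ez.
by rewrite /F /psi (max_idPr _) ?mul0r ?mulr0// subr_le0.
Qed.

(** [phi] vanishes on [Z] but perhaps not near it. A truncation moves the support off [Z] at a
    uniform cost [e], and boundedness makes the resulting error at most [C * e]. *)
Lemma vanishes_on phi (Z : set V) : is_bounded mu -> Cc phi ->
  (forall x, Z x -> phi x = 0) -> (forall x, ~ Z x -> vanishes_near mu x) -> mu phi = 0.
Proof.
move=> bmu Cp phiZ vZ; have /CcP[cp [r r0 Hr]] := Cp.
have [C HC] := bmu _ (@compact_ball0 R n.+1 r).
have H (e : R) : 0 < e -> `|mu phi| <= C * e.
  move=> e0.
  (* Soft thresholding at level [e]: [psi] vanishes wherever [|phi| <= e], and it differs from [phi]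
     by at most [e]. *)
  pose psi x := Num.max (phi x - e) 0 - Num.max (- phi x - e) 0.
  have psiE x : `|phi x| <= e -> psi x = 0.
    rewrite ler_norml => /andP[? ?]; rewrite /psi !(max_idPr _) ?subrr//; lra.
  have Cpsi : Cc psi.
    apply/CcP; split; last first.
      by exists r => // x /Hr E; apply: psiE; rewrite E normr0 ltW.
    by apply: contB; apply: cont_max; apply: contB; try exact: cont_cst; last exact: contN.
  have close x : `|phi x - psi x| <= e.
    rewrite ler_norml /psi; case: (leP (phi x - e) 0) => ?; case: (leP (- phi x - e) 0) => ?;
    by apply/andP; split; lra.
  have -> : mu phi = mu (fun x => phi x - psi x).
    rewrite linB// (_ : mu psi = 0) ?subr0//.
    apply: (@vanishes_locally _ [set x | e <= `|phi x|]) => //.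
    - apply: (@subclosed_compact _ _ [set x | `|x| <= r]); last 2 first.
      + exact: compact_ball0.
      + move=> x /= ex; rewrite leNgt; apply/negP => /Hr E.
        by move: ex; rewrite E normr0 leNgt e0.
      apply: (@closed_comp _ _ (fun x => `|phi x|) [set t | e <= t]); last exact: closed_ge.
      move=> x _; apply: (@cont_comp _ _ _ phi (fun t : R => `|t|)) => //.
      exact: (@cont_norm R R^o).
    - by move=> x /= /negP; rewrite -ltNge => /ltW; exact: psiE.
    - move=> x /= ex; apply: vZ => /phiZ E.
      by move: ex; rewrite E normr0 leNgt e0.
  apply: HC => //; first exact: CcB.
  by move=> x /= /negP; rewrite -ltNge => /Hr E; rewrite E psiE ?subrr// E normr0 ltW.
have C0 : 0 <= C by have := H 1 ltr01; rewrite mulr1; exact: le_trans.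
apply/eqP; rewrite -normr_le0 leNgt; apply/negP => m0.
have C1 : 0 < C + 1 by rewrite ltr_wpDl.
have := H (`|mu phi| / 2 / (C + 1)) _; rewrite !divr_gt0// => /(_ isT).
rewrite mulrC mulrAC ler_pdivlMr//.
have : `|mu phi| / 2 * C <= `|mu phi| / 2 * (C + 1) by rewrite ler_wpM2l ?divr_ge0// lerDl.
have : 0 < `|mu phi| * (C + 1) by rewrite mulr_gt0.
lra.
Qed.

End Linear.
End LocalFunctionals.

(** * Equivariant valuations of positive degree *)

Section EquivariantValuation.
Variables (R : realType) (n : nat).
Notation V := 'rV[R]_n.+1.

(** Real-valued counterpart of [MAVal] together with [GL_equivariant], satisfied by the real and the
    imaginary part of a complex valuation. *)
Record equivariant_valuation (k : nat) (q : R) (Psi : (V -> R) -> (V -> R) -> R) : Prop := {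
  ev_linear : forall f, convex_fun f -> is_linear (Psi f);
  ev_bounded : forall f, convex_fun f -> is_bounded (Psi f);
  ev_val : forall f h, convex_fun f -> convex_fun h ->
    convex_fun (fun x => Num.min (f x) (h x)) -> forall phi, Cc phi ->
    Psi (fun x => Num.max (f x) (h x)) phi + Psi (fun x => Num.min (f x) (h x)) phi =
    Psi f phi + Psi h phi;
  ev_cont : forall (fs : nat -> V -> R) (f : V -> R), (forall j, convex_fun (fs j)) ->
    convex_fun f -> loc_unif_cvg fs f -> forall phi, Cc phi ->
    (fun j => Psi (fs j) phi) @ \oo --> Psi f phi;
  ev_dual : forall f, convex_fun f -> forall (y : V) (c : R) phi, Cc phi ->
    Psi (fun x => f x + vdot x y + c) phi = Psi f phi;
  ev_local : forall f h, convex_fun f -> convex_fun h -> forall U : set V, open U ->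
    (forall x, U x -> f x = h x) -> forall phi, Cc phi ->
    (exists K : set V, compact K /\ K `<=` U /\ forall x, ~ K x -> phi x = 0) ->
    Psi f phi = Psi h phi;
  ev_trans : forall f, convex_fun f -> forall (a : V) phi, Cc phi ->
    Psi (fun x => f (x - a)) phi = Psi f (fun x => phi (x + a));
  ev_hom : forall f, convex_fun f -> forall t : R, 0 < t -> forall phi, Cc phi ->
    Psi (fun x => t * f x) phi = t ^+ k * Psi f phi;
  ev_GL : forall g : 'M[R]_n.+1, g \in unitmx -> forall f, convex_fun f ->
    forall phi, Cc phi ->
    Psi (fun x => f (x *m g)) (fun x => phi (x *m g)) = (`|\det g| `^ q) * Psi f phi }.

Variables (k : nat) (q : R) (Psi : (V -> R) -> (V -> R) -> R).
Hypothesis ev : equivariant_valuation k q Psi.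

(** Locality restricts to the ball, dual invariance removes the affine part, and translation moves
    [x0] to the origin. The test function is supported within radius [e / 2], compactly inside the
    open ball of radius [e]. *)
Lemma Psi_germ (f g : V -> R) x0 (y : V) (a e : R) (phi : V -> R) : convex_fun f ->
  convex_fun g -> 0 < e -> (forall x, `|x - x0| < e -> f x = a + vdot (x - x0) y + g (x - x0)) ->
  Cc phi -> (forall z, e / 2 <= `|z - x0| -> phi z = 0) ->
  Psi f phi = Psi g (fun x => phi (x + x0)).
Proof.
move=> cf cg e0 H Cp sp.
have cgs : convex_fun (fun x => g (x - x0)) by exact: convex_shift.
rewrite -(ev_trans ev cg x0 Cp) -(ev_dual ev cgs y (a - vdot x0 y) Cp).
apply: (@ev_local _ _ _ ev f _ cf _ [set x | `|x - x0| < e]) => //.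
- move=> x z t t01; have := cgs x z t t01; rewrite vdotDl !vdotZl; lra.
- apply/(@open_epsP R V) => x xe; exists (e - `|x - x0|); first by rewrite subr_gt0.
  move=> z zx; rewrite /= -(subrK x z) -addrA (le_lt_trans (ler_normD _ _))//.
  by rewrite -ltrBrDr.
- by move=> x /H ->; rewrite vdotBl; ring.
exists [set x | `|x - x0| <= e / 2]; split; first exact: compact_cball.
split=> x /=; first by move=> xe; lra.
by move=> /negP; rewrite -ltNge => /ltW; exact: sp.
Qed.

Lemma Psi_conj (g : 'M[R]_n.+1) f phi : g \in unitmx -> convex_fun f -> Cc phi ->
  Psi (fun x => f (x *m g)) phi = (`|\det g| `^ q) * Psi f (fun x => phi (x *m invmx g)).
Proof.
move=> ug cf Cp; have Cp' : Cc (fun x => phi (x *m invmx g)).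
  by apply: Cc_mulmx => //; rewrite unitmx_inv.
rewrite -(ev_GL ev ug cf Cp'); congr (Psi _ _).
by apply/funext => x; rewrite mulmxK.
Qed.

Definition diffs N (y : 'I_N.+1 -> V) : 'M[R]_(N.+1, n.+1) := \matrix_i (y i - y ord0).

Lemma diffs_mulE N (y : 'I_N.+1 -> V) (x : V) i :
  (diffs y *m x^T) i ord0 = vdot x (y i) - vdot x (y ord0).
Proof. by rewrite -vdotBr vdotC vdotE !mxE; apply: eq_bigr => j _; rewrite !mxE. Qed.

Lemma restr_in N (y : 'I_N.+1 -> V) S b i : exists j, restr y S b i = y j.
Proof. by rewrite /restr; case: ifP; [exists i|exists b]. Qed.

(** The differences of slopes active at [x0] are orthogonal to [x0], while those of [y] are not all
    so; hence the row space drops strictly. *)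
Lemma diffs_restr_rank N (y : 'I_N.+1 -> V) c x0 b : active y c x0 b ->
  (forall i, c i = 0) -> diffs y *m x0^T != 0 ->
  (\rank (diffs (restr y (active y c x0) b)) < \rank (diffs y))%N.
Proof.
move=> ab c0 nz; set y' := restr _ _ _.
have sub : (diffs y' <= diffs y)%MS.
  apply/row_subP => i; rewrite rowK /y'.
  have [j ->] := restr_in y (active y c x0) b i.
  have [l ->] := restr_in y (active y c x0) b ord0.
  have -> : y j - y l = row j (diffs y) - row l (diffs y).
    by rewrite !rowK opprB addrA subrK.
  by rewrite addmx_sub ?eqmx_opp ?row_sub.
have z : diffs y' *m x0^T = 0.
  apply/matrixP => i j; rewrite ord1 diffs_mulE mxE.
  have val l : vdot x0 (y' l) = pl y c x0.
    rewrite /y' /restr; case: ifP => [/eqP <-|_]; first by rewrite c0 addr0.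
    by rewrite -(eqP ab) c0 addr0.
  by rewrite !val subrr.
rewrite ltn_neqAle mxrankS// andbT; apply/eqP => E.
have sub' : (diffs y <= diffs y')%MS.
  by have := mxrank_leqif_sup sub; move=> /leqifP; case: ifP => // _; rewrite E ltnn.
have /submxP[D DE] := sub'.
by move/eqP : nz; apply; rewrite DE -mulmxA z mulmx0.
Qed.

Lemma pl_scale N (y : 'I_N.+1 -> V) (x x' : V) (s : R) : 0 < s ->
  (forall i, vdot x' (y i) = s * vdot x (y i)) ->
  pl y (fun=> 0) x' = s * pl y (fun=> 0) x.
Proof.
move=> s0 H; apply: pl_eq => [i|].
  by rewrite addr0 H ler_pM2l//; have := pl_ge y (fun=> 0) x i; rewrite addr0.
by have [i /eqP <-] := pl_active y (fun=> 0) x; exists i; rewrite !addr0 H.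
Qed.

(** Off the kernel of the differences the germ has smaller rank. The vanishing in smaller rank is a
    premise because the lemma serves both inside the induction of [Psi_flat] and after it. *)
Lemma Psi_off_kernel N (y : 'I_N.+1 -> V) :
  (forall N' (y' : 'I_N'.+1 -> V), (\rank (diffs y') < \rank (diffs y))%N ->
    forall phi, Cc phi -> Psi (pl y' (fun=> 0)) phi = 0) ->
  forall x0, diffs y *m x0^T <> 0 -> vanishes_near (Psi (pl y (fun=> 0))) x0.
Proof.
move=> IH x0 nz; have [b ab] := pl_active y (fun=> 0) x0.
have [e e0 He] := pl_local ab.
exists (e / 2); first by rewrite divr_gt0.
move=> psi Cpsi sp.
rewrite (@Psi_germ _ (pl (restr y (active y (fun=> 0) x0) b) (fun=> 0)) x0 0
  (pl y (fun=> 0) x0) e)//; [|exact: convex_pl|exact: convex_pl|]; last first.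
  by move=> x /He ->; rewrite vdot0r addr0.
apply: IH; last exact: Cc_shift.
by apply: diffs_restr_rank => //; apply/eqP.
Qed.

Lemma powR2_inj (a b : R) : (2 : R) `^ a = 2 `^ b -> a = b.
Proof.
move=> /(congr1 (@ln R)); rewrite !ln_powR => /mulIf; apply.
by rewrite gt_eqF// ln_gt0// ltr1n.
Qed.

(* [Psi (pl y 0)] lives on the kernel of the differences. Scaling transversally to
   the kernel gives [k = rank * q], hence [q > 0]; scaling along the kernel multiplies
   the mass by [s ^ ((n + 1 - rank) * q)], which is unbounded unless the mass is [0]. *)
Lemma Psi_flat N (y : 'I_N.+1 -> V) : (0 < k)%N -> (\rank (diffs y) < n.+1)%N ->
  forall phi, Cc phi -> Psi (pl y (fun=> 0)) phi = 0.
Proof.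
move=> k0; have [m] := ubnP (\rank (diffs y)).
elim: m N y => // m IH N y rm rn phi Cp.
(* Subtracting the linear function of index [ord0] makes [W] invariant under translations along the
   kernel. *)
pose y1 i := y i - y ord0; pose W := pl y1 (fun=> 0).
have cW : convex_fun W by exact: convex_pl.
have d1E : diffs y1 = diffs y.
  by apply/matrixP => i j; rewrite !mxE subrr subr0.
have -> : Psi (pl y (fun=> 0)) phi = Psi W phi.
  rewrite -(ev_dual ev cW (y ord0) 0 Cp); congr (Psi _ phi); apply/funext => x.
  apply: pl_eq => [i|].
    have := pl_ge y1 (fun=> 0) x i; rewrite /y1 vdotBr -/y1 -/(W x); lra.
  have [i /eqP E] := pl_active y1 (fun=> 0) x; exists i.
  by rewrite /W -E /y1 vdotBr; ring.
have lin := ev_linear ev cW; have bnd := ev_bounded ev cW.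
set Y := diffs y in rm rn d1E.
have vdotY (x : V) i : vdot x (y1 i) = (x *m Y^T) ord0 i.
  by rewrite vdotE !mxE; apply: eq_bigr => j _; rewrite !mxE.
(* In the coordinates [x *m T] the function [W] depends only on the first [r] coordinates, and the
   maps [G d] act diagonally. *)
pose r := \rank Y; pose T := (row_ebase Y)^T; pose L := col_ebase Y.
have uT : T \in unitmx by rewrite unitmx_tr row_ebase_unit.
have uL : L^T \in unitmx by rewrite unitmx_tr col_ebase_unit.
have YTE : Y^T = T *m pid_mx r *m L^T.
  by rewrite -{1}(mulmx_ebase Y) !trmx_mul tr_pid_mx mulmxA.
pose G (d : V) := T *m diag_mx d *m invmx T.
have detG d : \det (G d) = \prod_i d ord0 i.
  by rewrite /G !det_mulmx det_inv det_diag mulrAC mulfV ?mul1r// -unitfE -unitmxE.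
have GY (d x : V) : x *m G d *m Y^T = x *m T *m (diag_mx d *m pid_mx r) *m L^T.
  by rewrite /G YTE !mulmxA mulmxKV.
have off x0 : Y *m x0^T <> 0 -> vanishes_near (Psi W) x0.
  rewrite -d1E; apply: Psi_off_kernel => N' y' lt; apply: IH.
    by rewrite -ltnS (leq_trans _ rm)// ltnS; move: lt; rewrite d1E.
  by rewrite (leq_trans lt)// d1E ltnW.
apply/eqP; apply: contraT => muphi.
(* [d1] dilates transversally to the kernel, [d2] along it. *)
pose d1 (s : R) : V := \row_i (if (i < r)%N then s else 1).
pose d2 (s : R) : V := \row_i (if (i < r)%N then 1 else s).
have pd1 (s : R) : diag_mx (d1 s) *m pid_mx r = s *: (pid_mx r : 'M[R]_(n.+1, N.+1)).
  rewrite mul_diag_mx; apply/matrixP => i j; rewrite !mxE.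
  by case: (ltnP i r) => ir; rewrite ?andbT ?andbF ?mulr0.
have pd2 (s : R) : diag_mx (d2 s) *m pid_mx r = (pid_mx r : 'M[R]_(n.+1, N.+1)).
  rewrite mul_diag_mx; apply/matrixP => i j; rewrite !mxE.
  by case: (ltnP i r) => ir; rewrite ?andbT ?andbF ?mulr0 ?mul1r.
pose a1 := #|[pred i : 'I_n.+1 | (i < r)%N]|.
pose a2 := #|[pred i : 'I_n.+1 | ~~ (i < r)%N]|.
have det1 (s : R) : \det (G (d1 s)) = s ^+ a1.
  by rewrite detG /a1 -prodr_const [RHS]big_mkcond; apply: eq_bigr => i _; rewrite mxE inE.
have det2 (s : R) : \det (G (d2 s)) = s ^+ a2.
  rewrite detG /a2 -prodr_const [RHS]big_mkcond; apply: eq_bigr => i _; rewrite mxE !inE.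
  by case: ltnP.
have a20 : (0 < a2)%N.
  by apply/card_gt0P; exists ord_max; rewrite inE -leqNgt -ltnS.
have uG1 (s : R) : 0 < s -> G (d1 s) \in unitmx.
  by move=> s0; rewrite unitmxE unitfE det1 expf_neq0// gt_eqF.
have uG2 (s : R) : 0 < s -> G (d2 s) \in unitmx.
  by move=> s0; rewrite unitmxE unitfE det2 expf_neq0// gt_eqF.
have powE (s : R) a : 0 < s -> `|s ^+ a| `^ q = s `^ (a%:R * q).
  by move=> s0; rewrite ger0_norm ?exprn_ge0 ?(ltW s0)// powRrM powR_mulrn// ltW.
have W1 : (fun x => W (x *m G (d1 2))) = (fun x => 2 * W x).
  apply/funext => x; apply: pl_scale => // i; rewrite !vdotY GY pd1.
  by rewrite -scalemxAr -scalemxAl mxE YTE !mulmxA.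
have W2 (s : R) : (fun x => W (x *m G (d2 s))) = W.
  apply/funext => x; rewrite -[RHS]mul1r; apply: pl_scale => // i.
  by rewrite mul1r !vdotY GY pd2 YTE !mulmxA.
have u2 := uG1 2 (ltr0n _ 2).
have C1 : Cc (fun x => phi (x *m G (d1 2))) by exact: Cc_mulmx.
(* [G (d1 2)] fixes the kernel pointwise, so the two test functions agree there, and [Psi W]
   vanishes near every other point. *)
have inv1 : Psi W (fun x => phi (x *m G (d1 2))) = Psi W phi.
  apply/eqP; rewrite -subr_eq0 -(linB lin C1 Cp); apply/eqP.
  apply: (vanishes_on lin (Z := [set x | Y *m x^T = 0])) => //; first exact: CcB.
  move=> x /= Yx; apply/eqP; rewrite subr_eq0; apply/eqP; congr phi.
  have xY : x *m T *m pid_mx r *m L^T = 0.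
    by rewrite -!mulmxA [T *m _]mulmxA -YTE -[LHS]trmxK trmx_mul trmxK Yx trmx0.
  have {}xY : x *m T *m (pid_mx r : 'M[R]_(n.+1, N.+1)) = 0.
    by rewrite -[LHS](mulmxK uL) xY mul0mx.
  rewrite /G !mulmxA; suff -> : x *m T *m diag_mx (d1 2) = x *m T by rewrite mulmxK.
  rewrite mul_mx_diag; apply/rowP => i; rewrite mxE [d1 _ _ _]mxE.
  case: ifP => ir; last by rewrite mulr1.
  have iN : (i < N.+1)%N by rewrite (leq_trans ir)// rank_leq_row.
  move/rowP/(_ (Ordinal iN)) : xY; rewrite [LHS]mxE [RHS]mxE (bigD1 i)//= big1 ?addr0.
    by rewrite [pid_mx _ _ _]mxE /= eqxx ir mulr1 => ->; rewrite mul0r.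
  move=> j ji; rewrite [pid_mx _ _ _]mxE /= (_ : (j == i :> nat) = false) ?mulr0//.
  by apply/negbTE.
(* Homogeneity and equivariance give [2 ^ k = 2 ^ (a1 * q)], and the left exponent is positive. *)
have q0 : 0 < q.
  have := ev_GL ev u2 cW Cp; rewrite W1 (ev_hom ev)// inv1 det1 powE//.
  move=> /(mulIf muphi); rewrite -powR_mulrn// => /powR2_inj E.
  have : 0 < a1%:R * q by rewrite -E ltr0n.
  by case: (a1) => [|a]; rewrite ?mul0r ?ltxx// pmulr_rgt0.
have /CcP[cp [r' r'0 Hr']] := Cp.
have [M M0 HM] := Cc_bounded Cp.
have [C2 C20 HC2] := mulmx_norm (invmx T); have [C3 C30 HC3] := mulmx_norm T.
(* For [s >= 1] the map [G (d2 s)] does not shrink any coordinate of [x *m T], so the supports of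
   all the functions [phi (x *m G (d2 s))] stay in this fixed ball. *)
have [C HC] := bnd _ (@compact_ball0 R n.+1 (C2 * (C3 * r'))).
have key (s : R) : 1 <= s -> s `^ (a2%:R * q) * `|Psi W phi| <= C * M.
  move=> s1; have s0 : 0 < s by rewrite (lt_le_trans ltr01).
  have := ev_GL ev (uG2 s s0) cW Cp; rewrite W2 det2 powE// => E.
  rewrite -[X in X * _](@ger0_norm _ (s `^ _)) ?powR_ge0// -normrM -E; apply: HC.
  - by apply: Cc_mulmx => //; exact: uG2.
  - move=> x /= nx; apply: Hr'; rewrite ltNge; apply/negP => xr; apply: nx.
    rewrite -(mulmxK uT x) (le_trans (HC2 _))// ler_pM2l//.
    have GT : x *m G (d2 s) *m T = x *m T *m diag_mx (d2 s) by rewrite /G !mulmxA mulmxKV.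
    apply: (@le_trans _ _ `|x *m T *m diag_mx (d2 s)|).
      apply: norm_le_coord => // i; rewrite (le_trans _ (coord_le_norm _ i))//.
      rewrite mul_mx_diag [leRHS](_ : _ = `|(x *m T) ord0 i * d2 s ord0 i|); last by rewrite mxE.
      rewrite normrM ler_peMr// mxE; case: ifP; rewrite ?normr1// ger0_norm// ltW//.
    by rewrite -GT (le_trans (HC3 _))// ler_pM2l.
  - by move=> x; exact: HM.
have p0 : 0 < a2%:R * q by rewrite mulr_gt0// ltr0n.
have mu0 : 0 < `|Psi W phi| by rewrite normr_gt0.
pose B := C * M / `|Psi W phi|.
have B1 : 1 <= `|B| + 1 by rewrite lerDr.
(* Chosen so that [s ^ (a2 * q) = |B| + 1], which exceeds the bound [B]. *)
pose s := (`|B| + 1) `^ (a2%:R * q)^-1.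
have s1 : 1 <= s.
  rewrite -(powRr0 (`|B| + 1)); apply: ler_powR => //.
  by rewrite invr_ge0 ltW.
have := key s s1; rewrite -ler_pdivlMr// -/B /s -powRrM mulVf ?gt_eqF// powRr1; last by lra.
by move=> H; have := ler_norm B; lra.
Qed.

Lemma simplex_funP (w : V) (v : R) : 0 <= v -> (forall j, w ord0 j <= v) ->
  (v = 0 \/ exists j, v = w ord0 j) -> simplex_fun w = v.
Proof.
move=> v0 wv E; apply/eqP; rewrite eq_le; apply/andP; split.
  by have [->|[j ->]] := simplex_fun_eq w.
by case: E => [->|[j ->]]; [exact: simplex_fun_ge0|exact: simplex_fun_ge].
Qed.

Definition simplex_vertex (i : 'I_n.+2) : V :=
  if unlift ord0 i is Some j then delta_mx ord0 j else 0.

Lemma simplex_fun_pl : @simplex_fun R n = pl simplex_vertex (fun=> 0).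
Proof.
apply/funext => x; apply/esym; apply: pl_eq => [i|].
  rewrite addr0 /simplex_vertex; case: unlift => [j|]; first by rewrite vdot_delta simplex_fun_ge.
  by rewrite vdot0r simplex_fun_ge0.
have [->|[j ->]] := simplex_fun_eq x.
  by exists ord0; rewrite /simplex_vertex unlift_none vdot0r addr0.
by exists (lift ord0 j); rewrite /simplex_vertex liftK vdot_delta addr0.
Qed.

(** Every point other than [0] is off the kernel, so the functional is carried by the origin. By
    boundedness it kills [phi - phi 0 * chi], which vanishes at [0]: no derivatives of a Dirac mass
    occur. *)
Lemma Psi_simplex : (0 < k)%N -> exists v : R, forall phi, Cc phi ->
  Psi (@simplex_fun R n) phi = v * phi 0.
Proof.
move=> k0; have [chi [Cchi _ chi1]] := @Cc_bump R n.+1 1 ltr01.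
have cs := @convex_simplex_fun R n.
have lin := ev_linear ev cs; have bnd := ev_bounded ev cs.
exists (Psi (@simplex_fun R n) chi) => phi Cp.
have C2 : Cc (fun x => phi 0 * chi x) by exact: CcZ.
rewrite mulrC -(linZ lin)//; apply/eqP; rewrite -subr_eq0 -(linB lin)//; apply/eqP.
apply: (vanishes_on lin (Z := [set 0])) => //; first exact: CcB.
  by move=> x ->; rewrite chi1 ?normr0// mulr1 subrr.
move=> x x0; rewrite simplex_fun_pl; apply: Psi_off_kernel.
  move=> N y lt; apply: Psi_flat => //; apply: leq_trans lt _.
  exact: rank_leq_col.
move=> E; apply: x0; apply/rowP => j; rewrite [RHS]mxE.
have := diffs_mulE simplex_vertex x (lift ord0 j); rewrite E mxE.
by rewrite /simplex_vertex liftK unlift_none vdot_delta vdot0r subr0.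
Qed.

(* Cutting the standard simplex along the hyperplane through the midpoint of an edge
   produces two affine images of determinant [1/2] and a lower-dimensional piece. *)
Lemma simplex_weight v : (0 < k)%N ->
  (forall phi, Cc phi -> Psi (@simplex_fun R n) phi = v * phi 0) -> v != 0 ->
  q = 1 /\ k = n.+1.
Proof.
move=> k0 Hv v0.
have [chi [Cchi _ chi1]] := @Cc_bump R n.+1 1 ltr01.
have chi0 : chi 0 = 1 by rewrite chi1// normr0.
have cs := @convex_simplex_fun R n.
have Pg (g : 'M[R]_n.+1) : g \in unitmx ->
    Psi (fun x => simplex_fun (x *m g)) chi = (`|\det g| `^ q) * v.
  move=> ug; rewrite Psi_conj// Hv ?mul0mx ?chi0 ?mulr1//.
  by apply: Cc_mulmx => //; rewrite unitmx_inv.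
(* With [e0] the unit vector of index [ord0] and [e_j] the others, [h1] below is the support
   function of the half with vertices [0, e0 / 2, e_j], and [h2] that of the half with vertices
   [e0 / 2, e0, e_j], a translate of the image given by [g2]. Their common face, with support
   function [m], has vertices [e0 / 2, e_j]. *)
pose g1 : 'M[R]_n.+1 := diag_mx (\row_i (if i == ord0 then 1 / 2 else 1)).
pose g2 : 'M[R]_n.+1 := \matrix_(i, j)
  (if i == j then (if i == ord0 then 1 / 2 else 1) else if i == ord0 then - (1 / 2) else 0).
have pr : \prod_(i < n.+1) (if i == ord0 then 1 / 2 else 1) = 1 / 2 :> R.
  rewrite (bigD1 ord0)//= big1 ?mulr1// => i /negbTE ->//.
have det1 : \det g1 = 1 / 2.
  by rewrite det_diag -[RHS]pr; apply: eq_bigr => i _; rewrite mxE.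
have det2 : \det g2 = 1 / 2.
  rewrite -det_tr det_trig.
    by rewrite -[RHS]pr; apply: eq_bigr => i _; rewrite !mxE eqxx.
  apply/is_trig_mxP => i j ij; rewrite !mxE.
  have ji : (j == i) = false by apply/negbTE; rewrite -(inj_eq val_inj) gtn_eqF.
  by rewrite ji -(inj_eq val_inj) /= gtn_eqF// (leq_ltn_trans (leq0n i)).
have h0 : 1 / 2 != 0 :> R by rewrite mulf_neq0// invr_eq0.
have u1 : g1 \in unitmx by rewrite unitmxE unitfE det1.
have u2 : g2 \in unitmx by rewrite unitmxE unitfE det2.
have E1 (x : V) j : (x *m g1) ord0 j = if j == ord0 then x ord0 j / 2 else x ord0 j.
  rewrite /g1 mul_mx_diag !mxE; case: ifP => _; last by rewrite mulr1.
  by rewrite mul1r.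
have E2 (x : V) j : (x *m g2) ord0 j =
    if j == ord0 then x ord0 ord0 / 2 else x ord0 j - x ord0 ord0 / 2.
  rewrite mxE; have [->|j0] := eqVneq j ord0.
    rewrite (bigD1 ord0)//= big1 ?addr0 ?mxE ?eqxx ?mul1r//.
    by move=> i i0; rewrite mxE (negbTE i0) mulr0.
  rewrite (bigD1 j)//= (bigD1 ord0) ?(eq_sym ord0)//= big1 ?addr0.
    rewrite !mxE eqxx (negbTE j0) eq_sym (negbTE j0) eqxx mulr1; ring.
  by move=> i /andP[ij i0]; rewrite mxE (negbTE ij) (negbTE i0) mulr0.
pose ym (j : 'I_n.+1) : V := if j == ord0 then (1 / 2) *: delta_mx ord0 j else delta_mx ord0 j.
pose m := pl ym (fun=> 0).
have ymE (x : V) j : vdot x (ym j) = if j == ord0 then x ord0 j / 2 else x ord0 j.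
  by rewrite /ym; case: ifP => _; rewrite ?vdotZr vdot_delta ?mul1r// mulrC.
pose h1 (x : V) := simplex_fun (x *m g1).
pose h2 (x : V) := simplex_fun (x *m g2) + vdot x ((1 / 2) *: delta_mx ord0 ord0) + 0.
have ch1 : convex_fun h1 by exact: convex_mulmx.
have cg2 : convex_fun (fun x : V => simplex_fun (x *m g2)) by exact: convex_mulmx.
have ch2 : convex_fun h2.
  by move=> x z t t01; have := cg2 x z t t01; rewrite /h2 vdotDl !vdotZl; lra.
have h2E x : h2 x = simplex_fun (x *m g2) + x ord0 ord0 / 2.
  by rewrite /h2 addr0 vdotZr vdot_delta mul1r [_^-1 * _]mulrC.
have ms x : m x <= simplex_fun x.
  rewrite /m; have [j /eqP <-] := pl_active ym (fun=> 0) x; rewrite addr0 ymE; case: ifP => _.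
    by have := simplex_fun_ge0 x; have := simplex_fun_ge x j; lra.
  exact: simplex_fun_ge.
(* The sign of the coordinate [ord0] decides which of the two halves attains the maximum. *)
have hpos (x : V) : 0 <= x ord0 ord0 -> h1 x = m x /\ h2 x = simplex_fun x.
  move=> x0; split; apply/esym.
    apply: pl_eq => [j|]; first by rewrite addr0 ymE -E1 simplex_fun_ge.
    have [E|[j E]] := simplex_fun_eq (x *m g1); last by exists j; rewrite /h1 E addr0 ymE -E1.
    exists ord0; rewrite addr0 ymE eqxx /h1 E.
    by have := simplex_fun_ge (x *m g1) ord0; rewrite E E1 eqxx; lra.
  rewrite h2E; have S0 := simplex_fun_ge0 (x *m g2).
  have Sj j := simplex_fun_ge (x *m g2) j.
  apply: simplex_funP => [|j|]; first by lra.
    by have := Sj j; rewrite E2; case: eqP => [->|_]; lra.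
  have [E|[j E]] := simplex_fun_eq (x *m g2); rewrite E.
    by left; have := Sj ord0; rewrite E2 eqxx E; lra.
  by right; exists j; rewrite E2; case: eqP => [->|_]; lra.
have hneg (x : V) : x ord0 ord0 < 0 -> h1 x = simplex_fun x /\ h2 x = m x.
  move=> x0; split; apply/esym.
    have S0 := simplex_fun_ge0 (x *m g1); have Sj j := simplex_fun_ge (x *m g1) j.
    apply: simplex_funP => [//|j|].
      by have := Sj j; rewrite E1 /h1; case: eqP => [->|_]; lra.
    have [E|[j E]] := simplex_fun_eq (x *m g1); first by left.
    move: E; rewrite E1; case: eqP => [->|_] E; last by right; exists j.
    by exfalso; lra.
  rewrite h2E; have S0 := simplex_fun_ge0 (x *m g2).
  have Sj j := simplex_fun_ge (x *m g2) j.
  apply: pl_eq => [j|].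
    by rewrite addr0 ymE; have := Sj j; rewrite E2; case: eqP => [->|_]; lra.
  have [E|[j E]] := simplex_fun_eq (x *m g2); rewrite E.
    by exists ord0; rewrite addr0 ymE eqxx; lra.
  move: E; rewrite E2; case: eqP => [_|/eqP j0] E; first by exfalso; lra.
  by exists j; rewrite addr0 ymE (negbTE j0); lra.
have maxE : (fun x => Num.max (h1 x) (h2 x)) = @simplex_fun R n.
  apply/funext => x; have := ms x; have [x0|x0] := leP 0 (x ord0 ord0).
    by have [-> ->] := hpos x x0; move=> h; rewrite (max_idPr _).
  by have [-> ->] := hneg x x0; move=> h; rewrite (max_idPl _).
have minE : (fun x => Num.min (h1 x) (h2 x)) = m.
  apply/funext => x; have := ms x; have [x0|x0] := leP 0 (x ord0 ord0).
    by have [-> ->] := hpos x x0; move=> h; rewrite (min_idPl _).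
  by have [-> ->] := hneg x x0; move=> h; rewrite (min_idPr _).
have cm : convex_fun m by exact: convex_pl.
(* The common face gives a flat germ: the row of index [ord0] in the square matrix [diffs ym] is
   zero. *)
have m0 : Psi m chi = 0.
  apply: Psi_flat => //; rewrite ltn_neqAle rank_leq_row andbT.
  apply/negP => /eqP E; have : row_full (diffs ym) by rewrite /row_full E.
  rewrite row_full_unit unitmxE unitfE => /eqP; apply.
  by rewrite (expand_det_row _ ord0) big1// => j _; rewrite !mxE subrr mul0r.
have := ev_val ev ch1 ch2 _ Cchi; rewrite maxE minE => /(_ cm).
rewrite m0 addr0 Hv// chi0 mulr1.
have -> : Psi h2 chi = (`|\det g2| `^ q) * v by rewrite /h2 (ev_dual ev)// Pg.
rewrite /h1 Pg// det1 det2 -mulrDl -[LHS]mul1r => /(mulIf v0).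
have -> : `|1 / 2 : R| = 2^-1 by rewrite mul1r ger0_norm.
rewrite -powR_inv1// -powRrM mulN1r => E.
have q1 : q = 1.
  have : (2 : R) `^ 0 = 2 `^ (1 - q).
    rewrite powRr0 powRD; last by rewrite pnatr_eq0 implybT.
    by rewrite powRr1//; lra.
  by move=> /powR2_inj; lra.
split=> //.
(* The dilation by [2] compares degree and weight: [2 ^ k = 2 ^ n.+1]. *)
have ug : (2%:M : 'M[R]_n.+1) \in unitmx.
  by rewrite unitmxE unitfE det_scalar expf_neq0.
have := ev_GL ev ug cs Cchi.
have -> : (fun x : V => simplex_fun (x *m 2%:M)) = (fun x => 2 * simplex_fun x).
  apply/funext => x; rewrite mul_mx_scalar; apply: simplex_funP.
  - by rewrite mulr_ge0// simplex_fun_ge0.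
  - by move=> j; rewrite mxE ler_pM2l// simplex_fun_ge.
  have [->|[j ->]] := simplex_fun_eq x; first by left; rewrite mulr0.
  by right; exists j; rewrite mxE.
have C2 : Cc (fun x => chi (x *m 2%:M)) by exact: Cc_mulmx.
rewrite (ev_hom ev)// !Hv// mul0mx !chi0 !mulr1 => /(mulIf v0).
rewrite det_scalar q1 powRr1// ger0_norm ?exprn_ge0// -!powR_mulrn// => /powR2_inj /eqP.
by rewrite eqr_nat => /eqP.
Qed.

Lemma Psi_generic_pl v N (y : 'I_N.+1 -> V) (c : 'I_N.+1 -> R) : (0 < k)%N ->
  (forall phi, Cc phi -> Psi (@simplex_fun R n) phi = v * phi 0) ->
  (forall d : R, 0 < d -> d `^ q * v = d * v) -> generic y c ->
  forall phi, Cc phi -> Psi (pl y c) phi =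
    v / simplex_vol R n * \sum_S vtx_mass y c S * phi (vtx y c S).
Proof.
move=> k0 Hv hq gen phi Cp.
have kap0 := simplex_vol_gt0 R n; set kap := simplex_vol R n in kap0 *.
have cpl : convex_fun (pl y c) by exact: convex_pl.
have cs := @convex_simplex_fun R n.
pose mu psi := Psi (pl y c) psi - v / kap * \sum_S vtx_mass y c S * psi (vtx y c S).
suff : mu phi = 0 by move/eqP; rewrite subr_eq0 => /eqP.
have lmu : is_linear mu.
  move=> f g a b Cf Cg; rewrite /mu (ev_linear ev cpl)//.
  under eq_bigr do rewrite mulrDr mulrCA [X in _ + X]mulrCA.
  by rewrite big_split /= -!mulr_sumr; ring.
have /CcP[cp [r r0 Hr]] := Cp.
apply: (vanishes_locally lmu (K := [set x | `|x| <= r])) => //.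
- exact: compact_ball0.
- by move=> x /= /negP; rewrite -ltNge; exact: Hr.
move=> x0 _.
(* A ball around [x0] free of all other values of [vtx], including its default value. *)
have [e1 e10 He1] : exists2 e1 : R, 0 < e1 & forall S, vtx y c S != x0 ->
    e1 <= `|vtx y c S - x0|.
  have : nbhs x0 [set x : V | forall S, vtx y c S != x0 -> x != vtx y c S].
    apply: (@filter_forall _ _ (fun S (x : V) => vtx y c S != x0 -> x != vtx y c S) (nbhs x0)) => S.
    have [->|Sx] := eqVneq (vtx y c S) x0; first by near=> x.
    apply/(@nbhs_epsP R V); exists `|vtx y c S - x0|; first by rewrite normr_gt0 subr_eq0.
    by move=> x xx _; apply: contraTneq xx => ->; rewrite ltxx.
  move=> /(@nbhs_epsP R V)[e e0 He]; exists e => // S Sx.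
  by rewrite leNgt; apply/negP => /He/(_ S Sx); rewrite eqxx.
have [b ab] := pl_active y c x0.
have [e2 e20 He2] := pl_local ab.
pose e := Num.min e1 e2; have e0 : 0 < e by rewrite lt_min e10.
have ee1 : e <= e1 by rewrite ge_min lexx.
have ee2 : e <= e2 by rewrite ge_min lexx orbT.
exists (e / 2); first by rewrite divr_gt0.
move=> psi Cpsi sp.
have psiS S : vtx y c S != x0 -> psi (vtx y c S) = 0.
  by move=> /He1 H; apply: sp; lra.
set y' := restr y (active y c x0) b in He2.
have germ : Psi (pl y c) psi = Psi (pl y' (fun=> 0)) (fun x => psi (x + x0)).
  apply: (@Psi_germ _ _ x0 0 (pl y c x0) e) => //; first exact: convex_pl.
  by move=> x xe; rewrite He2 ?vdot0r ?addr0// (lt_le_trans xe).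
rewrite /mu germ.
have Cpsi' : Cc (fun x => psi (x + x0)) by exact: Cc_shift.
have [rf|nrf] := boolP (row_full (dirs y (active y c x0) b)).
  have vx : is_vertex y c x0 by exists b.
  have [D uD HD] := generic_vertex gen ab rf.
  have [ok vE] := vtx_actset vx.
  have cD : convex_fun (fun z : V => simplex_fun (z *m D)) by exact: convex_mulmx.
  have -> : pl y' (fun=> 0) = (fun z => simplex_fun (z *m D) + vdot z (y b) + 0).
    by apply/funext => z; rewrite HD addr0 addrC.
  have CD : Cc (fun x => psi (x *m invmx D + x0)).
    by apply: (@Cc_mulmx _ _ (fun x => psi (x + x0))) => //; rewrite unitmx_inv.
  rewrite (ev_dual ev)// Psi_conj// Hv//.
  rewrite mul0mx add0r mulrA hq; last by rewrite normr_gt0 -unitfE -unitmxE.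
  rewrite (bigD1 (actset y c x0))//= big1 ?addr0.
    rewrite vE; have -> : vtx_mass y c (actset y c x0) = `|\det D| * kap.
      apply: EFin_inj; rewrite vtx_massE// vE (subdiff_pl_germ ab).
      rewrite -(leb_subdiff_simplex (y b) uD); congr (leb_outer (subdiff _ 0)).
      by apply/funext => z; rewrite HD.
    by field; rewrite gt_eqF.
  move=> S Sn; have [okS|nok] := boolP (vtx_ok y c S); last first.
    by rewrite /vtx_mass (negbTE nok) mul0r.
  rewrite psiS ?mulr0//; apply: contra Sn => /eqP E.
  by have [_ <-] := vtxP okS; rewrite E.
(* [is_vertex] allows any active base index; the row space of the differences does not depend on
   this choice. *)
have nvx : ~ is_vertex y c x0.
  move=> [b' [ab' rf']]; move/negP : nrf; apply.
  have sub : (dirs y (active y c x0) b' <= dirs y (active y c x0) b)%MS.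
    have rowE i : active y c x0 i -> row i (dirs y (active y c x0) b) = y i - y b.
      by move=> ai; rewrite rowK /restr ai.
    apply/row_subP => i; rewrite rowK.
    have [j aj ->] : exists2 j, active y c x0 j & restr y (active y c x0) b' i = y j.
      by rewrite /restr; case: ifP => ai; [exists i|exists b'].
    have -> : y j - y b' = (y j - y b) - (y b' - y b) by rewrite opprB addrA subrK.
    by rewrite -!rowE// addmx_sub ?eqmx_opp ?row_sub.
  move: rf'; rewrite -!sub1mx => /submx_trans; exact.
rewrite Psi_flat//; last first.
  have sub : (diffs y' <= dirs y (active y c x0) b)%MS.
    apply/row_subP => i; rewrite rowK.
    have -> : y' i - y' ord0 = row i (dirs y (active y c x0) b) - row ord0 (dirs y (active y c x0) b).
      by rewrite !rowK opprB addrA subrK.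
    by rewrite addmx_sub ?eqmx_opp ?row_sub.
  rewrite (leq_ltn_trans (mxrankS sub))// ltn_neqAle rank_leq_col andbT.
  by move: nrf; rewrite /row_full.
rewrite sub0r big1 ?mulr0 ?oppr0// => S _.
have [okS|nok] := boolP (vtx_ok y c S); last by rewrite /vtx_mass (negbTE nok) mul0r.
rewrite psiS ?mulr0//; apply/eqP => E; apply: nvx; rewrite -E.
by have [] := vtxP okS.
Unshelve. all: by end_near. Qed.

(** This is applied to the real and to the imaginary part of a nonzero valuation. One of them may
    vanish, so weight and degree are determined only when [v != 0]. *)
Theorem Psi_monge_ampere : (0 < k)%N -> exists v : R,
  (v != 0 -> q = 1 /\ k = n.+1) /\
  forall f, convex_fun f -> forall phi, Cc phi -> Psi f phi =
    v / simplex_vol R n * layer_integral (fun B => leb_outer (subdiff_image f B)) phi.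
Proof.
move=> k0; have [v Hv] := Psi_simplex k0; exists v; split; first exact: simplex_weight.
have hq (d : R) : 0 < d -> d `^ q * v = d * v.
  move=> d0; have [->|v0] := eqVneq v 0; first by rewrite !mulr0.
  by have [-> _] := simplex_weight k0 Hv v0; rewrite powRr1// ltW.
move=> f cf phi Cp; have [N [y [c [gen lu]]]] := generic_pl_dense cf.
have cpl j : convex_fun (pl (y j) (c j)) by exact: convex_pl.
have h1 := ev_cont ev cpl cf lu Cp.
have h2 := MA_cvg cf Cp lu.
have h3 : (fun j => v / simplex_vol R n *
    \sum_S vtx_mass (y j) (c j) S * phi (vtx (y j) (c j) S)) @ \oo -->
    v / simplex_vol R n * layer_integral (fun B => leb_outer (subdiff_image f B)) phi.
  by apply: cvgM => //; exact: cvg_cst.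
apply: (@cvg_unique _ (@Rhausdorff R) _ _ _ _ h1).
apply: cvg_trans h3; apply: near_eq_cvg; near=> j.
by rewrite (Psi_generic_pl k0 Hv hq (gen j) Cp).
Unshelve. all: by end_near. Qed.

End EquivariantValuation.

(** * Translation invariant functionals are multiples of Lebesgue measure *)

Section Haar.
Variables (R : realType) (n : nat).
Notation V := 'rV[R]_n.+1.
Local Notation leb := (@leb_outer R n.+1).
Local Notation I := (layer_integral leb).

Lemma cvg_seq_eps (u : nat -> R) (l e : R) : u @ \oo --> l -> 0 < e ->
  exists N, forall j, (N <= j)%N -> `|l - u j| < e.
Proof. by move=> /cvgrPdist_lt H /H[N _ HN]; exists N => j; exact: HN. Qed.

Definition lsum J (phi : V -> R) : R :=
  \sum_(z : lat n J) mesh R J ^+ n.+1 * phi (lpt R z).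

Lemma lsum_abs_le J (phi psi : V -> R) : (forall x, `|phi x| <= psi x) ->
  `|lsum J phi| <= lsum J psi.
Proof.
have w0 : 0 <= mesh R J ^+ n.+1 by rewrite exprn_ge0// ltW// mesh_gt0.
move=> H; rewrite (le_trans (ler_norm_sum _ _ _))// ler_sum// => z _.
by rewrite normrM ger0_norm// ler_wpM2l.
Qed.

Lemma lsum_eventually_bounded (phi : V -> R) : Cc phi -> exists2 C : R, 0 < C &
  exists N, forall J, (N <= J)%N -> lsum J (fun x => `|phi x|) <= C.
Proof.
move=> Cp; have Ca : Cc (fun x => `|phi x|).
  have /CcP[cp [r r0 Hr]] := Cp; apply/CcP; split; last first.
    by exists r => // x /Hr ->; rewrite normr0.
  by apply: (@cont_comp _ _ _ phi (fun t : R => `|t|)) => //; exact: (@cont_norm R R^o).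
have [N HN] := cvg_seq_eps (lebesgue_lattice_cvg Ca) ltr01.
exists (`|I (fun x => `|phi x|)| + 1); first by rewrite ltr_wpDl.
exists N => J /HN H; have := ler_norm (I (fun x => `|phi x|)).
move: H; rewrite -/(lsum J (fun x => `|phi x|)) distrC => H.
by have := ler_norm (lsum J (fun x => `|phi x|) - I (fun x => `|phi x|)); lra.
Qed.

(** Volume is invariant under point reflections, which makes convolution commutative. *)
Lemma layer_leb_refl (phi : V -> R) (a : V) : I (fun x => phi (a - x)) = I phi.
Proof.
have H (P : set R) : leb [set x | P (phi (a - x))] = leb [set x | P (phi x)].
  rewrite -[RHS]leb_opp -[RHS](leb_shift _ a); congr leb.
  apply/seteqP; split=> [x Px|_ [_ [x Px <-] <-]] /=.
    exists (x - a); last by rewrite subrK.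
    by exists (a - x); rewrite ?opprB.
  by rewrite opprD opprK addrCA subrr addr0.
rewrite /layer_integral; congr (fine _ - fine _); apply: eq_integral => t _.
  exact: (H [set y | t < y]).
exact: (H [set y | y < - t]).
Qed.

Lemma layer_leb_bump (chi : V -> R) : Cc chi -> (forall x, 0 <= chi x) ->
  (forall x, `|x| <= 1 -> chi x = 1) -> 1 <= I chi.
Proof.
move=> Cchi c0 c1.
have cv := lebesgue_lattice_cvg Cchi; rewrite -(cvg_lim (@Rhausdorff R) cv).
apply: limr_ge; first by apply/cvg_ex; exists (I chi).
near=> J; apply: le_trans (lmass_unit_ball R n J) _.
rewrite /lmass /dmass big_mkcond /=; apply: ler_sum => z _.
case: ifPn => [/set_mem /= h|_]; first by rewrite c1// mulr1.
by rewrite mulr_ge0// exprn_ge0// ltW// mesh_gt0.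
Unshelve. all: by end_near. Qed.

(** For fixed [x] both grid sums tend to the same integral. Uniform continuity of [phi] and [psi],
    together with the eventual bounds on the grid sums, extends the convergence from a finite net to
    the whole ball. *)
Lemma conv_symm_unif (phi psi : V -> R) (r e : R) : Cc phi -> Cc psi -> 0 < e ->
  exists N, forall J, (N <= J)%N -> forall x, `|x| <= r ->
    `|lsum J (fun p => phi p * psi (x - p) - psi p * phi (x - p))| <= e.
Proof.
move=> Cp Cq e0.
have [C1 C10 [N1 HN1]] := lsum_eventually_bounded Cp.
have [C2 C20 [N2 HN2]] := lsum_eventually_bounded Cq.
(* Moving [x] to a net point changes the sum by at most [d0 * (C1 + C2) = e / 2]; the value at the
   net point takes the other half. *)
pose d0 := e / 2 / (C1 + C2).
have C0 : 0 < C1 + C2 by rewrite addr_gt0.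
have d00 : 0 < d0 by rewrite !divr_gt0.
have [d1 d10 H1] := Cc_unif_cont Cp d00.
have [d2 d20 H2] := Cc_unif_cont Cq d00.
have dm : 0 < Num.min d1 d2 by rewrite lt_min d10.
have [s Hs] := compact_finite_cover (@compact_ball0 R n.+1 r) dm.
pose F x p := phi p * psi (x - p) - psi p * phi (x - p).
have pt x : exists N, forall J, (N <= J)%N -> `|lsum J (F x)| < e / 2.
  have G1 := lebesgue_lattice_cvg (CcM Cp (Cc_refl x Cq).1).
  have G2 := lebesgue_lattice_cvg (CcM Cq (Cc_refl x Cp).1).
  have E : I (fun p => phi p * psi (x - p)) = I (fun p => psi p * phi (x - p)).
    rewrite -(layer_leb_refl (fun p => psi p * phi (x - p)) x); congr layer_integral.
    by apply/funext => p; rewrite subKr mulrC.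
  have G : (fun J => lsum J (F x)) @ \oo --> (0 : R).
    rewrite (_ : 0 = I (fun p => phi p * psi (x - p)) - I (fun p => psi p * phi (x - p)));
      last by rewrite E subrr.
    rewrite (_ : (fun J => lsum J (F x)) = fun J => lsum J (fun p => phi p * psi (x - p)) -
      lsum J (fun p => psi p * phi (x - p))); first exact: cvgB.
    by apply/funext => J; rewrite /lsum -sumrB; apply: eq_bigr => z _; rewrite mulrBr.
  have [N HN] := cvg_seq_eps G (divr_gt0 e0 (ltr0Sn R 1)).
  by exists N => J /HN; rewrite sub0r normrN.
have [N3 HN3] : exists N, forall J, (N <= J)%N -> forall c, c \in s -> `|lsum J (F c)| < e / 2.
  elim: (s) => [|c s' [N IH]]; first by exists 0%N.
  have [N' HN'] := pt c; exists (N + N')%N => J NJ c'.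
  rewrite inE => /predU1P[->|]; first by apply: HN'; rewrite (leq_trans (leq_addl _ _) NJ).
  by apply: IH; rewrite (leq_trans (leq_addr _ _) NJ).
exists (N1 + N2 + N3)%N => J NJ x xr.
have [c cs xc] := Hs x xr.
have J1 : (N1 <= J)%N by rewrite (leq_trans _ NJ)// -addnA leq_addr.
have J2 : (N2 <= J)%N by rewrite (leq_trans _ NJ)// addnAC leq_addl.
have J3 : (N3 <= J)%N by rewrite (leq_trans _ NJ)// leq_addl.
have K1 := HN1 _ J1; have K2 := HN2 _ J2; have K3 := HN3 _ J3 _ cs.
have xcp p : `|(x - p) - (c - p)| < Num.min d1 d2 by rewrite opprB addrA subrK.
have B : `|lsum J (fun p => F x p - F c p)| <=
    lsum J (fun p => d0 * (`|phi p| + `|psi p|)).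
  apply: lsum_abs_le => p.
  have -> : F x p - F c p = phi p * (psi (x - p) - psi (c - p)) -
     psi p * (phi (x - p) - phi (c - p)) by rewrite /F; ring.
  rewrite (le_trans (ler_normB _ _))// !normrM mulrDr !(mulrC d0) lerD// ler_wpM2l//.
    by apply/ltW/H2/(lt_le_trans (xcp p)); rewrite ge_min lexx orbT.
  by apply/ltW/H1/(lt_le_trans (xcp p)); rewrite ge_min lexx.
have E1 : lsum J (fun p => d0 * (`|phi p| + `|psi p|)) =
   d0 * (lsum J (fun p => `|phi p|) + lsum J (fun p => `|psi p|)).
  by rewrite /lsum -big_split mulr_sumr; apply: eq_bigr => z _; rewrite mulrCA mulrDr.
have E2 : lsum J (fun p => F x p - F c p) = lsum J (F x) - lsum J (F c).
  by rewrite /lsum -sumrB; apply: eq_bigr => z _; rewrite mulrBr.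
have B2 : d0 * (lsum J (fun p => `|phi p|) + lsum J (fun p => `|psi p|)) <= e / 2.
  rewrite (@le_trans _ _ (d0 * (C1 + C2)))// ?ler_pM2l ?lerD//.
  by rewrite /d0 divfK// gt_eqF.
rewrite E1 E2 in B.
have := ler_normD (lsum J (F x) - lsum J (F c)) (lsum J (F c)); rewrite subrK.
rewrite -/(F x); lra.
Qed.

Section Invariant.
Variable mu : (V -> R) -> R.
Hypothesis lmu : is_linear mu.
Hypothesis bmu : is_bounded mu.
Hypothesis tmu : forall (a : V) phi, Cc phi -> mu (fun x => phi (x + a)) = mu phi.

(** A discrete convolution is a finite combination of translates of [psi], on all of which [mu]
    takes the same value. *)
Lemma invariant_conv J (phi psi : V -> R) : Cc phi -> Cc psi ->
  mu (fun x => lsum J (fun p => phi p * psi (x - p))) = lsum J phi * mu psi.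
Proof.
move=> Cp Cq; rewrite /lsum (lin_sum lmu); last first.
  by move=> z; do 2 apply: CcZ; exact: Cc_shift.
rewrite mulr_suml; apply: eq_bigr => z _.
rewrite (linZ lmu); last by apply: CcZ; exact: Cc_shift.
by rewrite (linZ lmu) ?tmu ?mulrA//; exact: Cc_shift.
Qed.

(* [mu] of the discrete convolutions [phi * psi] and [psi * phi] is [lsum J phi * mu psi]
   and [lsum J psi * mu phi], while their difference tends to [0] uniformly. *)
Lemma invariant_exchange (phi psi : V -> R) : Cc phi -> Cc psi ->
  I phi * mu psi = I psi * mu phi.
Proof.
move=> Cp Cq; apply/eqP; rewrite -subr_eq0; apply/eqP.
pose D J x := lsum J (fun p => phi p * psi (x - p) - psi p * phi (x - p)).
have Csh (f g : V -> R) J : Cc f -> Cc (fun x => lsum J (fun p => g p * f (x - p))).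
  by move=> Cf; apply: Cc_sum => z; do 2 apply: CcZ; exact: Cc_shift.
have DE J : D J = fun x => lsum J (fun p => phi p * psi (x - p)) -
    lsum J (fun p => psi p * phi (x - p)).
  apply/funext => x; rewrite /D /lsum -sumrB.
  by apply: eq_bigr => z _; rewrite mulrBr.
have CD J : Cc (D J) by rewrite DE; apply: CcB; exact: Csh.
have muD J : mu (D J) = lsum J phi * mu psi - lsum J psi * mu phi.
  by rewrite DE (linB lmu) ?invariant_conv//; exact: Csh.
have cv : (fun J => mu (D J)) @ \oo --> I phi * mu psi - I psi * mu phi.
  under eq_fun do rewrite muD.
  by apply: cvgB; apply: cvgM; try exact: cvg_cst; exact: lebesgue_lattice_cvg.
have /CcP[_ [r1 r10 Hr1]] := Cp; have /CcP[_ [r2 r20 Hr2]] := Cq.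
have supp J x : r1 + r2 < `|x| -> D J x = 0.
  move=> xr; rewrite /D /lsum big1// => z _; set p := lpt R z.
  have H : r1 < `|p| \/ r2 < `|x - p|.
    have [|h] := ltP r1 `|p|; [by left|right].
    by have := ler_normD (x - p) p; rewrite subrK; lra.
  have H' : r2 < `|p| \/ r1 < `|x - p|.
    have [|h] := ltP r2 `|p|; [by left|right].
    by have := ler_normD (x - p) p; rewrite subrK; lra.
  case: H => /[dup] h; [move=> /Hr1 ->|move=> /Hr2 ->];
  by case: H' => /[dup] h'; [move=> /Hr2 ->|move=> /Hr1 ->];
    rewrite ?(mul0r, mulr0) subrr mulr0.
have [C HC] := bmu (@compact_ball0 R n.+1 (r1 + r2)).
apply: (@cvg_unique _ (@Rhausdorff R) _ _ _ _ cv).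
apply/cvgrPdist_le => e e0.
have C1 : 0 < `|C| + 1 by rewrite ltr_wpDl.
have [N HN] := @conv_symm_unif phi psi (r1 + r2) (e / (`|C| + 1)) Cp Cq (divr_gt0 e0 C1).
exists N => // J /= /HN H.
rewrite sub0r normrN.
have HM x : `|D J x| <= e / (`|C| + 1).
  have [|/supp ->] := leP `|x| (r1 + r2); first exact: H.
  by rewrite normr0 divr_ge0// ltW.
apply: (le_trans (HC (D J) _ (CD J) _ HM)).
  by move=> x /= /negP; rewrite -ltNge; exact: supp.
rewrite mulrA ler_pdivrMr// mulrC ler_pM2l//.
by have := ler_norm C; lra.
Qed.

Lemma invariant_lebesgue : exists c, forall phi, Cc phi -> mu phi = c * I phi.
Proof.
have [chi [Cchi c01 c1]] := @Cc_bump R n.+1 1 ltr01.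
have I1 : 1 <= I chi.
  apply: layer_leb_bump => // x.
  by have /andP[] := c01 x.
exists (mu chi / I chi) => phi Cp.
have I0 : I chi != 0 by rewrite gt_eqF// (lt_le_trans ltr01).
by rewrite mulrAC (mulrC (mu chi)) (invariant_exchange Cp Cchi) mulrAC mulfV// mul1r.
Qed.

End Invariant.
End Haar.

(** * Weights of the Lebesgue and Monge-Ampere operators *)

Section LayerScaling.
Variables (R : realType) (n : nat).
Notation V := 'rV[R]_n.+1.
Local Notation leb := (@leb_outer R n.+1).

(** [fine] sends infinite values to [0], and a nonzero factor keeps infinite values infinite, so the
    identity holds without finiteness. *)
Lemma fineZ (d : R) (x : \bar R) : d != 0 -> fine (d%:E * x)%E = d * fine x.
Proof.
move=> d0; case: x => [x| |] //=; rewrite mulr0; case: (ltrgtP d 0) d0 => // h _.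
- by rewrite lt0_muley ?lte_fin.
- by rewrite gt0_muley ?lte_fin.
- by rewrite lt0_muleNy ?lte_fin.
- by rewrite gt0_muleNy ?lte_fin.
Qed.

Lemma layer_pos_scale (nu nu' : set V -> \bar R) (phi phi' : V -> R) (d : R) : 0 < d ->
  (forall A, (0 <= nu A)%E) -> (forall A B, A `<=` B -> (nu A <= nu B)%E) ->
  (forall t, nu' [set x | t < phi' x] = (d%:E * nu [set x | (t < phi x)%R])%E) ->
  layer_pos nu' phi' = (d%:E * layer_pos nu phi)%E.
Proof.
move=> d0 nu0 num H; rewrite /layer_pos.
under eq_integral do rewrite H.
rewrite ge0_integralZl//.
- by rewrite itv_cyE; exact: measurable_itv.
- apply: nonincreasing_emeasurable.
    by rewrite itv_cyE; exact: measurable_itv.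
  by move=> s t st; apply: num => x /=; exact: le_lt_trans.
- by rewrite lee_fin ltW.
Qed.

Lemma layer_scale (nu nu' : set V -> \bar R) (g : 'M[R]_n.+1) (phi : V -> R) (d : R) :
  0 < d -> (forall A, (0 <= nu A)%E) -> (forall A B, A `<=` B -> (nu A <= nu B)%E) ->
  (forall A, nu' [set x | A (x *m g)] = (d%:E * nu A)%E) ->
  layer_integral nu' (fun x => phi (x *m g)) = d * layer_integral nu phi.
Proof.
move=> d0 nu0 num H; rewrite !layer_integralE.
rewrite (@layer_pos_scale nu nu' phi _ d)//; last by move=> t; exact: (H [set x | t < phi x]).
rewrite (@layer_pos_scale nu nu' (fun x => - phi x) _ d)//; last first.
  by move=> t; exact: (H [set x | t < - phi x]).
by rewrite !fineZ ?gt_eqF// mulrBr.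
Qed.

Lemma lebesgue_scale (g : 'M[R]_n.+1) (phi : V -> R) : g \in unitmx ->
  layer_integral leb (fun x => phi (x *m g)) = `|\det g|^-1 * layer_integral leb phi.
Proof.
move=> ug; have d0 : 0 < `|\det g| by rewrite normr_gt0 -unitfE -unitmxE.
apply: layer_scale; rewrite ?invr_gt0//; [exact: leb_ge0|exact: leb_mono|].
by move=> A; exact: leb_preimage_mulmx.
Qed.

(** Precomposition with [g] acts on gradients by [g^T], whence the factor [|\det g|] in place of its
    inverse. *)
Lemma monge_ampere_scale (g : 'M[R]_n.+1) (f phi : V -> R) : g \in unitmx ->
  layer_integral (fun B => leb (subdiff_image (fun x => f (x *m g)) B))
    (fun x => phi (x *m g)) =
  `|\det g| * layer_integral (fun B => leb (subdiff_image f B)) phi.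
Proof.
move=> ug; have d0 : 0 < `|\det g| by rewrite normr_gt0 -unitfE -unitmxE.
apply: layer_scale => //; first by move=> A; exact: leb_ge0.
  by move=> A B AB; apply: leb_mono => y [x /AB Bx yx]; exists x.
move=> A; rewrite -(det_tr g) -leb_mulmx ?unitmx_tr//; congr leb.
apply/seteqP; split=> [y [x Ax]|_ [y [x Ax yx] <-]].
  by rewrite subdiff_mulmx// => -[y' y'x <-]; exists y' => //; exists (x *m g).
exists (x *m invmx g); rewrite /= ?mulmxKV// subdiff_mulmx// mulmxKV//.
by exists y.
Qed.

End LayerScaling.

(** * Valuations of degree zero *)

Section DegreeZero.
Variables (R : realType) (n : nat) (q : R).
Notation V := 'rV[R]_n.+1.
Variable Psi : (V -> R) -> (V -> R) -> R.
Hypothesis ev : equivariant_valuation 0 q Psi.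
Local Notation I := (layer_integral (@leb_outer R n.+1)).

Lemma convex0 : convex_fun (fun _ : V => 0 : R).
Proof. by move=> x y t _; rewrite !mulr0 addr0. Qed.

Lemma Psi0_const (f phi : V -> R) : convex_fun f -> Cc phi ->
  Psi f phi = Psi (fun=> 0) phi.
Proof.
move=> cf Cp.
pose fs (j : nat) (x : V) := j.+1%:R^-1 * f x.
have fs0 j : (0 : R) < j.+1%:R^-1 by rewrite invr_gt0.
have cfs j : convex_fun (fs j).
  move=> x y t t01; rewrite /fs !(mulrCA _ j.+1%:R^-1) -mulrDr ler_pM2l//.
  exact: cf.
have lu : loc_unif_cvg fs (fun=> 0).
  move=> K cK e e0; have [r r0 Hr] := @compact_norm_bound R V K cK.
  have [B B0 HB] := convex_bounded cf r0.
  have [N HN] := @mesh_cvg R (e / B) (divr_gt0 e0 B0).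
  exists N => j /HN; rewrite /mesh ltr_pdivlMr// => h x /Hr/HB fB.
  rewrite subr0 /fs normrM gtr0_norm//; apply: le_lt_trans h.
  by rewrite ler_pM2l.
have := ev_cont ev cfs convex0 lu Cp.
under eq_fun do rewrite /fs (ev_hom ev cf (fs0 _) Cp) expr0 mul1r.
by move=> cv; apply: (@cvg_unique _ (@Rhausdorff R) _ _ _ _ _ cv); exact: cvg_cst.
Qed.

Theorem Psi_lebesgue : exists c : R, (c != 0 -> q = -1) /\
  forall f, convex_fun f -> forall phi, Cc phi -> Psi f phi = c * I phi.
Proof.
have [c Hc] : exists c, forall phi, Cc phi -> Psi (fun=> 0) phi = c * I phi.
  apply: invariant_lebesgue; [exact: ev_linear ev _ convex0|exact: ev_bounded ev _ convex0|].
  by move=> a phi Cp; rewrite -(ev_trans ev convex0 a Cp).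
exists c; split=> [c0|f cf phi Cp]; last by rewrite Psi0_const// Hc.
have [chi [Cchi c01 c1]] := @Cc_bump R n.+1 1 ltr01.
have I1 : 1 <= I chi by apply: layer_leb_bump => // x; have /andP[] := c01 x.
have u2 : (2%:M : 'M[R]_n.+1) \in unitmx.
  by rewrite unitmxE det_scalar unitfE expf_neq0// pnatr_eq0.
have := ev_GL ev u2 convex0 Cchi.
rewrite Hc; last exact: Cc_mulmx.
rewrite lebesgue_scale// Hc// mulrCA => E.
have E2 : `|\det (2%:M : 'M[R]_n.+1)|^-1 = `|\det (2%:M : 'M[R]_n.+1)| `^ q.
  apply: (mulIf _ E); rewrite mulf_neq0//.
  by rewrite gt_eqF// (lt_le_trans ltr01).
have n0 : n.+1%:R != 0 :> R by rewrite pnatr_eq0.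
apply: (mulfI n0); apply: powR2_inj.
rewrite !powRrM powR_mulrn// powR_inv1 ?exprn_ge0//.
by move: E2; rewrite det_scalar ger0_norm ?exprn_ge0.
Qed.

End DegreeZero.

(** * Reduction from complex to real valuations *)

Section ComplexParts.
Variables (R : realType) (n : nat).
Local Open Scope complex_scope.

Lemma MAVal_part (k : nat) (q : R) (Psi : mval R n.+1) (p : R[i] -> R) :
  p = @complex.Re R \/ p = @complex.Im R -> MAVal k Psi -> GL_equivariant q Psi ->
  equivariant_valuation k q (fun f phi => p (Psi f phi)).
Proof.
move=> pRI [rad [val [cont [dual [loc [trans hom]]]]]] gl.
have pZ (a : R) z : p (a%:C * z) = a * p z.
  by case: pRI => ->; case: z => x y /=; rewrite mul0r ?subr0 ?addr0.
have pD z w : p (z + w) = p z + p w by case: pRI => ->; case: z w => x y [x' y'].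
split.
- by move=> f cf phi psi a b Cp Cq; rewrite (rad f cf).1// pD !pZ.
- move=> f cf K cK; have [C HC] := (rad f cf).2 K cK.
  exists C => phi M Cp sp bp; apply: le_trans (HC phi M Cp sp bp).
  by case: pRI => ->; rewrite ?lerDl ?lerDr.
- by move=> f h cf ch cm phi Cp; rewrite -!pD val.
- by move=> fs f cfs cf lu phi Cp; have [] := cont fs f cfs cf lu phi Cp; case: pRI => ->.
- by move=> f cf y c phi Cp; rewrite dual.
- by move=> f h cf ch U oU E phi Cp sp; rewrite (loc f h cf ch U oU E phi Cp sp).
- by move=> f cf a phi Cp; rewrite trans.
- by move=> f cf t t0 phi Cp; rewrite hom// pZ.
- by move=> g ug f cf phi Cp; rewrite gl// pZ.
Qed.

Lemma complex_parts_eq (z : R[i]) (a b r : R) :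
  complex.Re z = a * r -> complex.Im z = b * r -> z = (a +i* b) * r%:C.
Proof.
by case: z => x y /= -> ->; apply/eqP; rewrite eq_complex /= !mulr0 subr0 add0r !eqxx.
Qed.

End ComplexParts.

Local Open Scope complex_scope.

Theorem theorem5p6 (R : realType) (n k : nat) (Psi : mval R n) (q : R) :
  (1 <= n)%N ->
  MAVal k Psi ->
  (exists (f : 'rV[R]_n -> R) (phi : 'rV[R]_n -> R),
      convex_fun f /\ Cc phi /\ Psi f phi <> 0) ->
  GL_equivariant q Psi <->
  ((k = 0%N /\ q = -1 /\
     exists c : R[i], forall f, convex_fun f -> forall phi, Cc phi ->
       Psi f phi = c * lebesgue_n phi) \/
   (k = n /\ q = 1 /\
     exists c : R[i], forall f, convex_fun f -> forall phi, Cc phi ->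
       Psi f phi = c * monge_ampere f phi)).
Proof.
case: n Psi => [//|n] Psi _ MA [f0 [phi0 [cf0 [Cp0 nz]]]].
(* The zero valuation is equivariant for every weight. The given nonzero value supplies a nonzero
   coefficient in the real or the imaginary part, from which weight and degree are read off. *)
have nzc (a b r : R) : Psi f0 phi0 = (a +i* b) * r%:C -> a != 0 \/ b != 0.
  have [->|] := eqVneq a 0; last by left.
  have [->|] := eqVneq b 0; last by right.
  by rewrite (_ : 0 +i* 0 = 0)// mul0r.
split=> [gl|[[_ [-> [c Hc]]]|[_ [-> [c Hc]]]] g ug f cf phi Cp]; last 2 first.
- rewrite (Hc _ (convex_mulmx g cf) _ (Cc_mulmx ug Cp)) (Hc f)//.
  by rewrite /lebesgue_n lebesgue_scale// powR_inv1// rmorphM /= mulrCA.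
- rewrite (Hc _ (convex_mulmx g cf) _ (Cc_mulmx ug Cp)) (Hc f)//.
  by rewrite /monge_ampere monge_ampere_scale// powRr1// rmorphM /= mulrCA.
have evR := MAVal_part (or_introl erefl) MA gl.
have evI := MAVal_part (or_intror erefl) MA gl.
have [k0|kpos] := posnP k.
  left; rewrite k0 in evR evI.
  have [a [aq Ha]] := Psi_lebesgue evR; have [b [bq Hb]] := Psi_lebesgue evI.
  have H f : convex_fun f -> forall phi, Cc phi -> Psi f phi = (a +i* b) * lebesgue_n phi.
    by move=> cf phi Cp; apply: complex_parts_eq; [exact: Ha|exact: Hb].
  split=> //; split; last by exists (a +i* b).
  by have [/aq|/bq] := nzc _ _ _ (H _ cf0 _ Cp0).
right.
have [a [aq Ha]] := Psi_monge_ampere evR kpos; have [b [bq Hb]] := Psi_monge_ampere evI kpos.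
set s := simplex_vol R n in Ha Hb.
have H f : convex_fun f -> forall phi, Cc phi ->
    Psi f phi = ((a / s) +i* (b / s)) * monge_ampere f phi.
  by move=> cf phi Cp; apply: complex_parts_eq; [exact: Ha|exact: Hb].
have [q1 kn] : q = 1 /\ k = n.+1.
  have nz0 (v : R) : v / s != 0 -> v != 0 by apply: contra_neq => ->; rewrite mul0r.
  by have [/nz0/aq|/nz0/bq] := nzc _ _ _ (H _ cf0 _ Cp0).
by split=> //; split=> //; exists ((a / s) +i* (b / s)).
Qed.
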